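(* Let $k$ be a field, let $F$ be a non-cyclic free group, and let $\mathrm{Rel}\subseteq kF$ satisfy the Compatibility Axiom. Let $\mathrm{Mon}$ be the set of monomials of $\mathrm{Rel}$, let $\mathcal{S}$ be the set of small pieces with respect to $\mathrm{Rel}$, and let $\mathcal{S}'$ be the union of $\mathcal{S}$ and the set of all letters that belong to $\mathrm{Mon}$. Let $\Lambda'$ denote the measure on $\mathrm{Mon}$ defined by $\mathcal{S}'$. Let $\tau\geqslant 16$. Assume that: (i) $\mathrm{Rel}$ satisfies the strong Small Cancellation Axiom with constant $\theta=\tau+10$ with respect to $\Lambda'$-measure; (ii) $\mathrm{Rel}$ satisfies the Isolation Axiom with constant $\tau$ with respect to $\Lambda'$-measure; (iii) there exist non-empty reduced words that do not belong to $\mathrm{Mon}$; (iv) whenever both $u\in\mathrm{Mon}$ and $u^{-1}\in\mathrm{Mon}$, one has $\Lambda'(u)=\Lambda'(u^{-1})$. Then the $k$-algebra $kF/\langle\langle \mathrm{Rel}\rangle\rangle$ is non-amenable.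
   Context: **Non-amenability.** An algebra $R$ over a field $k$ is called non-amenable if there exist $\varepsilon>0$ and a finite-dimensional subspace $S\subseteq R$ such that for every (non-zero) finite-dimensional subspace $H\subseteq R$ there exists $s\in S$ with $\dim_k((H+sH)/H)/\dim_k(H)\geqslant\varepsilon$. **Words and polynomials.** A basis (set of free generators) of the free group $F$ is fixed; the free generators and their inverses are called letters. Elements of $F$, identified with reduced words, are called words or monomials; elements of the group algebra $kF$ are called polynomials. For monomials $A,B$, $A\cdot B$ is their product in $F$; $AB$ (without the dot) denotes the product when there is no cancellation. $1$ is the empty word. $\langle\langle \mathrm{Rel}\rangle\rangle$ is the two-sided ideal of $kF$ generated by $\mathrm{Rel}$. $\mathrm{Mon}\subseteq F$ is the set of all monomials that occur with non-zero coefficient in some polynomial of $\mathrm{Rel}$. **Compatibility Axiom.** $\mathrm{Rel}$ is closed under multiplication by elements of $k$, and under left (respectively right) multiplication by a letter that cancels with the first (respectively last) letter of some monomial of the polynomial: if $p\in\mathrm{Rel}$ has a monomial beginning with the letter $x$, then $x^{-1}\cdot p\in\mathrm{Rel}$, and if $p$ has a monomial ending with $x$, then $p\cdot x^{-1}\in\mathrm{Rel}$. (Consequently $\mathrm{Mon}$ is closed under taking subwords.) **Small pieces.** Let $c\in\mathrm{Mon}$. Suppose there are $p,q\in\mathrm{Rel}$ such that $p$ contains a monomial $\widehat a_1c\widehat a_2$ and $q$ contains a monomial $\widehat b_1c\widehat b_2$ (the words $\widehat a_i,\widehat b_i$ may be empty) and at least one of $\widehat b_1\cdot\widehat a_1^{-1}\cdot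 p$ and $p\cdot\widehat a_2^{-1}\cdot\widehat b_2$ is not in $\mathrm{Rel}$. Then $c$ is called a small piece with respect to $\mathrm{Rel}$. The empty word is by definition always a small piece. The set of small pieces is $\mathcal{S}$; it is closed under taking subwords, and so is $\mathcal{S}'$. **Measure.** For $u\in\mathrm{Mon}$, $\Lambda'(u)$ is the smallest $t$ such that $u$ is a concatenation of $t$ elements of $\mathcal{S}'$ ($\infty$ if there is no such $t$). **Strong Small Cancellation Axiom with constant $\theta$ (with respect to $\Lambda'$).** Every non-zero element of the $k$-linear span of $\mathrm{Rel}$ contains, with non-zero coefficient after additive cancellations, a monomial $a$ with $\Lambda'(a)\geqslant\theta$. **Incident monomials; maximal occurrences.** Two monomials are incident if they both occur in one and the same polynomial of $\mathrm{Rel}$. An occurrence of $u\in\mathrm{Mon}$ in a word $A$ is a subword $u$ of $A$ together with its position. It is maximal if it is not properly contained in another occurrence in $A$ of an element of $\mathrm{Mon}$. **Isolation Axiom with constant $\tau$ (with respect to $\Lambda'$).** It consists of a left-sided and a right-sided condition. *Left-sided.* Let $m_1,\dots,m_K\in\mathrm{Mon}$ be such that $m_1\neq m_K$, $m_i,m_{i+1}$ are incident for $1\leqslant i<K$, and $\Lambda'(m_i)\geqslant\tau-2$ for all $i$. Let $a\in\mathrm{Mon}$ be such that: $\Lambda'(a)\geqslant\tau-2$; the products $am_1$ and $am_K$ have no cancellations and $am_1,am_K\notin\mathrm{Mon}$; $m_1$ is a maximal occurrence in $am_1$ and $m_K$ is a maximal occurrence in $am_K$. Let $ap_1$ be the maximal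 occurrence in $am_1$ containing $a$ and $ap_K$ the maximal occurrence in $am_K$ containing $a$ (so $p_1$ is a possibly empty prefix of $m_1$ and $p_K$ is a possibly empty prefix of $m_K$). Assume there exist $l,l'\in\mathcal{S}'$ such that $la$ and $l'a$ have no cancellations and belong to $\mathrm{Mon}$, and a sequence $b_1,\dots,b_n\in\mathrm{Mon}$ with $b_1=lap_1$, $b_n=l'ap_K$, $b_i,b_{i+1}$ incident for $1\leqslant i<n$, and $\Lambda'(b_i)\geqslant\tau-2$ for all $i$. Then it is required that $p_1^{-1}\cdot m_1\neq p_K^{-1}\cdot m_K$. *Right-sided.* The mirror image: $a$ is placed to the right of $m_1,m_K$ (words $m_1a$, $m_Ka$); $p_1a$, $p_Ka$ are the maximal occurrences containing $a$ (with $p_1,p_K$ suffixes of $m_1,m_K$); there are $r,r'\in\mathcal{S}'$ with $ar,ar'\in\mathrm{Mon}$ without cancellations; the sequence $b_1,\dots,b_n$ goes from $b_1=p_1ar$ to $b_n=p_Kar'$; and it is required that $m_1\cdot p_1^{-1}\neq m_K\cdot p_K^{-1}$. *)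

(* Defs.v *)
From HB Require Import structures.
From mathcomp Require Import all_boot all_order all_algebra.
From mathcomp Require Import finmap monalg.
From mathcomp Require Import boolp classical_sets reals constructive_ereal.

Set Implicit Arguments.
Unset Strict Implicit.
Unset Printing Implicit Defensive.

Import Order.TTheory GRing.Theory Num.Theory.

(* The letter [(x, false)] is the generator [x], [(x, true)] is its inverse. *)
Definition letter (X : choiceType) : Type := (X * bool)%type.
HB.instance Definition _ (X : choiceType) := Choice.on (letter X).

Section FreeGroup.
Context {X : choiceType}.
Local Notation L := (letter X).
Implicit Types (a b : L) (u v w : seq L).

Definition linv a : L := (a.1, ~~ a.2).

Definition reduced w : bool := sorted (fun a b => b != linv a) w.

Record free_group : predArgType :=
  Word { letters :> seq L; letters_reduced : reduced letters }.
HB.instance Definition _ := [isSub for letters].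
HB.instance Definition _ := [Choice of free_group by <:].

Definition lcons a w : seq L :=
  if w is b :: w' then if b == linv a then w' else a :: w else [:: a].

Definition lcat u v : seq L := foldr lcons v u.

Lemma linvK : involutive linv.
Proof. by case=> x e; rewrite /linv /= negbK. Qed.

Lemma reduced_behead a w : reduced (a :: w) -> reduced w.
Proof. exact: path_sorted. Qed.

Lemma lcons_reduced a w : reduced w -> reduced (lcons a w).
Proof.
case: w => [//|b w] /= rw; case: ifPn => [_|nb]; first exact: path_sorted rw.
by rewrite /= nb rw.
Qed.

Lemma lcat_reduced u v : reduced v -> reduced (lcat u v).
Proof. by move=> rv; elim: u => //= a u; apply: lcons_reduced. Qed.

Lemma lconsK a w : reduced w -> lcons a (lcons (linv a) w) = w.
Proof.
case: w => [|b w] /= rw; first by rewrite eqxx.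
rewrite linvK; case: eqVneq rw => [->|_] rw; last by rewrite /= eqxx.
by case: w rw => [//|c w] /= /andP[/negPf -> _].
Qed.

Lemma lcatA u v w : reduced v -> reduced w ->
  lcat (lcat u v) w = lcat u (lcat v w).
Proof.
move=> rv rw; elim: u => //= a u <-.
case: (lcat u v) (lcat_reduced u rv) => [//|b t] /= rt.
case: ifPn => [/eqP ->|//]; rewrite lconsK //; exact: lcat_reduced.
Qed.

Lemma lcat0 w : reduced w -> lcat w [::] = w.
Proof.
elim: w => //= a w IHw rw; rewrite IHw ?(reduced_behead rw) //.
by case: w rw {IHw} => //= b w /andP[/negPf ->].
Qed.

Definition winv w : seq L := rev (map linv w).

Lemma winv_reduced w : reduced w -> reduced (winv w).
Proof.
rewrite /reduced /winv rev_sorted sorted_map; apply: sub_sorted => a b.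
by rewrite /= (inj_eq (inv_inj linvK)); apply: contraNneq => ->; rewrite linvK.
Qed.

Lemma lcat_cat u v w : lcat (u ++ v) w = lcat u (lcat v w).
Proof. exact: foldr_cat. Qed.

Lemma winvK : involutive winv.
Proof. by move=> w; rewrite /winv map_rev revK mapK //; exact: linvK. Qed.

Lemma lcatVg w v : reduced w -> reduced v -> lcat w (lcat (winv w) v) = v.
Proof.
elim: w v => //= a w IHw v raw rv; have rw := reduced_behead raw.
rewrite /winv /= rev_cons -cats1 lcat_cat /=.
by rewrite -/(winv w) IHw ?lconsK //; apply: lcons_reduced.
Qed.

Definition fg_one : free_group := @Word [::] isT.
Definition fg_mul (u v : free_group) : free_group :=
  Word (lcat_reduced u (letters_reduced v)).
Definition fg_inv (u : free_group) : free_group :=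
  Word (winv_reduced (letters_reduced u)).

Fact fg_mulA : associative fg_mul.
Proof.
by move=> u v w; apply: val_inj; rewrite /= lcatA // letters_reduced.
Qed.

Fact fg_mul1 : left_id fg_one fg_mul.
Proof. by move=> u; apply: val_inj. Qed.

Fact fg_mulr1 : right_id fg_one fg_mul.
Proof. by move=> u; apply: val_inj; rewrite /= lcat0 // letters_reduced. Qed.

Fact fg_mulrV : right_inverse fg_one fg_inv fg_mul.
Proof.
move=> u; apply: val_inj => /=; have ru := letters_reduced u.
by rewrite -[RHS](lcatVg ru (isT : reduced [::])) lcat0 // winv_reduced.
Qed.

Fact fg_mulV : left_inverse fg_one fg_inv fg_mul.
Proof.
move=> u; rewrite -[RHS](fg_mulrV (fg_inv u)); congr fg_mul.
by apply: val_inj; rewrite /= winvK.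
Qed.

HB.instance Definition _ :=
  isGroup.Build free_group fg_mulA fg_mul1 fg_mulr1 fg_mulV fg_mulrV.

Definition letter_word a : free_group := @Word [:: a] isT.

End FreeGroup.
Arguments free_group X : clear implicits.

Definition cyclic_group (G : groupType) : Prop :=
  exists g : G, forall h : G, exists n : nat, (h = g ^+ n \/ h = g ^- n)%g.

Local Open Scope ring_scope.
Local Open Scope classical_set_scope.

(* Unital associative [k]-algebras; unlike for [algType k], [1 = 0] is allowed,
   so that every quotient by a two-sided ideal is one. *)
Record kalgebra (k : fieldType) := KAlgebra {
  kalg_module :> lmodType k;
  kalg_one : kalg_module;
  kalg_mul : kalg_module -> kalg_module -> kalg_module;
  kalg_mulA : associative kalg_mul;
  kalg_mul1l : left_id kalg_one kalg_mul;
  kalg_mul1r : right_id kalg_one kalg_mul;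
  kalg_mulDl : left_distributive kalg_mul +%R;
  kalg_mulDr : right_distributive kalg_mul +%R;
  kalg_scaleAl : forall (c : k) x y, c *: kalg_mul x y = kalg_mul (c *: x) y;
  kalg_scaleAr : forall (c : k) x y, c *: kalg_mul x y = kalg_mul x (c *: y)
}.

(* The library makes [{malg k[G]}] a ring only when [G] has no non-trivial unit,
   hence a new name for the same module of finitely supported functions. *)
Definition group_algebra (k : fieldType) (G : groupType) : Type := {malg k[G]}.

Section GroupAlgebra.
Context {k : fieldType} {G : groupType}.
Local Notation kG := {malg k[G]}.
Implicit Types (p q : kG) (g h : G).

Definition gsupp (p : group_algebra k G) : {fset G} := msupp p.

Definition gmon g : group_algebra k G := << 1 *g g >>.

Definition ga_mul p q : kG :=
  \sum_(g <- msupp p) \sum_(h <- msupp q) << p@_g * q@_h *g (g * h)%g >>.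

Fact ga_mulw (d1 d2 : {fset G}) p q :
  (msupp p `<=` d1)%fset -> (msupp q `<=` d2)%fset ->
  ga_mul p q = \sum_(g <- d1) \sum_(h <- d2) << p@_g * q@_h *g (g * h)%g >>.
Proof.
move=> le1 le2; rewrite /ga_mul (big_fset_incl _ le1) /=.
  apply/eq_bigr=> g _; apply/big_fset_incl => // h _ /mcoeff_outdom ->.
  by rewrite mulr0 monalgU0.
move=> g _ /mcoeff_outdom pg.
by rewrite big1 // => h _; rewrite pg mul0r monalgU0.
Qed.

Fact ga_mulDl : left_distributive ga_mul +%R.
Proof.
move=> p1 p2 q.
rewrite [in RHS](ga_mulw (fsubsetUl _ (msupp p2)) (fsubset_refl _)).
rewrite [in RHS](ga_mulw (fsubsetUr (msupp p1) _) (fsubset_refl _)).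
rewrite (ga_mulw (msuppD_le _ _) (fsubset_refl _)).
rewrite -big_split /=; apply/eq_bigr=> g _.
rewrite -big_split /=; apply/eq_bigr=> h _.
by rewrite mcoeffD mulrDl monalgUD.
Qed.

Fact ga_mulDr : right_distributive ga_mul +%R.
Proof.
move=> q p1 p2.
rewrite [in RHS](ga_mulw (fsubset_refl _) (fsubsetUl _ (msupp p2))).
rewrite [in RHS](ga_mulw (fsubset_refl _) (fsubsetUr (msupp p1) _)).
rewrite (ga_mulw (fsubset_refl _) (msuppD_le _ _)).
rewrite -big_split /=; apply/eq_bigr=> g _.
rewrite -big_split /=; apply/eq_bigr=> h _.
by rewrite mcoeffD mulrDr monalgUD.
Qed.

Fact ga_mul0l : left_zero 0 ga_mul.
Proof. by move=> p; rewrite /ga_mul msupp0 big_seq_fset0. Qed.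

Fact ga_mul0r : right_zero 0 ga_mul.
Proof.
by move=> p; rewrite /ga_mul big1 // => g _; rewrite msupp0 big_seq_fset0.
Qed.

Fact ga_mulUU (c d : k) g h :
  ga_mul << c *g g >> << d *g h >> = << c * d *g (g * h)%g >>.
Proof. by rewrite (ga_mulw msuppU_le msuppU_le) !big_seq_fset1 !mcoeffUU. Qed.

Fact ga_mul_suml (I : Type) (r : seq I) (F : I -> kG) q :
  ga_mul (\sum_(i <- r) F i) q = \sum_(i <- r) ga_mul (F i) q.
Proof. exact: (big_morph (ga_mul^~ q) (fun _ _ => ga_mulDl _ _ _) (ga_mul0l q)). Qed.

Fact ga_mul_sumr (I : Type) (r : seq I) (F : I -> kG) p :
  ga_mul p (\sum_(i <- r) F i) = \sum_(i <- r) ga_mul p (F i).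
Proof. exact: (big_morph (ga_mul p) (fun _ _ => ga_mulDr _ _ _) (ga_mul0r p)). Qed.

Fact ga_mulA : associative ga_mul.
Proof.
move=> p q r; rewrite [p]monalgE !ga_mul_suml; apply: eq_bigr => g _.
rewrite [q]monalgE ga_mul_suml !ga_mul_sumr ga_mul_suml.
apply: eq_bigr => h _; rewrite [r]monalgE !ga_mul_sumr.
apply: eq_bigr => i _.
by rewrite !ga_mulUU mulrA mulgA.
Qed.

Fact ga_mul1l : left_id (gmon 1%g : kG) ga_mul.
Proof.
move=> p; rewrite [p]monalgE ga_mul_sumr; apply: eq_bigr => g _.
by rewrite ga_mulUU mul1r mul1g.
Qed.

Fact ga_mul1r : right_id (gmon 1%g : kG) ga_mul.
Proof.
move=> p; rewrite [p]monalgE ga_mul_suml; apply: eq_bigr => g _.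
by rewrite ga_mulUU mulr1 mulg1.
Qed.

Fact ga_one_neq0 : (gmon 1%g : kG) != 0.
Proof. by rewrite monalgU_eq0 oner_eq0. Qed.

Fact ga_scaleU (c d : k) g : c *: (<< d *g g >> : kG) = << c * d *g g >>.
Proof. by apply/malgP => h; rewrite mcoeffZ !mcoeffU mulrnAr. Qed.

Fact ga_scaleAl (c : k) p q : c *: ga_mul p q = ga_mul (c *: p) q.
Proof.
rewrite [p]monalgE ga_mul_suml !scaler_sumr ga_mul_suml.
apply: eq_bigr => g _; rewrite [q]monalgE ga_scaleU !ga_mul_sumr scaler_sumr.
by apply: eq_bigr => h _; rewrite !ga_mulUU ga_scaleU mulrA.
Qed.

Fact ga_scaleAr (c : k) p q : c *: ga_mul p q = ga_mul p (c *: q).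
Proof.
rewrite [q]monalgE ga_mul_sumr !scaler_sumr ga_mul_sumr.
apply: eq_bigr => h _; rewrite [p]monalgE ga_scaleU !ga_mul_suml scaler_sumr.
by apply: eq_bigr => g _; rewrite !ga_mulUU ga_scaleU mulrCA.
Qed.

HB.instance Definition _ := GRing.Lmodule.on (group_algebra k G).
HB.instance Definition _ := GRing.Zmodule_isNzRing.Build (group_algebra k G)
  ga_mulA ga_mul1l ga_mul1r ga_mulDl ga_mulDr ga_one_neq0.
HB.instance Definition _ :=
  GRing.Lmodule_isLalgebra.Build k (group_algebra k G) ga_scaleAl.
HB.instance Definition _ :=
  GRing.Lalgebra_isAlgebra.Build k (group_algebra k G) ga_scaleAr.

End GroupAlgebra.
Arguments gmon k {G} g.

Definition is_subspace (k : pzRingType) (V : lmodType k) (U : set V) : Prop :=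
  U 0 /\ forall (c : k) u v, U u -> U v -> U (c *: u + v).

Definition linear_span (k : pzRingType) (V : lmodType k) (P : set V) : set V :=
  smallest (@is_subspace k V) P.

Definition is_ideal (A : pzRingType) (I : set A) : Prop :=
  [/\ I 0, forall x y, I x -> I y -> I (x - y),
      forall a x, I x -> I (a * x) & forall a x, I x -> I (x * a)].

Definition ideal_gen (A : pzRingType) (P : set A) : set A :=
  smallest (@is_ideal A) P.

Lemma ideal_gen_ideal (A : pzRingType) (P : set A) : is_ideal (ideal_gen P).
Proof.
split.
- by move=> I [[]].
- by move=> x y Ix Iy I PI; case: (PI) => -[_ + _ _] _; apply; [apply: Ix|apply: Iy].
- by move=> a x Ix I PI; case: (PI) => -[_ _ + _] _; apply; apply: Ix.
- by move=> a x Ix I PI; case: (PI) => -[_ _ _ +] _; apply; apply: Ix.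
Qed.

Definition ideal_pred (A : pzRingType) (P : set A) : {pred A} :=
  fun x => `[< ideal_gen P x >].

Section IdealPred.
Context {A : pzRingType} (P : set A).
Local Notation J := (ideal_pred P).

Fact ideal_pred_zmod : zmod_closed J.
Proof.
case: (ideal_gen_ideal P) => I0 IB _ _; split; first exact/asboolP.
by move=> x y /asboolP Ix /asboolP Iy; apply/asboolP; apply: IB.
Qed.

HB.instance Definition _ := GRing.isZmodClosed.Build A J ideal_pred_zmod.

Fact ideal_pred_mull a x : x \in J -> a * x \in J.
Proof.
case: (ideal_gen_ideal P) => _ _ IM _ /asboolP Ix; apply/asboolP.
exact: IM.
Qed.

Fact ideal_pred_mulr a x : x \in J -> x * a \in J.
Proof.
case: (ideal_gen_ideal P) => _ _ _ IM /asboolP Ix; apply/asboolP.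
exact: IM.
Qed.

End IdealPred.

Definition quotient_space (k : fieldType) (A : algType k) (P : set A) : Type :=
  Quotient.quot (ideal_pred P).
HB.instance Definition _ (k : fieldType) (A : algType k) (P : set A) :=
  GRing.Zmodule.on (quotient_space P).

Section QuotientAlgebra.
Context {k : fieldType} {A : algType k} (P : set A).
Local Notation J := (ideal_pred P).
Local Notation Q := (quotient_space P).
Local Open Scope quotient_scope.

Definition quot_proj (x : A) : Q := \pi_(Quotient.quot J) x.

Definition quot_repr (x : Q) : A := repr (x : Quotient.quot J).

Fact quot_projK x : quot_proj (quot_repr x) = x.
Proof. exact: reprK. Qed.

Fact quot_projP x y : (quot_proj x = quot_proj y) <-> (x - y \in J).
Proof.
by split=> [/eqP|Jxy]; rewrite /quot_proj -?Quotient.idealrBE // ; apply/eqP;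
   rewrite -Quotient.idealrBE.
Qed.

Fact quot_projD x y : quot_proj (x + y) = quot_proj x + quot_proj y.
Proof. exact: (Quotient.pi_add (ideal_pred P)). Qed.

Fact quot_reprP x : quot_repr (quot_proj x) - x \in J.
Proof. by apply/quot_projP; rewrite quot_projK. Qed.

Definition quot_one : Q := quot_proj 1.
Definition quot_mul (x y : Q) : Q := quot_proj (quot_repr x * quot_repr y).
Definition quot_scale (c : k) (x : Q) : Q := quot_proj (c *: quot_repr x).

Lemma quot_projM x y : quot_mul (quot_proj x) (quot_proj y) = quot_proj (x * y).
Proof.
apply/quot_projP; set x' := quot_repr _; set y' := quot_repr _.
have -> : x' * y' - x * y = (x' - x) * y' + x * (y' - y).
  by rewrite mulrBl mulrBr addrA subrK.
by apply: rpredD; [apply: ideal_pred_mulr|apply: ideal_pred_mull];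
   apply: quot_reprP.
Qed.

Lemma quot_projZ c x : quot_scale c (quot_proj x) = quot_proj (c *: x).
Proof.
apply/quot_projP; rewrite -scalerBr -[_ - x]mul1r scalerAl.
by apply: ideal_pred_mull; apply: quot_reprP.
Qed.

Fact quot_mulA : associative quot_mul.
Proof.
by move=> x y z; rewrite -[x]quot_projK -[y]quot_projK -[z]quot_projK !quot_projM mulrA.
Qed.

Fact quot_mul1 : left_id quot_one quot_mul.
Proof. by move=> x; rewrite -[x]quot_projK quot_projM mul1r. Qed.

Fact quot_mulr1 : right_id quot_one quot_mul.
Proof. by move=> x; rewrite -[x]quot_projK quot_projM mulr1. Qed.

Fact quot_mulDl : left_distributive quot_mul +%R.
Proof.
move=> x y z; rewrite -[x]quot_projK -[y]quot_projK -[z]quot_projK.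
by rewrite -quot_projD !quot_projM -quot_projD mulrDl.
Qed.

Fact quot_mulDr : right_distributive quot_mul +%R.
Proof.
move=> x y z; rewrite -[x]quot_projK -[y]quot_projK -[z]quot_projK.
by rewrite -quot_projD !quot_projM -quot_projD mulrDr.
Qed.

Fact quot_scaleA c d x : quot_scale c (quot_scale d x) = quot_scale (c * d) x.
Proof. by rewrite -[x]quot_projK !quot_projZ scalerA. Qed.

Fact quot_scale1 : left_id 1 quot_scale.
Proof. by move=> x; rewrite -[x]quot_projK quot_projZ scale1r. Qed.

Fact quot_scaleDr : right_distributive quot_scale +%R.
Proof.
move=> c x y; rewrite -[x]quot_projK -[y]quot_projK.
by rewrite -quot_projD !quot_projZ -quot_projD scalerDr.
Qed.

Fact quot_scaleDl x : {morph quot_scale^~ x : c d / c + d}.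
Proof. by move=> c d; rewrite -[x]quot_projK !quot_projZ -quot_projD scalerDl. Qed.

HB.instance Definition _ := GRing.Zmodule_isLmodule.Build k Q
  quot_scaleA quot_scale1 quot_scaleDr quot_scaleDl.

Fact quot_scaleAl (c : k) (x y : Q) : c *: quot_mul x y = quot_mul (c *: x) y.
Proof.
change (quot_scale c (quot_mul x y) = quot_mul (quot_scale c x) y).
rewrite -[x]quot_projK -[y]quot_projK quot_projM !quot_projZ quot_projM.
by rewrite scalerAl.
Qed.

Fact quot_scaleAr (c : k) (x y : Q) : c *: quot_mul x y = quot_mul x (c *: y).
Proof.
change (quot_scale c (quot_mul x y) = quot_mul x (quot_scale c y)).
rewrite -[x]quot_projK -[y]quot_projK quot_projM !quot_projZ quot_projM.
by rewrite scalerAr.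
Qed.

Definition quotient_algebra : kalgebra k :=
  @KAlgebra k Q quot_one quot_mul quot_mulA quot_mul1 quot_mulr1
    quot_mulDl quot_mulDr quot_scaleAl quot_scaleAr.

End QuotientAlgebra.

Section Amenability.
Context {k : fieldType}.

(* [dim_k (U / W) = n], for subspaces [W] and [U] of [V] with [W] included in
   [U]: the cosets of [e 0, ..., e (n - 1)] form a basis of [U / W]. *)
Definition has_dim_quotient (V : lmodType k) (U W : set V) (n : nat) : Prop :=
  exists e : 'I_n -> V, (forall i, U (e i)) /\
    forall u, U u ->
      exists! c : {ffun 'I_n -> k}, W (u - \sum_(i < n) c i *: e i).

Definition has_dim (V : lmodType k) (U : set V) (n : nat) : Prop :=
  has_dim_quotient U [set 0] n.

Definition findim_subspace (V : lmodType k) (U : set V) : Prop :=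
  is_subspace U /\ exists n, has_dim U n.

Definition nonamenable (R : realType) (A : kalgebra k) : Prop :=
  exists eps : R, 0 < eps /\
  exists S : set A, findim_subspace S /\
  forall H : set A, findim_subspace H -> H <> [set 0] ->
  exists s, S s /\
  exists d h : nat,
    [/\ has_dim_quotient [set x + kalg_mul s y | x in H & y in H] H d,
        has_dim H h & eps <= d%:R / h%:R].

End Amenability.

Section SmallCancellation.
Context {k : fieldType} {X : choiceType}.
Local Notation F := (free_group X).
Local Notation kF := (group_algebra k F).
Implicit Types (u v w : F) (x : letter X).

(* The product of reduced words has no cancellations iff their concatenation is
   reduced. *)
Definition no_cancel (s : seq F) : Prop := reduced (flatten (map letters s)).

Definition Mon (Rel : set kF) : set F :=
  [set u | exists2 p : kF, Rel p & u \in gsupp p].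

Definition compatibility_axiom (Rel : set kF) : Prop :=
  [/\ forall (c : k) (p : kF), Rel p -> Rel (c *: p),
      forall (p : kF) x w, Rel p -> w \in gsupp p ->
        (exists t : seq (letter X), letters w = x :: t) ->
        Rel (gmon k (letter_word x)^-1%g * p)
    & forall (p : kF) x w, Rel p -> w \in gsupp p ->
        (exists t : seq (letter X), letters w = rcons t x) ->
        Rel (p * gmon k (letter_word x)^-1%g)].

Definition small_piece (Rel : set kF) (c : F) : Prop :=
  c = 1%g \/
  (Mon Rel c /\
   exists (p q : kF) (a1 a2 b1 b2 : F),
     [/\ Rel p /\ Rel q,
         no_cancel [:: a1; c; a2] /\ (a1 * c * a2)%g \in gsupp p,
         no_cancel [:: b1; c; b2] /\ (b1 * c * b2)%g \in gsupp q
       & ~ Rel (gmon k (b1 * a1^-1)%g * p) \/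
         ~ Rel (p * gmon k (a2^-1 * b2)%g)]).

Definition small_piece' (Rel : set kF) : set F :=
  [set c | small_piece Rel c \/
           exists2 x, c = letter_word x & Mon Rel (letter_word x)].

Definition is_concatenation (P : set F) (u : F) (t : nat) : Prop :=
  exists s : seq F, [/\ size s = t, forall c, c \in s -> P c
    & letters u = flatten (map letters s)].

Definition measure' (R : realType) (Rel : set kF) (u : F) : \bar R :=
  if pselect (exists t, `[< is_concatenation (small_piece' Rel) u t >])
    is left ex_t then (ex_minn ex_t)%:R%:E else +oo%E.

Definition strong_small_cancellation_axiom
    (R : realType) (Rel : set kF) (theta : R) : Prop :=
  forall f : kF, linear_span Rel f -> f <> 0 ->
    exists2 a : F, a \in gsupp f & (theta%:E <= measure' R Rel a)%E.

Definition incident (Rel : set kF) (u v : F) : Prop :=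
  exists2 p : kF, Rel p & u \in gsupp p /\ v \in gsupp p.

(* Only the values [m 1, ..., m K] of [m] matter. *)
Definition incident_chain (R : realType) (Rel : set kF) (tau : R)
    (u v : F) : Prop :=
  exists (K : nat) (m : nat -> F),
    [/\ (0 < K)%N, m 1%N = u /\ m K = v,
        forall i, (1 <= i <= K)%N ->
          Mon Rel (m i) /\ ((tau - 2)%:E <= measure' R Rel (m i))%E
      & forall i, (1 <= i < K)%N -> incident Rel (m i) (m i.+1)].

(* The position [i] of an occurrence is the length of what precedes it. *)
Definition occurs_at (w : F) (i : nat) (u : F) : Prop :=
  exists s t : seq (letter X), size s = i /\ letters w = s ++ letters u ++ t.

Definition maximal_occurrence (Rel : set kF) (w : F) (i : nat) (u : F) : Prop :=
  [/\ Mon Rel u, occurs_at w i u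
    & forall j v, Mon Rel v -> occurs_at w j v ->
        (j <= i)%N -> (i + size u <= j + size v)%N -> j = i /\ v = u].

(* A maximal occurrence in [a * m1] that contains the prefix [a] starts at
   position [0], so it is [a * p1] for a prefix [p1] of [m1]. When [2 < tau] the
   word [a] is not empty, hence [l * a * p1] has no cancellations either. *)
Definition left_isolation (R : realType) (Rel : set kF) (tau : R) : Prop :=
  forall m1 mK a p1 pK : F,
  m1 <> mK -> incident_chain Rel tau m1 mK ->
  Mon Rel a -> ((tau - 2)%:E <= measure' R Rel a)%E ->
  no_cancel [:: a; m1] -> no_cancel [:: a; mK] ->
  ~ Mon Rel (a * m1)%g -> ~ Mon Rel (a * mK)%g ->
  maximal_occurrence Rel (a * m1)%g (size a) m1 ->
  maximal_occurrence Rel (a * mK)%g (size a) mK ->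
  prefix p1 m1 -> maximal_occurrence Rel (a * m1)%g 0 (a * p1)%g ->
  prefix pK mK -> maximal_occurrence Rel (a * mK)%g 0 (a * pK)%g ->
  (exists l l' : F,
    [/\ small_piece' Rel l /\ small_piece' Rel l',
        no_cancel [:: l; a] /\ Mon Rel (l * a)%g,
        no_cancel [:: l'; a] /\ Mon Rel (l' * a)%g
      & incident_chain Rel tau (l * a * p1)%g (l' * a * pK)%g]) ->
  (p1^-1 * m1)%g <> (pK^-1 * mK)%g.

Definition right_isolation (R : realType) (Rel : set kF) (tau : R) : Prop :=
  forall m1 mK a p1 pK : F,
  m1 <> mK -> incident_chain Rel tau m1 mK ->
  Mon Rel a -> ((tau - 2)%:E <= measure' R Rel a)%E ->
  no_cancel [:: m1; a] -> no_cancel [:: mK; a] ->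
  ~ Mon Rel (m1 * a)%g -> ~ Mon Rel (mK * a)%g ->
  maximal_occurrence Rel (m1 * a)%g 0 m1 ->
  maximal_occurrence Rel (mK * a)%g 0 mK ->
  suffix p1 m1 ->
  maximal_occurrence Rel (m1 * a)%g (size m1 - size p1) (p1 * a)%g ->
  suffix pK mK ->
  maximal_occurrence Rel (mK * a)%g (size mK - size pK) (pK * a)%g ->
  (exists r r' : F,
    [/\ small_piece' Rel r /\ small_piece' Rel r',
        no_cancel [:: a; r] /\ Mon Rel (a * r)%g,
        no_cancel [:: a; r'] /\ Mon Rel (a * r')%g
      & incident_chain Rel tau (p1 * a * r)%g (pK * a * r')%g]) ->
  (m1 * p1^-1)%g <> (mK * pK^-1)%g.

Definition isolation_axiom (R : realType) (Rel : set kF) (tau : R) : Prop :=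
  left_isolation Rel tau /\ right_isolation Rel tau.

End SmallCancellation.

(* Main.v *)
Require Import Defs.
From HB Require Import structures.
From mathcomp Require Import all_boot all_order all_algebra.
From mathcomp Require Import finmap monalg.
From mathcomp Require Import boolp classical_sets reals constructive_ereal.
From mathcomp Require Import zify.

Set Implicit Arguments.
Unset Strict Implicit.
Unset Printing Implicit Defensive.

Import Order.TTheory GRing.Theory Num.Theory.

(* Give a word the weight of its cheapest partition into letters and elements of
   [Mon], an element of [Mon] costing one more than its measure truncated just above
   [tau - 2].  Around a maximal occurrence of an element of [Mon] of large measure the
   weight splits as a sum, so replacing this occurrence by an incident monomial never
   increases the weight.  By strong small cancellation the span of the relations that
   can be applied at a given place has a reduced basis whose leading monomials are
   large, and isolation makes the choice of these monomials compatible with the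
   replacements made at the neighbouring occurrences.  Reducing the leftmost reducible
   occurrence thus terminates and defines a linear normal form [Phi] that is the
   identity modulo the ideal and, since the overlaps of relations are resolved by
   induction, kills the ideal.

   [Phi] does not increase weights, not even after multiplication on the left by a
   word that cannot cancel a long part of an element of [Mon].  Out of a shortest word
   outside [Mon] one builds, for three letters [y], words [Y], [Z] beginning with [y]
   and a letter [g] such that, with [s_y = Y g Z^-1], the heaviest words of the normal
   form of [s_y f] begin with [y] whenever those of [f] do not begin with [Z].  Take a
   basis of [H] whose normal forms are in echelon form with respect to their heaviest
   words.  Each of its elements is excluded for at most one [y], and the remaining
   products by the [s_y] are linearly independent, so the sum of the [s_y H] has
   dimension at least [2 dim H] and some [s_y] moves [H] by at least [dim H / 3]. *)

(** Maximal occurrences overlap in small pieces, so replacing one of them may change the ends of its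
    neighbours. One such change costs one unit of measure; the obstacle is that many could add up.
    They do not, because along a whole path of replacements to its right an occurrence changes only
    in its overlap with one and the same neighbour. Hence largeness can be defined up to such moves
    at the price of a single unit. The moves might still bring a monomial back as a different
    incident one, and this is the configuration that isolation forbids.

    Let [C] be the least integer at least [tau - 2], so that the threshold [tau + 10] reads
    [C + 12]. Of these 12 units, 9 may be cancelled by a multiplier, and one at each end of the
    occurrence may be lost to a neighbour or to an interval of a partition crossing that end. What
    remains is [C + 1], the level of truncation: one unit above [C], since isolation is applied to
    the neighbour after one more small piece has been cut off. *)

HB.lock Definition wd {X : choiceType} (s : seq (letter X)) : free_group X :=
  Word (lcat_reduced s (isT : reduced (@nil (letter X)))).

HB.lock Definition tr {k : fieldType} {G : groupType} (g : G)
  (p : group_algebra k G) (h : G) : group_algebra k G :=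
  (gmon k g * p * gmon k h)%R.

(** * Free reduction of sequences of letters *)

Section Words.
Context {X : choiceType}.
Local Notation L := (letter X).
Local Notation F := (free_group X).
Implicit Types (x y z : L) (s t u v : seq L).

Lemma letters_wd s : reduced s -> letters (wd s) = s.
Proof. by move=> rs; rewrite wd.unlock /= lcat0. Qed.

Lemma wdK (u : F) : wd (letters u) = u.
Proof. by apply: val_inj; rewrite [LHS]letters_wd // letters_reduced. Qed.

Lemma wd_cat s t : wd (s ++ t) = (wd s * wd t)%g.
Proof.
apply: val_inj; rewrite wd.unlock /= lcat_cat lcatA //.
exact: lcat_reduced.
Qed.

Lemma wd_cons x s : wd (x :: s) = (wd [:: x] * wd s)%g.
Proof. exact: (wd_cat [:: x]). Qed.

Lemma wd_rcons s x : wd (rcons s x) = (wd s * wd [:: x])%g.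
Proof. by rewrite -cats1 wd_cat. Qed.

Lemma wd0 : wd (@nil L) = 1%g.
Proof. by apply: val_inj; rewrite [LHS]letters_wd. Qed.

Lemma wd_inj s t : reduced s -> reduced t -> wd s = wd t -> s = t.
Proof. by move=> rs rt e; rewrite -(letters_wd rs) -(letters_wd rt) e. Qed.

Lemma winv_cat s t : winv (s ++ t) = winv t ++ winv s.
Proof. by rewrite /winv map_cat rev_cat. Qed.

Lemma wdV s : reduced s -> wd (winv s) = (wd s)^-1%g.
Proof.
move=> rs; apply: val_inj; rewrite [LHS]letters_wd ?winv_reduced //.
by rewrite -[in LHS](letters_wd rs).
Qed.

Lemma reduced_catl s t : reduced (s ++ t) -> reduced s.
Proof. by rewrite /reduced => /cat_sorted2 []. Qed.

Lemma reduced_catr s t : reduced (s ++ t) -> reduced t.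
Proof. by rewrite /reduced => /cat_sorted2 []. Qed.

Lemma reduced_glue s x t :
  reduced (rcons s x) -> reduced (x :: t) -> reduced (s ++ x :: t).
Proof.
by case: s => [//|a s]; rewrite /reduced /= cat_path rcons_path /=;
  case/andP=> -> -> ->.
Qed.

Lemma reduced_cat3 s t u : t <> [::] -> reduced (s ++ t) -> reduced (t ++ u) ->
  reduced (s ++ t ++ u).
Proof.
case: t => // a t _ r1 r2; rewrite cat_cons; apply: reduced_glue => //.
by apply: (@reduced_catl _ t); rewrite cat_rcons.
Qed.

Lemma reduced_mid s t u : reduced (s ++ t ++ u) -> reduced t.
Proof. by move/reduced_catr/reduced_catl. Qed.

Lemma linv_neq x : linv x != x.
Proof. by case: x => a b; rewrite /linv xpair_eqE eqxx /=; case: b. Qed.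

(** Isolates the part [k] of [s] that cancels against [t]. Every computation with a product that may
    cancel goes through this decomposition. *)
Lemma reduced_cancel s t : reduced s -> reduced t ->
  exists s0 k t0, [/\ s = s0 ++ k, t = winv k ++ t0 & reduced (s0 ++ t0)].
Proof.
elim/last_ind: s t => [|s x IH] t rs rt; first by exists [::], [::], t.
case: t rt => [|y t] rt.
  by exists (rcons s x), [::], [::]; rewrite ?cats0.
case: (eqVneq y (linv x)) => [->|ne]; last first.
  exists (rcons s x), [::], (y :: t); rewrite cats0; split => //.
  rewrite cat_rcons; apply: reduced_glue => //=.
  by rewrite ne; exact: rt.
have rs' : reduced s by apply: reduced_catl (_ : reduced (s ++ [:: x])); rewrite cats1.
have [s0 [k [t0 [-> -> r]]]] := IH t rs' (reduced_behead rt).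
exists s0, (rcons k x), t0; split => //; first by rewrite rcons_cat.
by rewrite -cats1 winv_cat.
Qed.

Lemma wd_cancel s0 k t0 : reduced k ->
  wd ((s0 ++ k) ++ (winv k ++ t0)) = wd (s0 ++ t0).
Proof.
by move=> rk; rewrite !wd_cat wdV // -!mulgA mulVKg.
Qed.

Lemma winv_nil s : winv s = [::] -> s = [::].
Proof. by move/(congr1 winv); rewrite winvK. Qed.

Lemma cat_eq s1 s2 t1 t2 : s1 ++ s2 = t1 ++ t2 -> size s1 <= size t1 ->
  exists m, t1 = s1 ++ m /\ s2 = m ++ t2.
Proof.
elim: s1 t1 => [|a s1 IH] [|b t1] //= e le; try by [exists [::]|exists (b :: t1)].
by case: e => -> /IH [//|m [-> ->]]; exists m.
Qed.

Lemma cat_eqP s1 s2 t1 t2 : s1 ++ s2 = t1 ++ t2 ->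
  (exists m, t1 = s1 ++ m /\ s2 = m ++ t2) \/
  (exists m, [/\ m <> [::], s1 = t1 ++ m & t2 = m ++ s2]).
Proof.
move=> e; case: (leqP (size s1) (size t1)) => [/(cat_eq e)|lt]; first by left.
right; have [m [e1 e2]] := cat_eq (esym e) (ltnW lt).
by exists m; split=> // m0; move: lt; rewrite e1 m0 cats0 ltnn.
Qed.

End Words.

(** * Two-sided translates in the group algebra *)

Section GroupAlgebraTranslation.
Context {k : fieldType} {G : groupType}.
Local Notation kG := (group_algebra k G).
Implicit Types (p q : kG) (g h u : G).
Local Open Scope ring_scope.

Lemma gmonM g h : gmon k g * gmon k h = gmon k (g * h)%g.
Proof. by rewrite /GRing.mul /= ga_mulUU mulr1. Qed.

Lemma gmon1 : gmon k (1%g : G) = 1.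
Proof. by []. Qed.

Lemma mcoeff_lmul g p u : (gmon k g * p)@_u = p@_(g^-1 * u)%g.
Proof.
rewrite [p in LHS](monalgE p) /GRing.mul /= ga_mul_sumr raddf_sum /=.
rewrite [p in RHS](monalgE p) raddf_sum /=; apply: eq_bigr => h _.
by rewrite ga_mulUU mul1r !mcoeffU -[in LHS](mulVKg g u) (can_eq (mulKg g)).
Qed.

Lemma mcoeff_rmul h p u : (p * gmon k h)@_u = p@_(u * h^-1)%g.
Proof.
rewrite [p in LHS](monalgE p) /GRing.mul /= ga_mul_suml raddf_sum /=.
rewrite [p in RHS](monalgE p) raddf_sum /=; apply: eq_bigr => g _.
by rewrite ga_mulUU mulr1 !mcoeffU -[in LHS](mulgVK h u) (can_eq (mulgK h)).
Qed.

Lemma mcoeff_tr g p h u : (tr g p h)@_u = p@_(g^-1 * u * h^-1)%g.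
Proof. by rewrite tr.unlock mcoeff_rmul mcoeff_lmul mulgA. Qed.

Lemma gsuppE p u : (u \in gsupp p) = (p@_u != 0).
Proof. by rewrite /gsupp mcoeff_neq0. Qed.

Lemma gsupp_tr g p h u : (u \in gsupp (tr g p h)) = ((g^-1 * u * h^-1)%g \in gsupp p).
Proof. by rewrite !gsuppE mcoeff_tr. Qed.

Lemma tr_tr g g' p h h' : tr g (tr g' p h') h = tr (g * g')%g p (h' * h)%g.
Proof. by rewrite tr.unlock -!gmonM !mulrA. Qed.

Lemma tr11 p : tr 1%g p 1%g = p.
Proof. by rewrite tr.unlock !gmon1 mul1r mulr1. Qed.

Lemma trE1 g p : gmon k g * p = tr g p 1%g.
Proof. by rewrite tr.unlock gmon1 mulr1. Qed.

Lemma trE2 h p : p * gmon k h = tr 1%g p h.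
Proof. by rewrite tr.unlock gmon1 mul1r. Qed.

Lemma tr_gmon g u h : tr g (gmon k u) h = gmon k (g * u * h)%g.
Proof. by rewrite tr.unlock !gmonM. Qed.

Lemma trD g h p q : tr g (p + q) h = tr g p h + tr g q h.
Proof. by rewrite tr.unlock mulrDr mulrDl. Qed.

Lemma trN g h p : tr g (- p) h = - tr g p h.
Proof. by rewrite tr.unlock mulrN mulNr. Qed.

Lemma trZ g h (c : k) p : tr g (c *: p) h = c *: tr g p h.
Proof. by rewrite tr.unlock -scalerAr -scalerAl. Qed.

Lemma tr0 g h : tr g (0 : kG) h = 0.
Proof. by rewrite tr.unlock mulr0 mul0r. Qed.

Lemma tr_sum g h (I : Type) (r : seq I) (P : pred I) (E : I -> kG) :
  tr g (\sum_(i <- r | P i) E i) h = \sum_(i <- r | P i) tr g (E i) h.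
Proof. by rewrite tr.unlock mulr_sumr mulr_suml. Qed.

Lemma tr_eq0 g h p : tr g p h = 0 -> p = 0.
Proof.
move/(congr1 (fun q => tr g^-1%g q h^-1%g)).
by rewrite tr_tr mulVg mulgV tr11 tr0.
Qed.

Lemma gmon_sum p : p = \sum_(u <- gsupp p) p@_u *: gmon k u.
Proof.
rewrite {1}(monalgE p) /gsupp; apply: eq_bigr => u _.
by rewrite /gmon ga_scaleU mulr1.
Qed.

Lemma mcoeff_gmon u v : (gmon k u)@_v = (u == v)%:R.
Proof. by rewrite /gmon mcoeffU -mulr_natr mul1r. Qed.

End GroupAlgebraTranslation.

(** * Integer form of the thresholds *)

Section Measure.
Context {R : realType} {k : fieldType} {X : choiceType}.
Context (Rel : set (group_algebra k (free_group X))).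
Local Notation L := (letter X).
Local Notation F := (free_group X).

Lemma measure'_ge (x : R) (u : F) : (x%:E <= measure' R Rel u)%E <->
  forall r, is_concatenation (small_piece' Rel) u r -> (x <= r%:R)%R.
Proof.
rewrite /measure'; case: pselect => [ex|nex]; last first.
  split=> _; last exact: leey.
  by move=> r h; case: nex; exists r; apply/asboolP.
case: ex_minnP => m /asboolP hm mmin; rewrite lee_fin; split=> [le r hr|]; last exact.
by apply: le_trans le _; rewrite ler_nat; apply: mmin; apply/asboolP.
Qed.

Definition measure_cut (tau : R) : nat := (`|Num.ceil tau| - 2)%N.

(** Measures are integers, so a real threshold may be replaced by its ceiling. *)
Lemma measure_cutP (tau : R) (htau : (16 <= tau)%R) r :
  ((tau - 2 <= r%:R)%R <-> (measure_cut tau <= r)%N) /\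
  ((tau + 10 <= r%:R)%R <-> (measure_cut tau + 12 <= r)%N).
Proof.
have c16 : (16 <= Num.ceil tau)%R.
  by rewrite -(ler_int R); apply: le_trans htau (Num.Theory.ceil_ge _).
have key (m : int) : (tau <= m%:~R)%R = (Num.ceil tau <= m)%R by rewrite -Num.Theory.ceil_le_int.
have e1 : (tau - 2 <= r%:R)%R = (tau <= (r%:Z + 2)%:~R)%R.
  by rewrite lerBlDr intrD.
have e2 : (tau + 10 <= r%:R)%R = (tau <= (r%:Z - 10)%:~R)%R.
  by rewrite -lerBrDr intrD.
rewrite e1 e2 !key /measure_cut; lia.
Qed.

Lemma measure_cut14 (tau : R) : (16 <= tau)%R -> (14 <= measure_cut tau)%N.
Proof.
move=> htau; have c16 : (16 <= Num.ceil tau)%R.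
  by rewrite -(ler_int R); apply: le_trans htau (Num.Theory.ceil_ge _).
by rewrite /measure_cut; lia.
Qed.

End Measure.

(** * Linear algebra *)

Section LinearAlgebra.
Local Open Scope ring_scope.
Local Open Scope classical_set_scope.

Section Span.
Context {K : pzRingType} {V : lmodType K}.
Implicit Types P U : set V.

Lemma subspaceZ U c u : is_subspace U -> U u -> U (c *: u).
Proof. by move=> [U0 UZ] Uu; rewrite -[_ *: _]addr0; apply: UZ. Qed.

Lemma subspaceD U u v : is_subspace U -> U u -> U v -> U (u + v).
Proof. by move=> [U0 UZ] Uu Uv; rewrite -[u]scale1r; apply: UZ. Qed.

Lemma subspace_sum U (I : eqType) (r : seq I) (E : I -> V) :
  is_subspace U -> (forall i, i \in r -> U (E i)) -> U (\sum_(i <- r) E i).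
Proof.
move=> sU; elim: r => [|i r IH] h; first by rewrite big_nil; case: sU.
rewrite big_cons; apply: subspaceD => //; first by apply: h; rewrite mem_head.
by apply: IH => j jr; apply: h; rewrite inE jr orbT.
Qed.

Lemma span_subspace P : is_subspace (linear_span P).
Proof.
split=> [U [[]] //|c u v hu hv U [sU PU]].
by case: (sU) => _; apply; [apply: hu|apply: hv].
Qed.

Lemma span_gen P : P `<=` linear_span P.
Proof. by move=> u Pu U [_]; apply. Qed.

Lemma span_min P U : is_subspace U -> P `<=` U -> linear_span P `<=` U.
Proof. by move=> sU PU u; apply; split. Qed.

Lemma spanZ P c u : linear_span P u -> linear_span P (c *: u).
Proof. exact: subspaceZ (span_subspace P). Qed.

Lemma spanB P u v : linear_span P u -> linear_span P v -> linear_span P (u - v).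
Proof.
by move=> hu hv; rewrite -scaleN1r; apply: (subspaceD (span_subspace P)) => //; apply: spanZ.
Qed.

End Span.

Section LinearCombinations.
Context {K : fieldType} {V : lmodType K}.
Implicit Types (c : nat -> K) (u x : V) (r : seq V) (W : set V).

(** The coefficients are indexed by all of [nat], so that lists can be cut and concatenated without
    casts between ordinals. *)
Fixpoint lc c r : V := if r is x :: r' then c 0%N *: x + lc (fun i => c i.+1) r' else 0.

Lemma lcE c r : lc c r = \sum_(i < size r) c i *: r`_i.
Proof.
elim: r c => [|x r IH] c /=; first by rewrite big_ord0.
by rewrite big_ord_recl IH.
Qed.

Lemma lcD c c' r : lc (fun i => c i + c' i) r = lc c r + lc c' r.
Proof. by rewrite !lcE -big_split; apply: eq_bigr => i _; rewrite scalerDl. Qed.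

Lemma lcZ a c r : lc (fun i => a * c i) r = a *: lc c r.
Proof. by rewrite !lcE scaler_sumr; apply: eq_bigr => i _; rewrite scalerA. Qed.

Lemma lc0 r : lc (fun=> 0) r = 0.
Proof. by rewrite lcE big1 // => i _; rewrite scale0r. Qed.

Lemma lc_cat c r1 r2 : lc c (r1 ++ r2) = lc c r1 + lc (fun i => c (size r1 + i)%N) r2.
Proof.
elim: r1 c => [|x r1 IH] c /=; first by rewrite add0r.
by rewrite IH addrA.
Qed.

Lemma eq_lc c c' r : (forall i, (i < size r)%N -> c i = c' i) -> lc c r = lc c' r.
Proof. by move=> h; rewrite !lcE; apply: eq_bigr => i _; rewrite h. Qed.

Definition in_span W r u : Prop := exists c, W (u - lc c r).

Definition ind W r : Prop := forall c, W (lc c r) -> forall i, (i < size r)%N -> c i = 0.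

(** Sifting: the head of the list is dropped exactly when it lies, modulo [W], in the span of the
    basis already found for the tail. *)
Lemma basis_ex W r : is_subspace W ->
  exists r', ind W r' /\ forall u, in_span W r u <-> in_span W r' u.
Proof.
move=> sW; elim: r => [|x r [r' [ir' hr']]]; first by exists [::].
have [[d hd]|nx] := EM (in_span W r' x).
  exists r'; split=> // u; split=> [[c hc]|/hr' [c hc]].
    have /hr' [c' hc'] : in_span W r (u - c 0%N *: x).
      by exists (fun i => c i.+1); rewrite -addrA -opprD.
    exists (fun i => c' i + c 0%N * d i); rewrite lcD lcZ.
    have -> : u - (lc c' r' + c 0%N *: lc d r') =
        (u - c 0%N *: x - lc c' r') + c 0%N *: (x - lc d r').
      by rewrite scalerBr opprD !addrA; congr (_ + _); rewrite addrAC subrK.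
    by apply: subspaceD => //; apply: subspaceZ.
  by exists (fun i => if i is i'.+1 then c i' else 0); rewrite /= scale0r add0r.
exists (x :: r'); split=> [c hc|u].
  have c0 : c 0%N = 0.
    apply: contrapT => /eqP c0; apply: nx; exists (fun i => - ((c 0%N)^-1 * c i.+1)).
    have -> : x - lc (fun i => - ((c 0%N)^-1 * c i.+1)) r' = (c 0%N)^-1 *: lc c (x :: r').
      rewrite /= scalerDr scalerA mulVf // scale1r; congr (_ + _).
      rewrite -lcZ -scaleN1r -lcZ; apply: eq_lc => i _.
      by rewrite mulN1r opprK.
    exact: subspaceZ.
  case=> [//|i] lt; apply: (ir' (fun i => c i.+1)) => //.
  by move: hc; rewrite /= c0 scale0r add0r.
split=> [[c hc]|[c hc]].
  have /hr' [c' hc'] : in_span W r (u - c 0%N *: x).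
    by exists (fun i => c i.+1); rewrite -addrA -opprD.
  exists (fun i => if i is i'.+1 then c' i' else c 0%N).
  by rewrite /= opprD addrA.
have /hr' [c' hc'] : in_span W r' (u - c 0%N *: x).
  by exists (fun i => c i.+1); rewrite -addrA -opprD.
exists (fun i => if i is i'.+1 then c' i' else c 0%N).
by rewrite /= opprD addrA.
Qed.

Lemma ind_has_dim W r (U : set V) : is_subspace W -> ind W r ->
  (forall u, U u <-> in_span W r u) -> has_dim_quotient U W (size r).
Proof.
move=> sW ir hU; exists (fun i : 'I_(size r) => r`_i); split=> [i|u /hU [c hc]].
  apply/hU; exists (fun j => (j == i :> nat)%:R); rewrite lcE (bigD1 i) //= eqxx scale1r big1.
    by rewrite addr0 subrr; case: sW.
  by move=> j nj; rewrite -val_eqE /= in nj; rewrite (negPf nj) scale0r.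
exists [ffun i : 'I_(size r) => c i]; split.
  by rewrite (eq_bigr (fun i : 'I_(size r) => c i *: r`_i)) => [|i _]; rewrite ?ffunE // -lcE.
move=> c' hc'; apply/ffunP => i; rewrite ffunE.
pose d j := if insub j is Some i' then c' i' else 0 : K.
have dE : \sum_(i0 < size r) c' i0 *: r`_i0 = lc d r.
  by rewrite lcE; apply: eq_bigr => j _; rewrite /d valK.
have hd : W (lc (fun j => c j - d j) r).
  have -> : lc (fun j => c j - d j) r = (u - lc d r) - (u - lc c r).
    rewrite opprB [RHS]addrC addrA subrK -scaleN1r -lcZ -lcD.
    by apply: eq_lc => j _; rewrite mulN1r.
  apply: subspaceD => //; first by rewrite -dE.
  by rewrite -scaleN1r; apply: subspaceZ.
have := ir _ hd i (ltn_ord i); rewrite /d valK => /eqP; rewrite subr_eq0 => /eqP ->.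
by [].
Qed.

(** If [S] were longer than [r], the matrix of coordinates would have a non-zero vector in its left
    kernel, which is a linear relation between the [v t]. *)
Lemma steinitz (T : eqType) (S : seq T) (v : T -> V) r : uniq S ->
  (forall c : T -> K, \sum_(t <- S) c t *: v t = 0 -> forall t, t \in S -> c t = 0) ->
  (forall t, t \in S -> exists c, v t = lc c r) -> (size S <= size r)%N.
Proof.
case: S => [//|t0 S0]; set S := t0 :: S0 => uS iS sS.
rewrite leqNgt; apply/negP => lt.
have [cf hcf] : {cf : T -> nat -> K | forall t, t \in S -> v t = lc (cf t) r}.
  exists (fun t => if pselect (exists c, v t = lc c r) is left ex then projT1 (cid ex) else fun=>
    0).
  move=> t /sS h; case: pselect => // ex; exact: (projT2 (cid ex)).
pose A := \matrix_(i < size S, j < size r) cf (nth t0 S i) j.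
have kn : kermx A != 0.
  rewrite -mxrank_eq0 mxrank_ker -lt0n subn_gt0.
  by apply: leq_ltn_trans lt; apply: rank_leq_col.
have /rowV0Pn [x /sub_kermxP xA xn] := kn.
pose c t := if insub (index t S) is Some i then x 0 i else 0 : K.
have cE (i : 'I_(size S)) : c (nth t0 S i) = x 0 i.
  by rewrite /c index_uniq ?ltn_ord // valK.
case/negP: xn; apply/eqP/rowP => i; rewrite mxE -cE; apply: iS; last exact: mem_nth.
rewrite (big_nth t0) big_mkord.
have e (l : 'I_(size S)) : c (nth t0 S l) *: v (nth t0 S l) = \sum_(j < size r) (x 0 l * A l j) *:
  r`_j.
  rewrite cE hcf ?mem_nth // lcE scaler_sumr; apply: eq_bigr => j _.
  by rewrite scalerA mxE.
rewrite (eq_bigr _ (fun l _ => e l)) exchange_big /= big1 // => j _.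
rewrite -scaler_suml; have /rowP /(_ j) := xA; rewrite !mxE => ->.
by rewrite scale0r.
Qed.

End LinearCombinations.

Section Spans.
Context {K : fieldType} {V : lmodType K}.
Implicit Types (c : nat -> K) (u x : V) (r : seq V) (W : set V).

Definition lspan r u : Prop := exists c, u = lc c r.

Lemma lspan0 r : lspan r 0.
Proof. by exists (fun=> 0); rewrite lc0. Qed.

Lemma lspan_cat r1 r2 u1 u2 : lspan r1 u1 -> lspan r2 u2 -> lspan (r1 ++ r2) (u1 + u2).
Proof.
move=> [c1 ->] [c2 ->]; exists (fun i => if (i < size r1)%N then c1 i else c2 (i - size r1)%N).
rewrite lc_cat; congr (_ + _); apply: eq_lc => i lt; first by rewrite lt.
by rewrite ltnNge leq_addr addKn.
Qed.

Lemma lspan_flatten (T : eqType) (ys : seq T) (rf : T -> seq V) y u : y \in ys ->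
  lspan (rf y) u -> lspan (flatten (map rf ys)) u.
Proof.
move=> + hu; elim: ys => // z ys IH; rewrite inE => /orP [/eqP <-|/IH h] /=.
  by rewrite -[u]addr0; apply: lspan_cat hu (lspan0 _).
by rewrite -[u]add0r; apply: lspan_cat (lspan0 _) h.
Qed.

Lemma lspan_map (T : eqType) (S : seq T) (v : T -> V) (c : T -> K) :
  lspan (map v S) (\sum_(t <- S) c t *: v t).
Proof.
elim: S => [|t S [c' e]]; first by rewrite big_nil; apply: lspan0.
by exists (fun i => if i is i'.+1 then c' i' else c t); rewrite big_cons /= -e.
Qed.

Lemma map_lspan (T : eqType) (S : seq T) (v : T -> V) u : uniq S -> lspan (map v S) u ->
  exists c : T -> K, u = \sum_(t <- S) c t *: v t.
Proof.
move=> + [c ->]; elim: S c => [|t S IH] c; first by exists (fun=> 0); rewrite big_nil.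
case/andP=> nt uS; have [c' e] := IH (fun i => c i.+1) uS.
exists (fun j => if j == t then c 0%N else c' j); rewrite big_cons eqxx /= e; congr (_ + _).
by apply: eq_big_seq => j jS; case: eqVneq => // ej; move: nt; rewrite -ej jS.
Qed.

Lemma lspan_subspace r : is_subspace (lspan r).
Proof.
split=> [|a u1 u2 [c1 ->] [c2 ->]]; first exact: lspan0.
by exists (fun i => a * c1 i + c2 i); rewrite lcD lcZ.
Qed.

Lemma lspan_mem r u : u \in r -> lspan r u.
Proof.
elim: r => // x r IH; rewrite inE => /orP [/eqP ->|/IH h].
  by exists (fun i => if i is _.+1 then 0 else 1); rewrite /= scale1r lc0 addr0.
by rewrite -cat1s -[u]add0r; apply: lspan_cat (lspan0 _) h.
Qed.

Lemma lspan_in_span r u : lspan r u <-> in_span [set 0] r u.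
Proof.
split=> [[c ->]|[c /= /eqP]]; exists c; first by rewrite /= subrr.
by apply/eqP; rewrite -subr_eq0.
Qed.

Lemma set0_subspace : is_subspace ([set 0] : set V).
Proof. by split=> // c u v -> ->; rewrite /= scaler0 addr0. Qed.

Lemma lspan_findim r : findim_subspace (lspan r).
Proof.
split; first exact: lspan_subspace.
have [r' [ir h]] := basis_ex r set0_subspace; exists (size r').
apply: (ind_has_dim set0_subspace ir) => u; rewrite -h; exact: lspan_in_span.
Qed.

Lemma sumn_max (T : eqType) (ys : seq T) (m : T -> nat) : ys <> [::] ->
  exists2 y, y \in ys & (sumn (map m ys) <= size ys * m y)%N.
Proof.
elim: ys => // y ys IH _; have [->|/eqP yn] := eqVneq ys [::].
  by exists y; rewrite ?mem_head //= addn0 mul1n.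
have [z zs h] := IH yn; have [le|lt] := leqP (m z) (m y).
  exists y; rewrite ?mem_head //= mulSn leq_add2l; apply: leq_trans h _.
  by rewrite leq_mul2l le orbT.
by exists z; rewrite ?inE ?zs ?orbT //= mulSn leq_add // ltnW.
Qed.

End Spans.

Section LinearExtension.
Context {K : fieldType} {G : groupType} {W : lmodType K} (ph : G -> W).
Local Notation kG := (group_algebra K G).

Definition lext (f : kG) : W := \sum_(U <- gsupp f) f@_U *: ph U.

Lemma lextw (d : {fset G}) (f : kG) : (gsupp f `<=` d)%fset ->
  lext f = \sum_(U <- d) f@_U *: ph U.
Proof.
move=> le; rewrite /lext (big_fset_incl _ le) //= => U _.
by rewrite gsuppE negbK => /eqP ->; rewrite scale0r.
Qed.

Lemma lextD (f1 f2 : kG) : lext (f1 + f2) = lext f1 + lext f2.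
Proof.
rewrite (lextw (f := f1) (fsubsetUl _ (gsupp f2))) (lextw (f := f2) (fsubsetUr (gsupp f1) _)).
rewrite (lextw (msuppD_le f1 f2)) -big_split /=; apply: eq_bigr => U _.
by rewrite mcoeffD scalerDl.
Qed.

Lemma lextZ (c : K) (f : kG) : lext (c *: f) = c *: lext f.
Proof.
rewrite (lextw (msuppZ_le c f)) scaler_sumr; apply: eq_bigr => U _.
by rewrite mcoeffZ scalerA.
Qed.

Lemma lext_gmon (U : G) : lext (gmon K U) = ph U.
Proof.
by rewrite (lextw msuppU_le) big_seq_fset1 mcoeff_gmon eqxx scale1r.
Qed.

Lemma lext0 : lext 0 = 0.
Proof. by have := lextZ 0 (0 : kG); rewrite !scale0r. Qed.

Lemma lextB (f1 f2 : kG) : lext (f1 - f2) = lext f1 - lext f2.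
Proof. by rewrite -[- f2]scaleN1r lextD lextZ scaleN1r. Qed.

Lemma lext_sum (I : Type) (r : seq I) (E : I -> kG) :
  lext (\sum_(i <- r) E i) = \sum_(i <- r) lext (E i).
Proof. by apply: (big_morph _ lextD lext0). Qed.

End LinearExtension.

Section Expand.
Context {K : fieldType} {G : groupType}.
Local Notation kG := (group_algebra K G).

Lemma tr_expandr (a b h : G) (f p : kG) :
  tr a f b * tr 1%g p h = \sum_(u <- gsupp p) p@_u *: tr a f (b * u * h)%g.
Proof.
rewrite {1}(gmon_sum p) tr_sum mulr_sumr; apply: eq_bigr => u _.
by rewrite trZ -scalerAr tr_gmon mul1g tr.unlock -(mulgA b u h) -(gmonM b) mulrA.
Qed.

Lemma tr_expandl (a b h : G) (f p : kG) :
  tr a f b * tr 1%g p h = \sum_(u <- gsupp f) f@_u *: tr (a * u * b)%g p h.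
Proof.
rewrite {1}(gmon_sum f) tr_sum mulr_suml; apply: eq_bigr => u _.
by rewrite trZ -scalerAl tr_gmon tr.unlock gmon1 mul1r mulrA.
Qed.

(* Expanding the product of [tr a f b] and [tr 1 p h] along [p], then along [f]. *)
Lemma lext_cross (W : lmodType K) (ph : G -> W) (v a b h : G) (f p : kG) : f@_v = 1 ->
  (forall u : G, p@_u != 0 -> lext ph (tr a f (b * u * h)%g) = 0) ->
  (forall u : G, f@_u != 0 -> u <> v -> lext ph (tr (a * u * b)%g p h) = 0) ->
  lext ph (tr (a * v * b)%g p h) = 0.
Proof.
move=> f1 hr hl; have := tr_expandr a b h f p; rewrite tr_expandl => /(congr1 (lext ph)).
rewrite !lext_sum => e.
have e0 : \sum_(u <- gsupp p) lext ph (p@_u *: tr a f (b * u * h)%g) = 0.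
  apply: big1_seq => u /andP [_ up]; rewrite lextZ hr ?scaler0 //.
  by rewrite -gsuppE.
have xf : v \in enum_fset (gsupp f) by rewrite -/(v \in gsupp f) gsuppE f1 oner_eq0.
rewrite e0 (bigD1_seq _ xf (fset_uniq _)) /= lextZ f1 scale1r in e.
rewrite big1_seq ?addr0 // in e => u /andP [/eqP nu uf].
by rewrite lextZ hl ?scaler0 // -gsuppE.
Qed.

End Expand.

Lemma gmon_subK (K : fieldType) (G : groupType) (g : G) (p q : group_algebra K G) :
  gmon K g^-1%g * q - p = gmon K g^-1%g * (q - gmon K g * p).
Proof. by rewrite mulrBr mulrA gmonM mulVg gmon1 mul1r. Qed.

Lemma linear_lmul_sum (K : fieldType) (B : algType K) (V : lmodType K) (ph : B -> V) :
  (forall x y, ph (x + y) = ph x + ph y) -> (forall c x, ph (c *: x) = c *: ph x) ->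
  forall (I : Type) (r : seq I) (c : I -> K) (E : I -> B) (a : B),
  ph (a * \sum_(i <- r) c i *: E i) = \sum_(i <- r) c i *: ph (a * E i).
Proof.
move=> phD phZ I r c E a; have ph0 : ph 0 = 0 by apply: (addrI (ph 0)); rewrite -phD !addr0.
rewrite mulr_sumr (big_morph ph phD ph0); apply: eq_bigr => i _.
by rewrite -scalerAr phZ.
Qed.

Lemma kalg_mul_sumr (K : fieldType) (B : kalgebra K) (I : Type) (r : seq I) (c : I -> K)
    (e : I -> B) (a : B) :
  kalg_mul a (\sum_(i <- r) c i *: e i) = \sum_(i <- r) c i *: kalg_mul a (e i).
Proof.
elim: r => [|i r IH]; last by rewrite !big_cons kalg_mulDr kalg_scaleAr IH.
by rewrite !big_nil -[X in kalg_mul _ X](scale0r 0) -kalg_scaleAr scale0r.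
Qed.

End LinearAlgebra.

Section SmallCancellation.
Context {R : realType} {k : fieldType} {X : choiceType}.
Context (Rel : set (group_algebra k (free_group X))) (tau : R).
Hypothesis sc_compat : compatibility_axiom Rel.
Hypothesis sc_tau : (16 <= tau)%R.
Hypothesis sc_strong : strong_small_cancellation_axiom Rel (tau + 10)%R.
Hypothesis sc_isolation : right_isolation Rel tau.
Hypothesis sc_sym : forall u : free_group X, Mon Rel u -> Mon Rel (u^-1)%g ->
  measure' R Rel u = measure' R Rel (u^-1)%g.
Local Notation L := (letter X).
Local Notation F := (free_group X).
Local Notation kF := (group_algebra k F).
(* [C] and [C + 12] are the least integers [>= tau - 2] and [>= tau + 10]; the
   measure is truncated at [N], so that an element of [Mon] costs at most [D]. *)
Local Notation C := (measure_cut tau).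
Local Notation N := (measure_cut tau).+1.
Local Notation D := (measure_cut tau).+2.

(** * Small pieces and tight occurrences *)

Section Pieces.
Implicit Types (p q : kF) (x y z : L) (s t u v a b c : seq L) (g h : F).

(* [M] and [Sp] are [Mon] and [S'] on sequences of letters. As the empty word is a
   small piece, [cov s r] means that the measure of [s] is at most [r], and
   [lam s n] that it is at least [n]. *)
Definition inp p s : Prop := wd s \in gsupp p.
Definition M s : Prop := reduced s /\ Mon Rel (wd s).

Lemma inp_tr p g h s t : (g * wd s * h)%g = wd t -> inp p s -> inp (tr g p h) t.
Proof. by move=> e; rewrite /inp gsupp_tr -e -!mulgA mulKg mulgV mulg1. Qed.

Lemma inp_cons p y s : inp p s -> inp (tr (wd [:: y]) p 1%g) (y :: s).
Proof. by apply: inp_tr; rewrite (wd_cons y s) mulg1. Qed.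

Lemma inp_rcons p y s : inp p s -> inp (tr 1%g p (wd [:: y])) (rcons s y).
Proof. by apply: inp_tr; rewrite wd_rcons mul1g. Qed.

Lemma inp_catr p t s : inp p s -> inp (tr 1%g p (wd t)) (s ++ t).
Proof. by apply: inp_tr; rewrite wd_cat mul1g. Qed.

Lemma MI p s : Rel p -> inp p s -> reduced s -> M s.
Proof. by move=> rp ips rs; split=> //; exists p. Qed.

Lemma M_reduced s : M s -> reduced s. Proof. by case. Qed.

Lemma M_inp s : M s -> exists2 p, Rel p & inp p s.
Proof. by case=> _ [p]; exists p. Qed.

Lemma compat_l p x s : Rel p -> inp p (x :: s) -> reduced (x :: s) ->
  Rel (tr (wd [:: x])^-1%g p 1%g).
Proof.
move=> rp ip rs; case: sc_compat => _ + _.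
move/(_ p x (wd (x :: s)) rp ip); rewrite letters_wd // => h.
rewrite -trE1; have -> : wd [:: x] = letter_word x by apply: val_inj; rewrite [LHS]letters_wd.
by apply: h; exists s.
Qed.

Lemma compat_r p x s : Rel p -> inp p (rcons s x) -> reduced (rcons s x) ->
  Rel (tr 1%g p (wd [:: x])^-1%g).
Proof.
move=> rp ip rs; case: sc_compat => _ _.
move/(_ p x (wd (rcons s x)) rp ip); rewrite letters_wd // => h.
rewrite -trE2; have -> : wd [:: x] = letter_word x by apply: val_inj; rewrite [LHS]letters_wd.
by apply: h; exists s.
Qed.

Lemma M_behead x s : M (x :: s) -> M s.
Proof.
move=> Mx; have [p rp ip] := M_inp Mx; have rx := M_reduced Mx.
apply: (MI (compat_l rp ip rx)); last exact: reduced_behead rx.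
by apply: (inp_tr _ ip); rewrite (wd_cons x s) mulKg mulg1.
Qed.

Lemma M_rcons x s : M (rcons s x) -> M s.
Proof.
move=> Mx; have [p rp ip] := M_inp Mx; have rx := M_reduced Mx.
apply: (MI (compat_r rp ip rx)); last by move: rx; rewrite -cats1 => /reduced_catl.
by apply: (inp_tr _ ip); rewrite wd_rcons mul1g mulgK.
Qed.

Lemma M_catr s t : M (s ++ t) -> M t.
Proof. by elim: s => // x s IH /M_behead. Qed.

Lemma M_catl s t : M (s ++ t) -> M s.
Proof.
by elim/last_ind: t => [|t x IH]; rewrite ?cats0 // -rcons_cat => /M_rcons.
Qed.

Lemma M_mid s t u : M (s ++ t ++ u) -> M t.
Proof. by move/M_catr/M_catl. Qed.

Definition Sp s : Prop := reduced s /\ small_piece' Rel (wd s).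

Lemma Sp0 : Sp [::].
Proof. by split=> //; left; left; rewrite wd0. Qed.

Lemma Sp_letter x : M [:: x] -> Sp [:: x].
Proof.
move=> [_ Mx]; split=> //; have e : wd [:: x] = letter_word x by apply: val_inj;
  rewrite [LHS]letters_wd.
by right; exists x; rewrite -?e.
Qed.

Lemma no_cancel3 (a b c : F) : no_cancel [:: a; b; c] = reduced (letters a ++ letters b ++ letters
  c).
Proof. by rewrite /no_cancel /= cats0. Qed.

Lemma Sp_sub a c b : Sp (a ++ c ++ b) -> Sp c.
Proof.
move=> [rs]; have rc := reduced_mid rs.
case=> [[e1|[Ms [p [q [a1 [a2 [b1 [b2 [[rp rq] [na ia] [nb ib] nr]]]]]]]]]|[x e Mx]].
- have : a ++ c ++ b = [::] by apply: wd_inj; rewrite ?wd0.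
  by case: a {rs e1} => //; case: c {rc} => // _; exact: Sp0.
- have [->|cn] := eqVneq c [::]; first exact: Sp0.
  split=> //; left; right; split.
    by have [] : M c by apply: (@M_mid a c b); split.
  rewrite catA in rs; have rb := reduced_catr rs.
  rewrite no_cancel3 letters_wd // -?catA in na; last by rewrite catA.
  rewrite no_cancel3 letters_wd // -?catA in nb; last by rewrite catA.
  rewrite -?catA in na nb.
  have ra1 : reduced (letters a1 ++ a) by move: na; rewrite catA => /reduced_catl.
  have rb1 : reduced (letters b1 ++ a) by move: nb; rewrite catA => /reduced_catl.
  have ra2 : reduced (b ++ letters a2).
    by move: na; rewrite !catA -(catA _ b) => /reduced_catr.
  have rb2 : reduced (b ++ letters b2).
    by move: nb; rewrite !catA -(catA _ b) => /reduced_catr.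
  exists p, q, (wd (letters a1 ++ a)), (wd (b ++ letters a2)),
    (wd (letters b1 ++ a)), (wd (b ++ letters b2)).
  split; [by split| | |].
  + split; first by rewrite no_cancel3 !letters_wd // -!catA.
    by move: ia; rewrite !wd_cat !wdK !mulgA.
  + split; first by rewrite no_cancel3 !letters_wd // -!catA.
    by move: ib; rewrite !wd_cat !wdK !mulgA.
  + move: nr; rewrite !wd_cat !wdK !invgM !mulgA.
    by rewrite -(mulgA _ (wd a)) mulgV mulg1 -(mulgA _ _ (wd b)) mulVg mulg1.
- have e' : a ++ c ++ b = [:: x].
    by rewrite -(letters_wd rs) e.
  case: c rc rs e e' => [|y c] rc rs e e'; first by move=> *; exact: Sp0.
  have [-> ->] : c = [::] /\ y = x.
    case: a e' {rs e} => [|? a] /= [].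
      by move=> -> ; case: c {rc}.
    by move=> _; case: a.
  by apply: Sp_letter; split=> //; rewrite (_ : wd _ = letter_word x) //; apply: val_inj;
    rewrite [LHS]letters_wd.
Qed.

Definition cov s r : Prop :=
  exists ss : seq (seq L), [/\ size ss = r, forall c, c \in ss -> Sp c & s = flatten ss].

Lemma is_concatenationE (u : F) r :
  is_concatenation (small_piece' Rel) u r <-> cov (letters u) r.
Proof.
split=> [[ss [sz pp e]]|[ss [sz pp e]]].
  exists (map letters ss); rewrite size_map; split=> // c /mapP [d din ->].
  by split; rewrite ?letters_reduced // wdK; apply: pp.
exists (map wd ss); rewrite size_map; split=> //.
  by move=> c /mapP [d /pp [_ h] ->].
rewrite e -map_comp; congr flatten; apply/esym; rewrite -[RHS]map_id.
by apply/eq_in_map => d /pp [rd _]; exact: letters_wd.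
Qed.

Lemma cov0 r : cov [::] r.
Proof.
exists (nseq r [::]); rewrite size_nseq; split=> //.
  by move=> c /nseqP [-> _]; apply: Sp0.
by elim: r.
Qed.

Lemma cov_cat s t m n : cov s m -> cov t n -> cov (s ++ t) (m + n).
Proof.
move=> [ss [<- ps ->]] [tt [<- pt ->]]; exists (ss ++ tt); rewrite size_cat flatten_cat.
by split=> // c; rewrite mem_cat => /orP [/ps|/pt].
Qed.

Lemma cov_pad s m n : (m <= n)%N -> cov s m -> cov s n.
Proof. by move=> /subnKC <- h; rewrite -(cats0 s); apply: cov_cat => //; apply: cov0. Qed.

Lemma cov_Sp s : Sp s -> cov s 1.
Proof.
by move=> h; exists [:: s]; split=> //= [c|]; rewrite ?inE ?cats0 // => /eqP ->.
Qed.

Lemma cov1_Sp s : cov s 1 -> Sp s.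
Proof.
move=> [ss [sz h ->]]; case: ss sz h => [|c [|d ss]] //= _ h.
by rewrite cats0; apply: h; exact: mem_head.
Qed.

Lemma cov_is0 s : cov s 0 -> s = [::].
Proof. by move=> [[|? ?] [? ? ->]]. Qed.

Lemma cov_catl s t r : cov (s ++ t) r -> cov s r.
Proof.
move=> [ss [<- pp e]]; elim: ss s pp e => [|c ss IH] s pp e.
  by case: s e => // _; apply: cov0.
have pc := pp c (mem_head _ _).
have pss d : d \in ss -> Sp d by move=> h; apply: pp; rewrite inE h orbT.
case: (cat_eqP e) => [[m [ec _]]|[m [mn es ec]]].
  apply: (@cov_pad _ 1) => //; apply: cov_Sp; apply: (@Sp_sub [::] s m).
  by rewrite /= -ec.
rewrite es /= -add1n; apply: cov_cat; first exact: cov_Sp.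
by apply: (IH _ pss); rewrite -ec.
Qed.

Lemma cov_catr s t r : cov (s ++ t) r -> cov t r.
Proof.
move=> [ss [<- pp e]]; elim: ss s pp e => [|c ss IH] s pp e.
  by case: s e => //= ->; apply: cov0.
have pc := pp c (mem_head _ _).
have pss d : d \in ss -> Sp d by move=> h; apply: pp; rewrite inE h orbT.
case: (cat_eqP e) => [[m [ec et]]|[m [mn es ec]]].
  rewrite et /= -add1n; apply: cov_cat; last by exists ss.
  by apply: cov_Sp; apply: (@Sp_sub s m [::]); rewrite cats0 -ec.
by apply: (@cov_pad _ (size ss)) => //=; apply: (IH _ pss (esym ec)).
Qed.

Lemma cov_mid s t u r : cov (s ++ t ++ u) r -> cov t r.
Proof. by move/cov_catr/cov_catl. Qed.

Lemma M_cov s : M s -> cov s (size s).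
Proof.
elim: s => [|x s IH] Ms; first exact: cov0.
rewrite /= -add1n -cat1s; apply: cov_cat; last exact/IH/(M_behead Ms).
by apply/cov_Sp/Sp_letter; apply: (@M_catl _ s).
Qed.

Definition lam s n : Prop := forall r, cov s r -> (n <= r)%N.

Lemma cov_or_lam s n : cov s n \/ lam s n.+1.
Proof.
have [c|nc] := EM (cov s n); [by left|right=> r cr].
by rewrite ltnNge; apply/negP => le; apply: nc; apply: cov_pad cr.
Qed.

Lemma lam_le s m n : (n <= m)%N -> lam s m -> lam s n.
Proof. by move=> le h r /h; apply: leq_trans. Qed.

Lemma lam_sub a s b n : lam s n -> lam (a ++ s ++ b) n.
Proof. by move=> h r /cov_mid /h. Qed.

Lemma lam_catl s t n : lam s n -> lam (s ++ t) n.
Proof. by move=> h r /cov_catl /h. Qed.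

Lemma lam_catr s t n : lam t n -> lam (s ++ t) n.
Proof. by move=> h r /cov_catr /h. Qed.

Lemma lam_cutl s t m n : cov s m -> lam (s ++ t) (m + n) -> lam t n.
Proof. by move=> cs h r ct; have := h _ (cov_cat cs ct); rewrite leq_add2l. Qed.

Lemma lam_cutr s t m n : cov t m -> lam (s ++ t) (n + m) -> lam s n.
Proof. by move=> ct h r cs; have := h _ (cov_cat cs ct); rewrite leq_add2r. Qed.

Lemma lam_nil s n : lam s n.+1 -> s <> [::].
Proof. by move=> h e; have := h 0; rewrite e => /(_ (cov0 0)). Qed.

Lemma lam1 s : s <> [::] -> lam s 1.
Proof. by move=> sn [|r] // /cov_is0. Qed.

Lemma cov_lam s m n : cov s m -> (m < n)%N -> ~ lam s n.
Proof. by move=> cs lt h; have := h _ cs; lia. Qed.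

(** The symmetry of the measure under inversion, in the form in which cancellation needs it: what
    cancels against a small part of one monomial is a small part of the other. *)
Lemma cov_winv s r : M s -> M (winv s) -> cov s r -> cov (winv s) r.
Proof.
move=> Ms Mw cs; have rs := M_reduced Ms.
have Mw' : Mon Rel (wd s)^-1%g by rewrite -wdV //; case: Mw.
have e := sc_sym (proj2 Ms) Mw'.
have [|nc] := cov_or_lam (winv s) r; first by [].
have : ((r.+1)%:R%:E <= measure' R Rel (wd s)^-1%g)%E.
  apply/measure'_ge => r' /is_concatenationE; rewrite -wdV // letters_wd ?winv_reduced //.
  by move=> /nc; rewrite ler_nat.
rewrite -e => /measure'_ge /(_ r); rewrite is_concatenationE letters_wd // => /(_ cs).
by rewrite ler_nat ltnn.
Qed.

(** A word that cannot be covered by one element of [S'] is not a small piece, so the defining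
    condition of small pieces fails for it, and both translates are relations. *)
Lemma piece_lr p c a1 a2 b1 b2 : lam c 2 -> Rel p ->
  reduced (a1 ++ c ++ a2) -> inp p (a1 ++ c ++ a2) -> M (b1 ++ c ++ b2) ->
  Rel (tr (wd b1 * (wd a1)^-1)%g p 1%g) /\ Rel (tr 1%g p ((wd a2)^-1 * wd b2)%g).
Proof.
move=> c2 rp ra ia Mb.
have rcs : reduced c := reduced_mid ra.
have nsp : ~ small_piece Rel (wd c).
  by move=> h; have /c2 : cov c 1 by apply: cov_Sp; split=> //; left.
have [q rq iq] := M_inp Mb.
have rb := M_reduced Mb.
apply: contrapT => /not_andP h; apply: nsp; right; split.
  by have [] : M c by apply: (@M_mid b1 c b2).
exists p, q, (wd a1), (wd a2), (wd b1), (wd b2); split; [by split| | |].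
- split; last by move: ia; rewrite /inp !wd_cat mulgA.
  by rewrite no_cancel3 !letters_wd // ?(reduced_catl ra) //; move: ra;
    rewrite catA => /reduced_catr.
- split; last by move: iq; rewrite /inp !wd_cat mulgA.
  by rewrite no_cancel3 !letters_wd // ?(reduced_catl rb) //; move: rb;
    rewrite catA => /reduced_catr.
- by rewrite trE1 trE2.
Qed.

Lemma tr_left p y c a : Rel p -> inp p (c ++ a) -> reduced (c ++ a) ->
  lam c 2 -> M (y :: c) -> Rel (tr (wd [:: y]) p 1%g).
Proof.
move=> rp ip rc c2 My.
have My' : M ([:: y] ++ c ++ [::]) by rewrite cats0.
have [+ _] := @piece_lr p c [::] a [:: y] [::] c2 rp rc ip My'.
by rewrite wd0 invg1 !mulg1.
Qed.

Lemma tr_right p y c a : Rel p -> inp p (a ++ c) -> reduced (a ++ c) ->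
  lam c 2 -> M (rcons c y) -> Rel (tr 1%g p (wd [:: y])).
Proof.
move=> rp ip rc c2 My.
have My' : M ([::] ++ c ++ [:: y]) by rewrite cats1.
have := @piece_lr p c a [::] [::] [:: y] c2 rp.
by rewrite cats0 wd0 invg1 !mul1g => /(_ rc ip My') [].
Qed.

Lemma M_left y c a : M (c ++ a) -> lam c 2 -> M (y :: c) -> M (y :: c ++ a).
Proof.
move=> Mc c2 My; have rc := M_reduced Mc; have [p rp ip] := M_inp Mc.
apply: (MI (tr_left rp ip rc c2 My)).
  exact: inp_cons.
have := reduced_cat3 (lam_nil c2) (M_reduced My : reduced ([:: y] ++ c)) rc; exact.
Qed.

Lemma M_right y c a : M (a ++ c) -> lam c 2 -> M (rcons c y) -> M (rcons (a ++ c) y).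
Proof.
move=> Mc c2 My; have rc := M_reduced Mc; have [p rp ip] := M_inp Mc.
apply: (MI (tr_right rp ip rc c2 My)).
  exact: inp_rcons.
have := M_reduced My; rewrite -!cats1 -catA => r1.
exact: reduced_cat3 (lam_nil c2) rc r1.
Qed.

Lemma M_glue a c b : M (a ++ c) -> lam c 2 -> M (c ++ b) -> M (a ++ c ++ b).
Proof.
move=> Mc c2 My; have rc := M_reduced Mc; have [p rp ip] := M_inp Mc.
have r : Rel (tr 1%g p (wd b)).
  by have := @piece_lr p c a [::] [::] b c2 rp; rewrite cats0 wd0 invg1 !mul1g => /(_ rc ip My) [].
apply: (MI r); first by rewrite catA; apply: inp_catr.
by apply: reduced_cat3 (lam_nil c2) rc (M_reduced My).
Qed.

(** Only extensions by one letter are tested. As [Mon] is closed under subwords, this already gives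
    maximality in the whole word. *)
Definition ltight s b : Prop := forall s' y, s = rcons s' y -> ~ M (y :: b).
Definition rtight b t : Prop := forall z t', t = z :: t' -> ~ M (rcons b z).
Definition tight s b t : Prop :=
  [/\ reduced (s ++ b ++ t), M b, ltight s b & rtight b t].

Lemma tight_M s b t : tight s b t -> M b. Proof. by case. Qed.
Lemma tight_red s b t : tight s b t -> reduced (s ++ b ++ t). Proof. by case. Qed.

Lemma ltight_cat s s' b : s' <> [::] -> ltight s' b <-> ltight (s ++ s') b.
Proof.
case/lastP: s' => // s' y _; split=> h t x; last first.
  by move=> /rcons_inj [_ <-]; apply: (h (s ++ s')); rewrite rcons_cat.
by rewrite -rcons_cat => /rcons_inj [_ <-]; apply: (h s').
Qed.

Lemma rtight_cat b t t' : t <> [::] -> rtight b t <-> rtight b (t ++ t').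
Proof.
case: t => // y t _; split=> h z s; last by case=> <- _; apply: (h y (t ++ t')).
by case=> <- _; apply: (h y t).
Qed.

Lemma rtight_inside b m t r : m <> [::] -> rtight b (m ++ t) -> ~ M (b ++ m ++ r) .
Proof.
case: m => // y m _ h Mb; apply: (h y (m ++ t)) => //.
by apply: (@M_catl _ (m ++ r)); rewrite cat_rcons.
Qed.

Lemma ltight_inside b m t r : m <> [::] -> ltight (t ++ m) b -> ~ M (r ++ m ++ b).
Proof.
case/lastP: m => // m y _ h Mb; apply: (h (t ++ m) y); first by rewrite rcons_cat.
by apply: (@M_catr (r ++ m)); rewrite -catA; move: Mb; rewrite cat_rcons.
Qed.

(** If [c] began with the inverse of the last letter [y] of [s], compatibility would make [y] times
    [p] a relation, and [y :: b] would lie in [Mon] against maximality. *)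
Lemma compat_ltight s b t p c : tight s b t -> lam b 2 -> Rel p -> inp p b ->
  inp p c -> reduced c -> reduced (s ++ c).
Proof.
case=> rd Mb lt rt b2 rp ib ic rc.
case/lastP: s lt rd => // s y lt rd; case: c ic rc => [|x c] ic rc.
  by rewrite cats0; exact: reduced_catl rd.
rewrite cat_rcons; apply: reduced_glue; first exact: reduced_catl rd.
rewrite /reduced /=; apply/andP; split=> //; apply/negP => /eqP exy.
apply: (lt s y) => //.
have := compat_l rp ic rc; rewrite exy.
have -> : (wd [:: linv y])^-1%g = wd [:: y].
  by rewrite -wdV //; congr wd; rewrite /winv /= linvK.
move=> r; apply: (MI r); first exact: inp_cons.
by move: rd; rewrite cat_rcons => /reduced_catr; rewrite -cat_cons => /reduced_catl.
Qed.

Lemma compat_rtight s b t p c : tight s b t -> lam b 2 -> Rel p -> inp p b ->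
  inp p c -> reduced c -> reduced (c ++ t).
Proof.
case=> rd Mb lt rt b2 rp ib ic rc.
case: t rt rd => [|y t] rt rd; first by rewrite cats0.
case/lastP: c ic rc => [|c x] ic rc.
  by rewrite cat0s; move: rd => /reduced_catr /reduced_catr.
apply: reduced_glue; last by move: rd => /reduced_catr /reduced_catr.
rewrite -cats1 cat_rcons; apply: reduced_glue => //.
rewrite /reduced /= andbT; apply/negP => /eqP exy.
apply: (rt y t) => //.
have := compat_r rp ic rc.
have -> : (wd [:: x])^-1%g = wd [:: y] by rewrite -wdV //; congr wd; rewrite /winv /= -exy.
move=> r; apply: (MI r); first exact: inp_rcons.
by move: rd => /reduced_catr; rewrite -cat_rcons => /reduced_catl.
Qed.

Lemma tight_inc s b t p c : tight s b t -> lam b 2 -> Rel p -> inp p b ->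
  inp p c -> reduced c -> c <> [::] -> reduced (s ++ c ++ t).
Proof.
move=> tb b2 rp ib ic rc cn; apply: reduced_cat3 => //.
  exact: compat_ltight tb b2 rp ib ic rc.
exact: compat_rtight tb b2 rp ib ic rc.
Qed.

(** If [c] could be prolonged by a letter, so could [b], because the same translate of [p] contains
    both prolongations. *)
Lemma tight_move s b t p c : tight s b t -> lam b 2 -> Rel p -> inp p b ->
  inp p c -> reduced c -> lam c 2 -> tight s c t.
Proof.
move=> tb b2 rp ib ic rc c2; have [rd Mb lt rt] := tb.
have rd' := tight_inc tb b2 rp ib ic rc (lam_nil c2).
have Mc := MI rp ic rc; split=> //.
  move=> s' y es Mc'; apply: (lt s' y es).
  have ic' : inp p (c ++ [::]) by rewrite cats0.
  have rc' : reduced (c ++ [::]) by rewrite cats0.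
  apply: (MI (tr_left rp ic' rc' c2 Mc')); first exact: inp_cons.
  by move: rd; rewrite es cat_rcons => /reduced_catr; rewrite -cat_cons => /reduced_catl.
move=> z t' et Mc'; apply: (rt z t' et).
apply: (MI (@tr_right p z c [::] rp ic rc c2 Mc')); first exact: inp_rcons.
by move: rd; rewrite et => /reduced_catr; rewrite -cat_rcons => /reduced_catl.
Qed.

(** Otherwise [m1 ++ c1] and [b] could be glued along [c1], and the maximal occurrence [b] could be
    prolonged to the left. *)
Lemma lstraddle s b m1 c1 b2 : ltight (s ++ m1) b -> M b -> m1 <> [::] -> b = c1 ++ b2 ->
  M (m1 ++ c1) -> cov c1 1.
Proof.
move=> lt Mb mn eb Mm; case: (cov_or_lam c1 1) => // c2; exfalso.
case/lastP: m1 mn lt Mm => // m1 y _ lt Mm.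
apply: (lt (s ++ m1) y); first by rewrite rcons_cat.
rewrite eb; apply: M_left => //; first by rewrite -eb.
by apply: (@M_catr m1); rewrite -cat_rcons.
Qed.

Lemma rstraddle b t m2 c2 b1 : rtight b (m2 ++ t) -> M b -> m2 <> [::] -> b = b1 ++ c2 ->
  M (c2 ++ m2) -> cov c2 1.
Proof.
move=> rt Mb mn eb Mm; case: (cov_or_lam c2 1) => // c22; exfalso.
case: m2 mn rt Mm => // y m2 _ rt Mm; apply: (rt y (m2 ++ t)) => //.
rewrite eb; apply: M_right => //; first by rewrite -eb.
by apply: (@M_catl _ m2); rewrite cat_rcons.
Qed.

End Pieces.

(** * The weight of a word *)

Section Weights.
Implicit Types (p q : kF) (x y z : L) (s t u v a b c m : seq L) (g h : F).

Lemma mn_ex s : exists r, (r == N) || `[< cov s r >].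
Proof. by exists N; rewrite eqxx. Qed.

Definition mn s : nat := ex_minn (mn_ex s).
Definition cst s : nat := (mn s).+1.

Lemma mn_le s : (mn s <= N)%N.
Proof. by rewrite /mn; case: ex_minnP => m _; apply; rewrite eqxx. Qed.

Lemma mn_cov s : (mn s < N)%N -> cov s (mn s).
Proof.
rewrite /mn; case: ex_minnP => m /orP [/eqP ->|/asboolP //] _.
by rewrite ltnn.
Qed.

Lemma cov_mn s r : cov s r -> (mn s <= r)%N.
Proof. by move=> h; rewrite /mn; case: ex_minnP => m _; apply; apply/orP; right; apply/asboolP. Qed.

Lemma lam_mn s r : lam s r -> (r <= N)%N -> (r <= mn s)%N.
Proof.
move=> h le; case: (ltnP (mn s) N) => [/mn_cov /h //|]; exact: leq_trans.
Qed.

Lemma mn_lam s : (N <= mn s)%N -> lam s N.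
Proof. by move=> h r /cov_mn; apply: leq_trans. Qed.

Lemma cst_le s : (cst s <= D)%N. Proof. by rewrite /cst ltnS mn_le. Qed.

Lemma cst_lam s : lam s N -> cst s = D.
Proof. by move=> h; apply/eqP; rewrite eqn_leq cst_le /cst ltnS; apply: lam_mn. Qed.

Lemma mn_cat s t : (mn (s ++ t) <= mn s + mn t)%N.
Proof.
case: (ltnP (mn s) N) => [h1|h1]; last by have := mn_le (s ++ t); lia.
case: (ltnP (mn t) N) => [h2|h2]; last by have := mn_le (s ++ t); lia.
by apply: cov_mn; apply: cov_cat; apply: mn_cov.
Qed.

Lemma mn_mid s t u : (mn t <= mn (s ++ t ++ u))%N.
Proof.
case: (ltnP (mn (s ++ t ++ u)) N) => [h1|h1]; last by have := mn_le t; lia.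
exact/cov_mn/(cov_mid (mn_cov h1)).
Qed.

Definition Mp m : Prop := (M m /\ m <> [::]) \/ size m = 1.

Inductive pt : seq L -> nat -> Prop :=
| pt0 : pt [::] 0
| pt1 m s n : Mp m -> pt s n -> pt (m ++ s) (cst m + n).

Lemma pt_Mp m : Mp m -> pt m (cst m).
Proof. by move=> h; rewrite -(cats0 m) -[X in pt _ X]addn0 cats0; move: (pt1 h pt0);
  rewrite cats0. Qed.

Lemma pt_cat s t n1 n2 : pt s n1 -> pt t n2 -> pt (s ++ t) (n1 + n2).
Proof.
move=> h ht; elim: h => // a s' n' ha _ IH.
by rewrite -catA -addnA; apply: pt1.
Qed.

Lemma pt_ex s : exists n, `[< pt s n >].
Proof.
elim: s => [|x s [n /asboolP h]]; first by exists 0; apply/asboolP/pt0.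
by exists (cst [:: x] + n)%N; apply/asboolP; rewrite -cat1s; apply: pt1 => //; right.
Qed.

Definition w s : nat := ex_minn (pt_ex s).

Lemma pt_w s : pt s (w s).
Proof. by rewrite /w; case: ex_minnP => m /asboolP. Qed.

Lemma w_min s n : pt s n -> (w s <= n)%N.
Proof. by move=> h; rewrite /w; case: ex_minnP => m _; apply; apply/asboolP. Qed.

Lemma w0 : w [::] = 0.
Proof. by apply/eqP; rewrite -leqn0; apply/w_min/pt0. Qed.

Lemma w_cat s t : (w (s ++ t) <= w s + w t)%N.
Proof. by apply/w_min/pt_cat; apply: pt_w. Qed.

Lemma pt_split s t n : pt (s ++ t) n ->
  (exists n1 n2, [/\ pt s n1, pt t n2 & n = (n1 + n2)%N]) \/
  (exists s0 m1 m2 t0 n1 n2, [/\ s = s0 ++ m1, t = m2 ++ t0, m1 <> [::] & m2 <> [::]] /\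
     [/\ M (m1 ++ m2), pt s0 n1, pt t0 n2 & n = (n1 + cst (m1 ++ m2) + n2)%N]).
Proof.
move eu: (s ++ t) => u h; elim: h s t eu => [|m u' n' hm pu IH] s t e.
  by left; exists 0, 0; case: s e => //= ->; split=> //; apply: pt0.
case: (cat_eqP e) => [[m' [em et]]|[m' [mn' es ec]]].
  case: (eqVneq s [::]) => [s0|/eqP sn].
    left; exists 0, (cst m + n')%N; rewrite s0; split=> //; first exact: pt0.
    by move: e; rewrite s0 /= => ->; apply: pt1.
  case: (eqVneq m' [::]) => [m0|/eqP mn'].
    left; exists (cst m), n'; split=> //; last by rewrite et m0.
    by move: em; rewrite m0 cats0 => <-; apply: pt_Mp.
  right; exists [::], s, m', u', 0, n'; split=> //; split=> //; [|exact: pt0|by rewrite -em].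
  rewrite -em; case: hm => [[]//|sz]; move: sz; rewrite em size_cat.
  by case: (s) sn => // ? ?; case: (m') mn' => // ? ? /=; rewrite addnS.
have [[n1 [n2 [h1 h2 ->]]]|[s0 [m1 [m2 [t0 [n1 [n2 [[e1 e2 h1 h2] [h3 h4 h5 ->]]]]]]]]] := IH _ _
  (esym ec).
  left; exists (cst m + n1)%N, n2; split=> //; last by rewrite addnA.
  by rewrite es; apply: pt1.
right; exists (m ++ s0), m1, m2, t0, (cst m + n1)%N, n2; split; split=> //.
- by rewrite es e1 catA.
- exact: pt1.
- by rewrite !addnA.
Qed.

(** The truncated measure is subadditive and each interval also pays its fixed unit, so several
    intervals are never cheaper than one. *)
Lemma pt_cst s n : s <> [::] -> pt s n -> (cst s <= n)%N.
Proof.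
move=> + h; elim: h => // m s' n' hm ps IH _.
case: (eqVneq s' [::]) => [->|/eqP sn]; first by rewrite cats0 leq_addr.
by have := IH sn; rewrite /cst; have := mn_cat m s'; lia.
Qed.

Lemma w_Mcst s : M s -> (w s <= cst s)%N.
Proof.
case: (eqVneq s [::]) => [->|/eqP sn Ms]; first by rewrite w0.
by apply/w_min/pt_Mp; left.
Qed.

Lemma w_catl s t : (w s <= w (s ++ t))%N.
Proof.
case: (pt_split (pt_w (s ++ t))) => [[n1 [n2 [h1 _ ->]]]|].
  by have := w_min h1; lia.
move=> [s0 [m1 [m2 [t0 [n1 [n2 [[-> _ m1n _] [Mm h1 _ ->]]]]]]]].
have := w_min (pt_cat h1 (pt_Mp (or_introl (conj (M_catl Mm) m1n)))).
by have := mn_mid [::] m1 m2; rewrite /cst /=; lia.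
Qed.

Lemma w_catr s t : (w t <= w (s ++ t))%N.
Proof.
case: (pt_split (pt_w (s ++ t))) => [[n1 [n2 [_ h1 ->]]]|].
  by have := w_min h1; lia.
move=> [s0 [m1 [m2 [t0 [n1 [n2 [[_ -> _ m2n] [Mm _ h1 ->]]]]]]]].
have := w_min (pt_cat (pt_Mp (or_introl (conj (M_catr Mm) m2n))) h1).
by have := mn_mid m1 m2 [::]; rewrite cats0 /cst /=; lia.
Qed.

(** An interval that straddles the cut is paid for on both sides, and one of the two copies costs at
    most [D]. *)
Lemma w_super s t : (w s + w t <= w (s ++ t) + D)%N.
Proof.
case: (pt_split (pt_w (s ++ t))) => [[n1 [n2 [h1 h2 ->]]]|].
  by have := w_min h1; have := w_min h2; lia.
move=> [s0 [m1 [m2 [t0 [n1 [n2 [[-> -> m1n m2n] [Mm h1 h2 ->]]]]]]]].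
have := w_min (pt_cat h1 (pt_Mp (or_introl (conj (M_catl Mm) m1n)))).
have := w_min (pt_cat (pt_Mp (or_introl (conj (M_catr Mm) m2n))) h2).
have := mn_mid m1 m2 [::]; rewrite cats0.
by have := cst_le m1; rewrite /cst; lia.
Qed.

Lemma w_gt0 s : s <> [::] -> (0 < w s)%N.
Proof. by move=> sn; have := pt_cst sn (pt_w s); rewrite /cst; lia. Qed.

Definition wF (g : F) : nat := w (letters g).

Lemma wF_wd s : reduced s -> wF (wd s) = w s.
Proof. by move=> rs; rewrite /wF letters_wd. Qed.

Lemma wF_mul g h : (wF (g * h)%g <= wF g + wF h)%N.
Proof.
have [s0 [m [t0 [e1 e2 r]]]] := reduced_cancel (letters_reduced g) (letters_reduced h).
have rm : reduced m by have := letters_reduced g; rewrite e1 => /reduced_catr.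
have -> : (g * h)%g = wd (s0 ++ t0) by rewrite -(wd_cancel s0 t0 rm) -e1 -e2 wd_cat !wdK.
rewrite wF_wd // /wF e1 e2; apply: leq_trans (w_cat _ _) _.
by apply: leq_add; [apply: w_catl|apply: w_catr].
Qed.

Lemma w_upper s b t : M b -> (w (s ++ b ++ t) <= w s + cst b + w t)%N.
Proof.
move=> /w_Mcst h; apply: leq_trans (w_cat _ _) _; have := w_cat b t; lia.
Qed.

(** An interval that straddles the right end of [b] meets it in a small piece. What remains of [b2]
    still costs [D], and the interval can be cut down to its part in [t]. *)
Lemma pt_rtight b b1 b2 t n : M b -> rtight b t -> b = b1 ++ b2 -> lam b2 N.+1 ->
  pt (b2 ++ t) n -> (D + w t <= n)%N.
Proof.
move=> Mb rt eb l2 /pt_split [[n1 [n2 [h1 h2 ->]]]|].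
  have := pt_cst (lam_nil l2) h1; rewrite cst_lam; last exact: lam_le l2.
  by have := w_min h2; lia.
move=> [s0 [m1 [m2 [t0 [n1 [n2 [[e1 e2 m1n m2n] [Mm h1 h2 ->]]]]]]]].
have c1 : cov m1 1.
  by apply: (rstraddle (b1 := b1 ++ s0) (t := t0) _ Mb m2n _ Mm); rewrite -?e2 // -catA -e1.
have ls0 : lam s0 N by apply: (lam_cutr c1); rewrite -e1 addn1.
have := pt_cst (lam_nil ls0) h1; rewrite cst_lam //.
have := w_min (pt_cat (pt_Mp (or_introl (conj (M_catr Mm) m2n))) h2); rewrite -e2.
have := mn_mid m1 m2 [::]; rewrite cats0 /cst; lia.
Qed.

(* When a tight occurrence [c ++ a] overlaps the end [c] of [kk ++ c], an interval
   of the partition that straddles both can be shared out between its two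
   neighbours, which saves at least the fixed part of its cost. *)
Lemma pt_radj s kk c a t n kk1 kk2 : tight s (kk ++ c) (a ++ t) ->
  tight (s ++ kk) (c ++ a) t -> lam (c ++ a) 8 ->
  kk = kk1 ++ kk2 -> lam kk2 N ->
  pt (kk2 ++ c ++ a ++ t) n -> (D + w (a ++ t) <= n)%N.
Proof.
move=> [rd Mb lt rt] [rd' Ma lt' rt'] la ek l2 /pt_split [[n1 [n2 [h1 h2 ->]]]|].
  have := pt_cst (lam_nil l2) h1; rewrite cst_lam //.
  by have := w_min h2; have := w_catr c (a ++ t); lia.
move=> [s0 [m1 [m2 [y0 [n1 [n2 [[e1 e2 m1n m2n] [Mm h1 h2 ->]]]]]]]].
have lt1 : ltight ((s ++ kk1 ++ s0) ++ m1) (c ++ a) by rewrite -!catA -e1 -ek.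
have wy0 := w_min h2.
(* The case in which the straddling interval ends inside [c] or at its end: then everything up to
   its end is large and costs [D]. *)
have inside : M (s0 ++ m1 ++ m2) -> (w (a ++ t) <= w y0)%N ->
    (D + w (a ++ t) <= n1 + cst (m1 ++ m2) + n2)%N.
  move=> Mb2 le.
  have pm : pt (s0 ++ m1 ++ m2) (n1 + cst (m1 ++ m2)).
    by apply: (pt_cat h1); apply: pt_Mp; left; split=> //; case: (m1) m1n.
  have lm : lam (s0 ++ m1 ++ m2) N by rewrite catA -e1; apply: lam_catl.
  by have := pt_cst (lam_nil lm) pm; rewrite cst_lam //; lia.
have Mkk r c1 : c = c1 ++ r -> M ((s0 ++ m1) ++ c1).
  move=> ec; rewrite -e1; apply: (@M_catl _ r).
  by apply: (@M_catr kk1); move: Mb; rewrite ek ec -!catA.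
case: (cat_eqP e2) => [[c' [em ey]]|[c' [cn ec ey]]]; last first.
  by apply: inside; [rewrite catA; apply: Mkk ec|rewrite ey; apply: w_catr].
case: (eqVneq c' [::]) => [c0|/eqP cn].
  apply: inside; last by rewrite ey c0.
  by rewrite catA em c0 cats0; apply: (@Mkk [::]); rewrite cats0.
case: (cat_eqP ey) => [[a2 [ea et]]|[a2 [a2n ea ey0]]].
  exfalso; apply: (ltight_inside (r := [::]) m1n lt1).
  by apply: (@M_catl _ a2); move: Mm; rewrite em ea -!catA.
have cm2 : cov m2 1.
  by apply: (lstraddle (b2 := a2) lt1 Ma m1n _ Mm); rewrite em ea catA.
have la2 : lam a2 7 by apply: (lam_cutl cm2); rewrite em -catA -ea.
have cc' : cov c' 1 by apply: (@cov_catr c); rewrite -em.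
have cm1 : cov m1 1.
  apply: (@cov_catl _ c).
  apply: (rstraddle (b := kk ++ c) (b1 := kk1 ++ s0) (t := y0) _ Mb cn).
  - by rewrite -ey.
  - by rewrite ek e1 -!catA.
  - by rewrite -catA -em.
have ls0 : lam s0 (measure_cut tau) by apply: (lam_cutr cm1); rewrite -e1 addn1.
have m14 := measure_cut14 sc_tau.
have s0n : s0 <> [::] by apply: (@lam_nil _ 0); apply: lam_le ls0; lia.
have cs0 := pt_cst s0n h1; have ms0 := lam_mn ls0 (leqnSn _).
have mm12 : (1 <= mn (m1 ++ m2))%N by apply: lam_mn => //; apply: lam1; case: (m1) m1n.
(* The part [s0] costs at least [C + 1] and the straddling interval at least 2, together [D + 1].
   The unit in excess pays for the small piece [c'] at the beginning of [a]. *)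
suff : (w (a ++ t) <= n2.+1)%N by move: cs0; rewrite /cst; lia.
move: h2; rewrite ey0 => /pt_split [[n3 [n4 [h3 h4 ->]]]|].
  have := pt_cst (lam_nil la2) h3; have := w_min h4; have := w_cat a t.
  by have := w_Mcst (M_catr Ma); have := mn_cat c' a2; have := cov_mn cc'; rewrite -ea /cst; lia.
move=> [s1 [m3 [m4 [y1 [n3 [n4 [[e3 e4 m3n m4n] [Mm' h3 h4 ->]]]]]]]].
have cm3 : cov m3 1.
  apply: (rstraddle (b := c ++ a) (b1 := c ++ c' ++ s1) (t := y1) _ Ma m4n _ Mm').
    by rewrite -e4.
  by rewrite ea e3 !catA.
have s1n : s1 <> [::].
  by apply: (@lam_nil _ 5); apply: (lam_cutr cm3); rewrite -e3.
have Mc1 : M (c' ++ s1) by apply: (@M_mid c _ m3); move: Ma; rewrite ea e3 -!catA.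
have := pt_cst s1n h3; have := w_Mcst Mc1.
have m34 : m3 ++ m4 <> [::] by case: (m3) m3n.
have := w_min (pt1 (or_introl (conj Mm' m34)) h4).
have := w_cat (c' ++ s1) ((m3 ++ m4) ++ y1); have := mn_cat c' s1; have := cov_mn cc'.
by rewrite ea e3 e4 -!catA /cst; lia.
Qed.

(* Two situations in which some cheapest partition of [s ++ b ++ t] has [b], up to
   its ends, as an interval of cost [D]. *)
Definition bigat s b t : Prop :=
  lam b N.+2 \/
  exists kk c a t', [/\ b = kk ++ c, t = a ++ t', tight (s ++ kk) (c ++ a) t',
    lam (c ++ a) 8 & lam kk N.+1].

Lemma w_lower s b t : tight s b t -> bigat s b t -> (w s + D + w t <= w (s ++ b ++ t))%N.
Proof.
move=> tb big; have [rd Mb lt rt] := tb.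
(* What is left of [b] after a small piece has been cut off on the left still forces the cost
   [D]. *)
have key b1 b2 n : b = b1 ++ b2 -> cov b1 1 -> pt (b2 ++ t) n -> (D + w t <= n)%N.
  move=> eb cb1 h; case: big => [lb|[kk [c [a [t' [ek et tk la lk]]]]]].
    by apply: (pt_rtight Mb rt eb _ h); apply: (lam_cutl cb1); rewrite -eb.
  have e : kk ++ c = b1 ++ b2 by rewrite -ek.
  case: (cat_eqP e) => [[m [eb1 _]]|[m [mn ekk eb2]]].
    by exfalso; apply: (cov_lam (cov_catl (_ : cov (kk ++ m) 1)) _ lk); rewrite -?eb1.
  rewrite et; apply: (@pt_radj s kk c a t' n b1 m); rewrite -?et -?ek //.
    by apply: (lam_cutl cb1); rewrite -ekk.
  by move: h; rewrite eb2 et -!catA.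
case: (pt_split (pt_w (s ++ b ++ t))) => [[n1 [n2 [h1 h2 ->]]]|].
  by have := key [::] b n2 erefl (cov0 1) h2; have := w_min h1; lia.
move=> [s0 [m1 [m2 [t0 [n1 [n2 [[e1 e2 m1n m2n] [Mm h1 h2 ->]]]]]]]].
rewrite e1 in lt.
case: (cat_eqP e2) => [[m [em2 _]]|[b2 [b2n eb et0]]].
  exfalso; apply: (ltight_inside (r := [::]) m1n lt).
  by apply: (@M_catl _ m); rewrite /= -catA -em2.
have cm2 : cov m2 1 by apply: (lstraddle lt Mb m1n eb Mm).
rewrite et0 in h2; have := key _ _ _ eb cm2 h2.
have := w_min (pt_cat h1 (pt_Mp (or_introl (conj (M_catl Mm) m1n)))); rewrite -e1.
have := mn_mid [::] m1 m2; rewrite /cst /=; lia.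
Qed.

Lemma w_eq s b t : tight s b t -> bigat s b t -> w (s ++ b ++ t) = (w s + D + w t)%N.
Proof.
move=> tb big; apply/eqP; rewrite eqn_leq w_lower // andbT.
by apply: leq_trans (w_upper _ _ (tight_M tb)) _; have := cst_le b; lia.
Qed.

End Weights.

(** * Moves of the neighbours of an occurrence *)

Section Moves.
Implicit Types (p q : kF) (s t u v a b c e g : seq L).

Lemma tight_uniq s b t b' t' : tight s b t -> tight s b' t' ->
  b ++ t = b' ++ t' -> b = b' /\ t = t'.
Proof.
wlog le : b t b' t' / (size b <= size b')%N => [h tb tb' e|].
  case: (leqP (size b) (size b')) => [le|/ltnW le]; first exact: h.
  by have [-> ->] := h _ _ _ _ le tb' tb (esym e).
move=> [_ _ _ rt] [_ Mb' _ _] e; have [m [eb' et]] := cat_eq e le.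
case: (eqVneq m [::]) => [m0|/eqP mn]; first by rewrite eb' et m0 cats0.
exfalso; rewrite et in rt; apply: (rtight_inside (r := [::]) mn rt).
by rewrite cats0 -eb'.
Qed.

Lemma longest_prefix u a : M u ->
  exists e r, [/\ a = e ++ r, M (u ++ e) & forall z r', r = z :: r' -> ~ M (rcons (u ++ e) z)].
Proof.
elim: a u => [|x a IH] u Mu; first by exists [::], [::]; split; rewrite ?cats0.
have [Mx|nMx] := EM (M (rcons u x)).
  have [e [r [-> Me h]]] := IH _ Mx; exists (x :: e), r.
  by rewrite -cat_rcons; split.
by exists [::], (x :: a); split; rewrite ?cats0 // => z r' [<- _].
Qed.

Lemma longest_suffix u a : M u ->
  exists r e, [/\ a = r ++ e, M (e ++ u) & forall z r', r = rcons r' z -> ~ M (z :: e ++ u)].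
Proof.
elim/last_ind: a u => [|a x IH] u Mu; first by exists [::], [::]; split=> // z [|? ?].
have [Mx|nMx] := EM (M (x :: u)).
  have [r [e [-> Me h]]] := IH _ Mx; exists r, (rcons e x).
  by rewrite rcons_cat cat_rcons; split.
by exists (rcons a x), [::]; split; rewrite ?cats0 // => z r' /rcons_inj [_ <-].
Qed.

(** When the right neighbour becomes [a'], the maximal occurrence after [s] keeps its part [u], and
    its new end is the longest prefix of [a'] that [u] can absorb. It cannot absorb all of [a'],
    which is maximal itself. *)
Lemma turn_slot s u v a t a' : u <> [::] -> lam u 2 ->
  tight s (u ++ v) (a ++ t) -> tight (s ++ u) a' t ->
  exists e r, [/\ a' = e ++ r, r <> [::] & tight s (u ++ e) (r ++ t)].
Proof.
move=> un u2 [rd Mu lt rt] [rd' Ma' lt' rt'].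
have [e [r [ea Me h]]] := longest_prefix a' (M_catl Mu).
have rn : r <> [::].
  by move=> r0; apply: (ltight_inside (r := [::]) un lt'); rewrite /= ea r0 cats0.
exists e, r; split=> //; split=> //.
- by move: rd'; rewrite ea -!catA.
- move=> s' y es My; apply: (lt s' y es); rewrite -cat_cons.
  have := @M_left y u v Mu u2; apply; apply: (@M_catl _ e); exact: My.
- by case: (r) rn h => // z r' _ h z' t' [<- _]; apply: (h z r').
Qed.

(** The length is recorded because [steps_core] is proved by induction on it. *)
Inductive chain (T : Type) (r : T -> T -> Prop) : nat -> T -> T -> Prop :=
| chain0 x : chain r 0 x x
| chainS n x y z : chain r n x y -> r y z -> chain r n.+1 x z.

Section Chain.
Context (T : Type).
Implicit Types (r : T -> T -> Prop) (x y z : T).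

Lemma chain1 r x y : r x y -> chain r 1 x y.
Proof. exact/chainS/chain0. Qed.

Lemma chain_trans r n n' x y z :
  chain r n x y -> chain r n' y z -> chain r (n + n') x z.
Proof.
move=> h hh; elim: hh h => [y0 h|n2 y1 y2 y3 _ IH st h]; first by rewrite addn0.
by rewrite addnS; apply: chainS (IH h) st.
Qed.

Lemma chain_sym r n x y : (forall x y, r x y -> r y x) -> chain r n x y -> chain r n y x.
Proof.
move=> sym; elim=> [x0|n' x' y' z' _ IH st]; first exact: chain0.
by rewrite -add1n; apply: chain_trans IH; apply/chain1/sym.
Qed.

Lemma chain_mono r r' n x y : (forall x y, r x y -> r' x y) -> chain r n x y -> chain r' n x y.
Proof.
move=> h; elim=> [x0|n' x' y' z' _ IH st]; first exact: chain0.
exact: chainS IH (h _ _ st).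
Qed.

End Chain.

Section Steps.
Variables (m j : nat).
Implicit Types (x y z : seq L * seq L).

(* Replacement of an occurrence lying to the right of the occurrence [b] in
   [s ++ b ++ t], with a gap [g] in between. *)
Inductive fstep s : seq L * seq L -> seq L * seq L -> Prop :=
| Fstep b g a a1 t (p : kF) : g <> [::] ->
    tight s b (g ++ a ++ t) -> tight s b (g ++ a1 ++ t) ->
    tight (s ++ b ++ g) a t -> tight (s ++ b ++ g) a1 t ->
    Rel p -> inp p a -> inp p a1 -> lam a m -> lam a1 m ->
    fstep s (b, g ++ a ++ t) (b, g ++ a1 ++ t).

(* The same for an occurrence adjacent to [b], or overlapping it. *)
Inductive step s : seq L * seq L -> seq L * seq L -> Prop :=
| step_far x y : fstep s x y -> step s x y
| step_adj u c c1 a a1 t (p : kF) : u <> [::] ->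
    tight s (u ++ c) (a ++ t) -> tight s (u ++ c1) (a1 ++ t) ->
    tight (s ++ u) (c ++ a) t -> tight (s ++ u) (c1 ++ a1) t ->
    Rel p -> inp p (c ++ a) -> inp p (c1 ++ a1) ->
    lam (c ++ a) m -> lam (c1 ++ a1) m -> lam a j -> lam a1 j ->
    step s (u ++ c, a ++ t) (u ++ c1, a1 ++ t).

Lemma fstep_sym s x y : fstep s x y -> fstep s y x.
Proof. by case=> b g a a1 t p *; apply: (Fstep (p := p)). Qed.

Lemma step_sym s x y : step s x y -> step s y x.
Proof.
case=> [{}x {}y /fstep_sym|u c c1 a a1 t p *]; first exact: step_far.
exact: (step_adj (p := p)).
Qed.

Lemma step_tight s x y : step s x y -> tight s x.1 x.2 /\ tight s y.1 y.2.
Proof. by case=> // ? ? []. Qed.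

Lemma steps_tight s n x y : chain (step s) n x y -> tight s x.1 x.2 -> tight s y.1 y.2.
Proof. by case=> // ? ? ? ? _ /step_tight []. Qed.

(** Isolates the last step that acts on an adjacent occurrence; only far steps follow it. *)
Lemma chain_adj s n x y : chain (step s) n x y -> chain (fstep s) n x y \/
  exists n1 n2 u c c1 a a1 t p, [/\ (n1 + n2 < n)%N, chain (step s) n1 x (u ++ c, a ++ t),
    chain (fstep s) n2 (u ++ c1, a1 ++ t) y, u <> [::] & lam a j /\ lam a1 j] /\
    [/\ tight s (u ++ c) (a ++ t), tight s (u ++ c1) (a1 ++ t),
    tight (s ++ u) (c ++ a) t, tight (s ++ u) (c1 ++ a1) t &
    [/\ Rel p, inp p (c ++ a), inp p (c1 ++ a1),
    lam (c ++ a) m & lam (c1 ++ a1) m]].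
Proof.
elim=> [x0|n' x0 y0 z0 h IH st]; first by left; apply: chain0.
case: st h IH => [x1 y1 f|u c c1 a a1 t p un t1 t2 t3 t4 rp i1 i2 l1 l2 l3 l4] h; last first.
  move=> _; right; exists n', 0, u, c, c1, a, a1, t, p; rewrite addn0.
  by split; split=> //; apply: chain0.
case=> [fs|[n1 [n2 [u [c [c1 [a [a1 [t [p [[le ch fs un lj] H]]]]]]]]]]].
  by left; apply: chainS fs f.
right; exists n1, n2.+1, u, c, c1, a, a1, t, p; split=> //; split=> //; first by rewrite addnS.
exact: chainS fs f.
Qed.

End Steps.

End Moves.

Local Notation steps m j s := (chain (step m j s)).
Local Notation fsteps m s := (chain (fstep m s)).

Section StepLemmas.
Implicit Types (p q : kF) (s t u v a b c e g : seq L).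

Lemma step_mono m j m' j' s (x y : seq L * seq L) : (m' <= m)%N -> (j' <= j)%N ->
  step m j s x y -> step m' j' s x y.
Proof.
move=> lm lj; case=> [{}x {}y [b d a a1 t p *]|u c c1 a a1 t p *].
  by apply/step_far/(Fstep (p := p)) => //; apply: lam_le lm _.
by apply: (step_adj (p := p)) => //;
  solve [apply: lam_le lm _; done | apply: lam_le lj _; done].
Qed.

Lemma steps_mono m j m' j' s n (x y : seq L * seq L) : (m' <= m)%N -> (j' <= j)%N ->
  steps m j s n x y -> steps m' j' s n x y.
Proof. by move=> lm lj; apply: chain_mono => ? ?; apply: step_mono. Qed.

Lemma steps_sym m j s n (x y : seq L * seq L) : steps m j s n x y -> steps m j s n y x.
Proof. by apply: chain_sym; apply: step_sym. Qed.

(** Of two such occurrences, the one that starts earlier would contain the other or overlap it in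
    more than a small piece, against maximality. *)
Lemma right_touching_uniq s b t u c a t1 u' c' a' t1' :
  M b -> b = u ++ c -> b = u' ++ c' -> t = a ++ t1 -> t = a' ++ t1' ->
  u <> [::] -> u' <> [::] ->
  tight (s ++ u) (c ++ a) t1 -> tight (s ++ u') (c' ++ a') t1' ->
  lam (c ++ a) 3 -> lam (c' ++ a') 3 -> u = u'.
Proof.
wlog le : u c a t1 u' c' a' t1' / (size u <= size u')%N => [h Mb e1 e2 e3 e4 un un' h1 h2 l1 l2|].
  case: (leqP (size u) (size u')) => [le|/ltnW le]; first exact: (h u c a t1 u' c' a' t1').
  by apply/esym; apply: (h u' c' a' t1' u c a t1).
move=> Mb eb eb' et et' un un' [_ Ma lt rt] [_ Ma' lt' rt'] l1 l2.
have e : u ++ c = u' ++ c' by rewrite -eb.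
have [d [eu ec]] := cat_eq e le.
case: (eqVneq d [::]) => [d0|/eqP dn]; first by rewrite eu d0 cats0.
exfalso; have ea : a ++ t1 = a' ++ t1' by rewrite -et.
rewrite eu catA in lt'.
case: (cat_eqP ea) => [[r [ea' _]]|[r [rn ea' _]]].
  have cc : cov c 1 by apply: (lstraddle lt Ma un erefl); rewrite -eb.
  have l2' : lam (c' ++ a) 2.
    apply: (lam_cutl (s := d) (m := 1)); last by rewrite catA -ec.
    by apply: (@cov_catl _ c'); rewrite -ec.
  case/lastP: d dn eu ec lt' => // d y _ eu ec lt'.
  apply: (lt' ((s ++ u) ++ d) y); first by rewrite rcons_cat.
  rewrite ea' catA; apply: M_left => //; first by rewrite -catA -ea'.
  by apply: (@M_catr d); rewrite -cat_rcons catA -ec.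
apply: (ltight_inside (r := [::]) dn lt'); rewrite /= .
by apply: (@M_catl _ r); rewrite -!catA -ea' catA -ec.
Qed.

End StepLemmas.

(** * Paths of moves and their transport to incident monomials *)

Section Paths.
Implicit Types (p q : kF) (s t u v a b c e : seq L) (g h : F).

(** Seen from the right neighbour [c ++ a0] of [u ++ c], a replacement far from [u ++ c] is again a
    step. If it touches that neighbour, a small piece is lost to the overlap, whence the second
    index [m]. *)
Lemma far_step_inside m s u c a0 T0 (d : seq L) a a1 t p : u <> [::] -> d <> [::] ->
  tight s (u ++ c) (d ++ a ++ t) -> tight s (u ++ c) (d ++ a1 ++ t) ->
  tight (s ++ (u ++ c) ++ d) a t -> tight (s ++ (u ++ c) ++ d) a1 t ->
  Rel p -> inp p a -> inp p a1 -> lam a m.+1 -> lam a1 m.+1 ->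
  a0 ++ T0 = d ++ a ++ t -> tight (s ++ u) (c ++ a0) T0 -> lam (c ++ a0) 3 ->
  exists a0' T0', a0' ++ T0' = d ++ a1 ++ t /\
    step m.+1 m (s ++ u) (c ++ a0, T0) (c ++ a0', T0').
Proof.
move=> un dn tb tb1 ta ta1 rp ia ia1 la la1 e tA lA.
have lAn : c ++ a0 <> [::] by apply: lam_nil lA.
have [rA MA lt rt] := tA.
case: (cat_eqP e) => [[d' [ed eT]]|[e0 [e0n ea eT]]].
- have [d0|/eqP dn'] := eqVneq d' [::].
    subst d'; rewrite cats0 /= in ed eT; subst a0 T0.
    have tA' : tight (s ++ u) ((c ++ d) ++ [::]) (a ++ t) by rewrite cats0.
    have ta1' : tight ((s ++ u) ++ c ++ d) a1 t by move: ta1; rewrite -!catA.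
    have [e1 [r [ea1 rn tr1]]] := turn_slot lAn (@lam_le _ 3 2 isT lA) tA' ta1'.
    exists (d ++ e1), (r ++ t); split; first by rewrite ea1 -!catA.
    rewrite catA -{1}(cats0 (c ++ d)).
    apply: (@step_adj _ _ _ (c ++ d) [::] e1 a r t p) => //.
    + by move: ta; rewrite -!catA.
    + by rewrite -ea1.
    + by rewrite -ea1.
    + by rewrite -ea1.
    + exact: lam_le la.
    + rewrite ea1 in la1; apply: (lam_cutl (m := 1)) la1.
      case: ta1' => _ Ma1 lt1 _; apply: (lstraddle lt1 Ma1 lAn ea1).
      by case: tr1.
  subst d T0; exists a0, (d' ++ a1 ++ t); split; first by rewrite -catA.
  apply/step_far/(Fstep (p := p)) => //.
  + split=> //; first by have := tight_red tb1; rewrite -!catA.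
    by apply/(rtight_cat _ _ dn'); move/(rtight_cat _ _ dn'): rt.
  + by move: ta; rewrite -!catA.
  + by move: ta1; rewrite -!catA.
- subst a0.
  have dn1 : c ++ d <> [::] by case: (c) => //; exact: dn.
  have [r0 [rn [ea et]]] : exists r0, r0 <> [::] /\ a = e0 ++ r0 /\ T0 = r0 ++ t.
    case: (cat_eqP eT) => [[r [e1 e2]]|[r [rn e1 e2]]].
      subst e0; case: ta => _ _ lta _; exfalso.
      apply: (@ltight_inside a (c ++ d) (s ++ u) [::] dn1); first by move: lta; rewrite -!catA.
      by apply: (@M_catl _ r); rewrite /= -!catA in MA *.
    by exists r.
  subst a T0.
  have ta' : tight ((s ++ u) ++ (c ++ d)) (e0 ++ r0) t by move: ta; rewrite -!catA.
  have ta1' : tight ((s ++ u) ++ (c ++ d)) a1 t by move: ta1; rewrite -!catA.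
  have ce0 : cov e0 1.
    case: (ta') => _ Ma lta _; apply: (lstraddle lta Ma dn1 erefl).
    by rewrite -catA.
  have lcd : lam (c ++ d) 2.
    by apply: (lam_cutr (m := 1) ce0); rewrite -catA.
  have tA' : tight (s ++ u) ((c ++ d) ++ e0) (r0 ++ t) by rewrite -catA.
  have [e1 [r [ea1 rn1 tr1]]] := turn_slot dn1 lcd tA' ta1'.
  exists (d ++ e1), (r ++ t); split; first by rewrite ea1 -!catA.
  rewrite !catA; apply: (@step_adj _ _ _ _ _ _ _ _ _ p) => //.
  + by rewrite -ea1.
  + by rewrite -ea1.
  + by rewrite -ea1.
  + exact: (lam_cutl (m := 1) ce0 la).
  + rewrite ea1 in la1; apply: (lam_cutl (m := 1)) la1.
    case: ta1' => _ Ma1 lt1 _; apply: (lstraddle lt1 Ma1 dn1 ea1).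
    by case: tr1.
Qed.

(** The slot of the right neighbour; [c] is its overlap with [x.1], empty when the two merely
    touch. *)
Definition adj m s (x : seq L * seq L) u c a T : Prop :=
  [/\ u <> [::], x = (u ++ c, a ++ T), tight (s ++ u) (c ++ a) T & lam (c ++ a) m].

Lemma adj_mono m m' s x u c a T : (m' <= m)%N -> adj m s x u c a T -> adj m' s x u c a T.
Proof. by move=> le [? ? ? l]; split=> //; apply: lam_le l. Qed.

Lemma adj_cov m s x u c a T : M x.1 -> adj m s x u c a T -> cov c 1.
Proof. by move=> Mx [un ex [_ Ma lt _] _]; apply: (lstraddle lt Ma un erefl); rewrite ex in Mx. Qed.

Lemma adj_uniq s x u c a T u' c' a' T' : M x.1 ->
  adj 3 s x u c a T -> adj 3 s x u' c' a' T' -> [/\ u = u', c = c', a = a' & T = T'].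
Proof.
move=> Mx [un e1 ta l1] [un' e2 ta' l2].
have [ec et] : u ++ c = u' ++ c' /\ a ++ T = a' ++ T' by move: e1; rewrite e2 => -[-> ->].
have eu : u = u'.
  apply: (@right_touching_uniq s x.1 x.2 u c a T u' c' a' T') => //.
  by rewrite e1. by rewrite e2. by rewrite e1. by rewrite e2.
subst u'; have eqc : c = c' by have := eqP (introT eqP ec); move/eqP;
  rewrite eqseq_cat // eqxx => /eqP.
subst c'; have e : (c ++ a) ++ T = (c ++ a') ++ T' by rewrite -!catA et.
have [/eqP + ->] := tight_uniq ta ta' e.
by rewrite eqseq_cat // eqxx => /eqP ->.
Qed.

Lemma fstep_adj m s x y u c a T : adj 3 s x u c a T -> fstep m.+1 s x y ->
  exists a' T', [/\ y = (u ++ c, a' ++ T'), tight (s ++ u) (c ++ a') T' &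
    step m.+1 m (s ++ u) (c ++ a, T) (c ++ a', T')].
Proof.
move=> [un ex ta la] f; case: f ex => b d a0 a1 t p dn t1 t2 t3 t4 rp i1 i2 l1 l2 [eb et].
subst b; have [a' [T' [e st]]] := far_step_inside un dn t1 t2 t3 t4 rp i1 i2 l1 l2 (esym et) ta la.
by exists a', T'; split=> //; [rewrite e|case: (step_tight st)].
Qed.

(** The hypothesis on paths of length at most [n] is what the induction in [steps_core] supplies. It
    keeps the neighbour large, so that one and the same neighbour can be followed to the end. *)
Lemma fsteps_adj m s n u c a T x y : (3 <= m)%N ->
  (forall o s x y, (o <= n)%N -> tight s x.1 x.2 -> lam x.1 m.+1 ->
     steps m.+1 0 s o x y -> lam y.1 m) ->
  adj m.+1 s x u c a T -> fsteps m.+1 s n x y ->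
  exists a' T', adj m s y u c a' T' /\ steps m.+1 m (s ++ u) n (c ++ a, T) (c ++ a', T').
Proof.
move=> m3 + ax h; elim: h ax => [x0|n' x0 y0 z0 h IH st] ax hyp.
  by exists a, T; split; [apply: adj_mono ax|apply: chain0].
have [a' [T' [ay sty]]] := IH ax (fun o s x y le => hyp o s x y (leqW le)).
have [a2 [T2 [ez tz st2]]] := fstep_adj (adj_mono m3 ay) st.
have stz := chainS sty st2; exists a2, T2; split=> //.
case: ax ay => un _ ta la [_ _ _ _]; split=> //.
by apply: (hyp n'.+1 (s ++ u) (c ++ a, T) (c ++ a2, T2)) => //; apply: steps_mono stz.
Qed.

Lemma fsteps_tightl m s n x y : fsteps m s n x y -> x.1 = y.1.
Proof. by elim=> // n' x0 y0 z0 _ -> []. Qed.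

Lemma fsteps_sym m s n x y : fsteps m s n x y -> fsteps m s n y x.
Proof. by apply: chain_sym; apply: fstep_sym. Qed.

Lemma core_lam m s x y u c a T c' a' T' r : M x.1 -> adj m s x u c a T -> adj m s y u c' a' T' ->
  lam x.1 r.+1 -> lam u r /\ lam y.1 r.
Proof.
move=> Mx ax ay lx; have cc := adj_cov Mx ax.
have lu : lam u r.
  by case: ax lx => _ -> _ _ lx; apply: (lam_cutr (m := 1) cc); rewrite addn1.
by split=> //; case: ay => _ -> _ _; apply: lam_catl.
Qed.

(* Along a path of steps, either [b] never changes, or it changes only in its
   overlap with a fixed adjacent occurrence. *)
Lemma steps_core m j s n x y : (3 <= m)%N -> tight s x.1 x.2 -> steps m.+1 j s n x y ->
  fsteps m.+1 s n x y \/
  exists u c a T c' a' T', adj m s x u c a T /\ adj m s y u c' a' T'.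
Proof.
move=> m3; elim/ltn_ind: n j s x y => n IH j s x y tx h.
have hyp o s0 x0 y0 : (o < n)%N -> tight s0 x0.1 x0.2 -> lam x0.1 m.+1 ->
     steps m.+1 0 s0 o x0 y0 -> lam y0.1 m.
  move=> lt t0 l0 h0; case: (IH _ lt _ _ _ _ t0 h0) => [/fsteps_tightl <-|].
    exact: lam_le l0.
  by move=> [u [c [a [T [c' [a' [T' [a1 a2]]]]]]]]; case: (core_lam (tight_M t0) a1 a2 l0).
(* The path is cut at its last adjacent step. The neighbour replaced there is followed through the
   far steps behind it, and [adj_uniq] identifies it with the one found by induction for the path
   before it. *)
case: (chain_adj h) => [|[n1 [n2 [u [c [c1 [a [a1 [t [p [[le h1 h2 un _] [t1 t2 t3 t4 [rp i1 i2 l1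
  l2]]]]]]]]]]]]]; first by left.
right.
have ay1 : adj m.+1 s (u ++ c1, a1 ++ t) u c1 a1 t by split.
have ax1 : adj m.+1 s (u ++ c, a ++ t) u c a t by split.
have [|a' [T' [ay _]]] := fsteps_adj m3 _ ay1 h2.
  by move=> o s0 x0 y0 lek; apply: hyp; lia.
have [|f|[u0 [c0 [a0 [T0 [c0' [a0' [T0' [a1' a2']]]]]]]]] := IH n1 _ j s x _ tx h1; first by lia.
  have [|a'' [T'' [ax _]]] := fsteps_adj m3 _ ax1 (fsteps_sym f).
    by move=> o s0 x0 y0 lek; apply: hyp; lia.
  by exists u, c, a'', T'', c1, a', T'.
have [|eu _ _ _] := adj_uniq _ (adj_mono m3 a2') (adj_mono (leqW m3) ax1); first exact: tight_M t1.
by subst u0; exists u, c0, a0, T0, c1, a', T'.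
Qed.

(** However long the path, only the overlap with one neighbour can change, and this overlap is a
    small piece. *)
Lemma steps_lam m j s n x y r : (3 <= m)%N -> tight s x.1 x.2 -> lam x.1 r.+1 ->
  steps m.+1 j s n x y -> lam y.1 r.
Proof.
move=> m3 tx lx h; case: (steps_core m3 tx h) => [/fsteps_tightl <-|]; first exact: lam_le lx.
by move=> [u [c [a [T [c' [a' [T' [a1 a2]]]]]]]]; case: (core_lam (tight_M tx) a1 a2 lx).
Qed.

Lemma cov_winv_suffix o c : M o -> M c -> forall d d', c = d ++ winv o ++ d' -> cov c 1 -> cov o 1.
Proof.
move=> Mk Mc d d' ec cc; rewrite -(winvK o); apply: cov_winv; rewrite ?winvK //.
  by apply: (@M_mid d _ d'); rewrite -ec.
by apply: (@cov_mid d _ d'); rewrite -ec.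
Qed.

(** Cancelling against [c^-1] and then against [c1] removes from the end of [b] at most one small
    piece each time; the second piece occurs inverted in [c1], and [cov_winv] applies. *)
Lemma mul_pieces b c c1 : M b -> M c -> M c1 -> cov c 1 -> cov c1 1 ->
  exists b0 o k1, [/\ b = b0 ++ o, cov o 2, reduced (b0 ++ k1) &
    wd (b0 ++ k1) = (wd b * ((wd c)^-1 * wd c1))%g].
Proof.
move=> Mb Mc Mc1 cc cc1.
have rc := M_reduced Mc; have rc1 := M_reduced Mc1.
have [b0 [o [t0 [eb ec r0]]]] := reduced_cancel (M_reduced Mb) (winv_reduced rc).
have ck : cov o 1.
  apply: (@cov_catr (winv t0)); rewrite -(winvK o) -winv_cat -ec winvK //.
have rk : reduced o by have := M_reduced Mb; rewrite eb => /reduced_catr.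
have e0 : wd (b0 ++ t0) = (wd b * (wd c)^-1)%g.
  by rewrite -(wd_cancel b0 t0 rk) -eb -ec wd_cat wdV.
have [f [k2 [r [ef ec1 r1]]]] := reduced_cancel r0 rc1.
have rk2 : reduced k2 by move: r0; rewrite ef => /reduced_catr.
have e1 : wd (f ++ r) = (wd b * ((wd c)^-1 * wd c1))%g.
  by rewrite -(wd_cancel f r rk2) -ef -ec1 wd_cat e0 mulgA.
case: (cat_eqP ef) => [[d [ed _]]|[d [dn ed ek2]]]; last first.
  exists f, (d ++ o), r; split=> //; first by rewrite eb ed catA.
  rewrite -[2]/(1 + 1)%N; apply: cov_cat => //.
  have Md : M d by apply: (@M_mid f _ o); rewrite catA -ed -eb.
  by apply: (@cov_winv_suffix d c1 Md Mc1 (winv t0) r) => //; rewrite catA -winv_cat -ek2.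
exists b0, o, (d ++ r); split=> //.
- exact: cov_pad ck.
- by rewrite catA -ed.
- by rewrite catA -ed.
Qed.

Lemma ltight_change s s' d b : d <> [::] -> ltight (s ++ d) b -> ltight (s' ++ d) b.
Proof. by move=> dn h; apply: (proj1 (ltight_cat s' b dn)); apply: (proj2 (ltight_cat s b dn)). Qed.

Lemma rtight_change t t' d b : d <> [::] -> rtight b (d ++ t) -> rtight b (d ++ t').
Proof. by move=> dn h; apply: (proj1 (rtight_cat b t' dn)); apply: (proj2 (rtight_cat b t dn)). Qed.

(** An adjacent step multiplies [x.1] on the right by [c^-1 c1], and a far one by 1. The same factor
    acts on [q], and its effect on [b] is again a step, possibly with another overlap [e] in place
    of [c]. *)
Lemma step_transport m j s x y q b : (3 <= j)%N -> (j <= m)%N -> step m j s x y ->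
  Rel q -> inp q x.1 -> inp q b -> tight s b x.2 -> lam b 4 -> lam x.1 4 ->
  exists b', [/\ step j j s (b, x.2) (b', y.2), wd b' = (wd b * ((wd x.1)^-1 * wd y.1))%g &
    Rel (tr 1%g q ((wd x.1)^-1 * wd y.1)%g)].
Proof.
move=> j3 jm; case=> [{}x {}y [d g a a1 t p gn t1 t2 t3 t4 rp i1 i2 l1 l2]|
    u c c1 a a1 t p un t1 t2 t3 t4 rp i1 i2 l1 l2 l3 l4] rq ix ib tb lb lx.
  rewrite /= in ix lx tb *; exists b; rewrite !mulVg tr11 mulg1; split=> //.
  apply/step_far/(Fstep (p := p)) => //.
  - have [r _ lt rt] := tb; split=> //.
    + have := reduced_cat3 gn; move: r t4 => + []; rewrite !catA => /reduced_catl/reduced_catl r.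
      rewrite -!catA => /reduced_catr/reduced_catr r' _ _ _ /(_ (s ++ b) (a1 ++ t)).
      by rewrite -!catA in r *; apply.
    + exact: tight_M tb.
    + exact: rtight_change gn rt.
  - case: t3 => r Ma lt rt; split=> //.
      by have := tight_red tb; rewrite -!catA.
    by rewrite catA; apply: (ltight_change (s := s ++ d)) => //; rewrite -catA.
  - case: t4 => r Ma lt rt; split=> //; last first.
      by rewrite catA; apply: (ltight_change (s := s ++ d)) => //; rewrite -catA.
    have := reduced_cat3 gn; have := tight_red tb; rewrite !catA => /reduced_catl/reduced_catl r0.
    move: r; rewrite -!catA => /reduced_catr/reduced_catr r' /(_ (s ++ b) (a1 ++ t)).
    by rewrite -!catA in r0 *; apply.
  - exact: lam_le l1.
  - exact: lam_le l2.
rewrite /= in ix lx tb *.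
have Mc : M c by apply: (@M_catr u); exact: tight_M t1.
have Mc1 : M c1 by apply: (@M_catr u); exact: tight_M t2.
have cc : cov c 1 by case: t3 => _ Ma lt _; apply: (lstraddle lt Ma un erefl); exact: tight_M t1.
have cc1 : cov c1 1 by case: t4 => _ Ma lt _; apply: (lstraddle lt Ma un erefl); exact: tight_M t2.
have lu : lam u 3 by apply: (lam_cutr (m := 1) cc); rewrite addn1.
have -> : ((wd (u ++ c))^-1 * wd (u ++ c1) = (wd c)^-1 * wd c1)%g.
  by rewrite !wd_cat invgM -mulgA mulKg.
have Mb := tight_M tb.
have rq' : Rel (tr 1%g q ((wd c)^-1 * wd c1)%g).
  have := @piece_lr q u [::] c [::] c1 (@lam_le _ 3 2 isT lu) rq.
  by rewrite /= => /(_ (M_reduced (tight_M t1)) ix (tight_M t2)) [].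
have an : a <> [::] by apply: (@lam_nil _ 2); apply: lam_le l3.
have an1 : a1 <> [::] by apply: (@lam_nil _ 2); apply: lam_le l4.
have a2 : lam a 2 by apply: lam_le l3; lia.
have a12 : lam a1 2 by apply: lam_le l4; lia.
have [b0 [o [k1 [eb ck rb1 eb1]]]] := mul_pieces Mb Mc Mc1 cc cc1.
set b1 := b0 ++ k1 in rb1 eb1.
have lb0 : lam b0 2 by apply: (lam_cutr (m := 2) ck); rewrite -eb.
have lb1 : lam b1 2 by apply: lam_catl.
have ib1 : inp (tr 1%g q ((wd c)^-1 * wd c1)%g) b1.
  by apply: (inp_tr _ ib); rewrite mul1g eb1.
have ix1 : inp (tr 1%g q ((wd c)^-1 * wd c1)%g) (u ++ c1).
  by apply: (inp_tr _ ix); rewrite mul1g wd_cat -mulgA mulVKg wd_cat.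
have lu1 : lam (u ++ c1) 2 by apply: lam_catl; apply: lam_le lu.
have tb1 : tight s b1 (a1 ++ t) := tight_move t2 lu1 rq' ix1 ib1 rb1 lb1.
have Ma : M a by apply: (@M_catr c); exact: tight_M t3.
have [v [e [ebv Me he]]] := longest_suffix b Ma.
have vn : v <> [::].
  move=> v0; subst v; rewrite /= in ebv; subst e.
  by case: tb => _ _ _ rt; apply: (rtight_inside (t := t) (r := [::]) an rt); rewrite cats0.
have te : tight (s ++ v) (e ++ a) t.
  split=> //.
  - by have := tight_red tb; rewrite ebv -!catA.
  - by apply: (proj1 (ltight_cat s (e ++ a) vn)) => v' y1 ev; exact: he ev.
  - move=> z t' et Mz; case: t3 => _ Mca _ rt3; apply: (rt3 z t' et).
    have := @M_right z a (c) Mca a2; apply; apply: (@M_catr e); rewrite -rcons_cat //.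
have rp' : Rel (tr (wd e * (wd c)^-1)%g p 1%g).
  have := @piece_lr p a c [::] e [::] a2 rp; rewrite !cats0.
  by move=> /(_ (M_reduced (tight_M t3)) i1 Me) [].
have ie : inp (tr (wd e * (wd c)^-1)%g p 1%g) (e ++ a).
  by apply: (inp_tr _ i1); rewrite mulg1 !wd_cat -mulgA mulKg.
(* The monomial [c1 ++ a1] of [p], read in the translate of [p] that contains [e ++ a]. *)
pose gx : F := (wd e * ((wd c)^-1 * wd c1) * wd a1)%g.
have ig : inp (tr (wd e * (wd c)^-1)%g p 1%g) (letters gx).
  by apply: (inp_tr _ i2); rewrite mulg1 wdK wd_cat /gx !mulgA.
have eg : wd (v ++ letters gx) = wd (b1 ++ a1).
  by rewrite [RHS]wd_cat eb1 [LHS]wd_cat wdK /gx ebv wd_cat !mulgA.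
have rg : reduced (letters gx) := letters_reduced gx.
have rb1a : reduced (b1 ++ a1) by have := tight_red tb1 => /reduced_catr;
  rewrite catA => /reduced_catl.
have nob m' r : a1 = m' ++ r -> m' <> [::] -> ~ M (b1 ++ m').
  move=> ea mn Mm; case: tb1 => _ _ _; rewrite ea -catA => rt.
  by apply: (rtight_inside (r := [::]) mn rt); rewrite cats0.
have rv : reduced v by have := M_reduced Mb; rewrite ebv => /reduced_catl.
have Mv : M v by rewrite ebv in Mb; apply: M_catl Mb.
have gn : letters gx <> [::].
  move=> g0; apply: (nob a1 [::]); rewrite ?cats0 //.
  by rewrite g0 cats0 in eg; rewrite -(wd_inj rv rb1a eg).
have la' : lam (e ++ a) 2 by apply: lam_catr.
have rvg := tight_inc te la' rp' ie ig rg gn.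
have evg : v ++ letters gx = b1 ++ a1.
  by apply: wd_inj => //; move: rvg; rewrite -catA => /reduced_catr; rewrite catA => /reduced_catl.
case: (cat_eqP evg) => [[e1 [eb1' eg']]|[r [rn ev ea1]]]; last first.
  by exfalso; apply: (nob _ _ ea1 rn); rewrite -ev.
have ce : cov e 1.
  by case: tb => _ _ _ rt; apply: (rstraddle rt Mb an ebv Me).
exists b1; split=> //; rewrite ebv eb1'.
apply: (step_adj (p := tr (wd e * (wd c)^-1)%g p 1%g)) => //.
- by rewrite -ebv.
- by rewrite -eb1'.
- rewrite -eg'; apply: tight_move te la' rp' ie ig rg _.
  by rewrite eg'; apply: lam_catr.
- by rewrite -eg'.
- by apply: lam_catr.
- by apply: lam_catr.
Qed.

Lemma steps_transport j s n x y q b : (3 <= j)%N -> steps j.+1 j.+1 s n x y ->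
  tight s x.1 x.2 -> Rel q -> inp q x.1 -> inp q b -> tight s b x.2 ->
  lam b 5 -> lam x.1 5 ->
  exists b', [/\ steps j.+1 j.+1 s n (b, x.2) (b', y.2),
    wd b' = (wd b * ((wd x.1)^-1 * wd y.1))%g &
    Rel (tr 1%g q ((wd x.1)^-1 * wd y.1)%g)].
Proof.
move=> j3 h tx rq ix ib tb lb lx; elim: h tx ix lx tb => [x0|n' x0 y0 z0 h IH st] tx ix lx tb.
  by exists b; rewrite mulVg mulg1 tr11; split=> //; apply: chain0.
have [b1 [hb eb rq1]] := IH tx ix lx tb.
have tb1 := steps_tight hb tb.
have lb1 : lam b1 4 := steps_lam (x := (b, x0.2)) (y := (b1, y0.2)) j3 tb lb hb.
have ly : lam y0.1 4 := steps_lam j3 tx lx h.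
have [||b2 [st2 eb2 rq2]] := @step_transport j.+1 j.+1 s y0 z0 _ b1 (ltnW j3) (leqnn _) st rq1 _ _
  tb1 lb1 ly.
- by apply: (inp_tr _ ix); rewrite mul1g mulVKg.
- by apply: (inp_tr _ ib); rewrite mul1g eb.
exists b2; split.
- exact: chainS hb st2.
- by rewrite eb2 eb -!mulgA mulVKg.
- by move: rq2; rewrite tr_tr mulg1 -mulgA mulVKg.
Qed.

End Paths.

(** * Uniqueness of transport *)

Section Isolation.
Implicit Types (p q : kF) (s t u v a b c e : seq L) (g h : F).

Lemma lam_measure s : M s -> lam s C -> ((tau - 2)%:E <= measure' R Rel (wd s))%E.
Proof.
move=> Ms l; apply/measure'_ge => r /is_concatenationE;
  rewrite letters_wd ?(M_reduced Ms) // => /l h.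
by apply/(measure_cutP sc_tau r).1.
Qed.

Definition inc u v : Prop :=
  [/\ M u /\ lam u C, M v /\ lam v C & exists2 q, Rel q & inp q u /\ inp q v].

Lemma incident_chainI n u v : M u -> lam u C -> chain inc n u v ->
  incident_chain Rel tau (wd u) (wd v).
Proof.
move=> Mu lu h.
suff [m [m1 mK h1 h2]] : exists m : nat -> F, [/\ m 1 = wd u, m n.+1 = wd v,
    forall i, (1 <= i <= n.+1)%N -> Mon Rel (m i) /\ ((tau - 2)%:E <= measure' R Rel (m i))%E
    & forall i, (1 <= i < n.+1)%N -> incident Rel (m i) (m i.+1)].
  by exists n.+1, m.
elim: h Mu lu => [x Mx lx|n' x y z _ IH st Mx lx].
  exists (fun=> wd x); split=> // i; last by lia.
  by move=> _; split; [case: Mx|apply: lam_measure].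
have [m [m1 mK h1 h2]] := IH Mx lx; case: st => _ [Mz lz] [q rq [iy iz]].
exists (fun i => if (i <= n'.+1)%N then m i else wd z); rewrite ltnn; split=> //.
  move=> i; case: ifP => [le|le] hi; first by apply: h1; lia.
  by split; [case: Mz|apply: lam_measure].
move=> i hi; have -> : (i <= n'.+1)%N by lia.
case: ifP => le; first by apply: h2; lia.
have -> : i = n'.+1 by lia.
by rewrite mK; exists q.
Qed.

Lemma max_occ_prefix b a : reduced (b ++ a) -> M b -> rtight b a ->
  maximal_occurrence Rel (wd (b ++ a)) 0 (wd b).
Proof.
move=> rd Mb rt; have rb := M_reduced Mb; split.
- by case: Mb.
- by exists [::], a; rewrite /= !letters_wd.
move=> j v Mv [s [t [sj e]]]; rewrite leqn0 => /eqP j0 le; split=> //.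
move: sj; rewrite j0 => /size0nil s0; subst s; rewrite letters_wd //= in e.
rewrite letters_wd // j0 !add0n in le.
have [m [ev ea]] := cat_eq e le.
have [m0|/eqP mn] := eqVneq m [::]; first by rewrite -(wdK v) ev m0 cats0.
exfalso; rewrite ea in rt; apply: (rtight_inside (r := [::]) mn rt); rewrite cats0 -ev.
by split; rewrite ?letters_reduced ?wdK.
Qed.

Lemma max_occ_suffix u b : reduced (u ++ b) -> M b -> ltight u b ->
  maximal_occurrence Rel (wd (u ++ b)) (size u) (wd b).
Proof.
move=> rd Mb lt; have rb := M_reduced Mb; split.
- by case: Mb.
- by exists u, [::]; rewrite cats0 !letters_wd.
move=> j v Mv [s [t [sj e]]] le1 le2.
rewrite !letters_wd // in e le2.
have lesz : (size s <= size u)%N by rewrite sj.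
have [m [eu ev]] := cat_eq (esym e) lesz.
have t0 : t = [::].
  apply: size0nil; have := congr1 size ev; have := congr1 size eu.
  by rewrite !size_cat; move: le2; rewrite -sj; move: (letters v) => v'; lia.
rewrite t0 cats0 in ev.
have [m0|/eqP mn] := eqVneq m [::].
  by rewrite eu m0 cats0 sj -(wdK v) ev m0.
exfalso; rewrite eu in lt; apply: (ltight_inside (r := [::]) mn lt); rewrite /= -ev.
by split; rewrite ?letters_reduced ?wdK.
Qed.

(** The right-sided axiom is applied with [m1 = u ++ c], [mK = u ++ d], [p1 = c] and [pK = d]. Both
    quotients then equal [u], which the axiom forbids unless [c = d]. *)
Lemma isolation_words n1 n2 u c d a r r' : a <> [::] ->
  M (u ++ c) -> M (u ++ d) -> lam (u ++ c) C -> chain inc n1 (u ++ c) (u ++ d) ->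
  M (c ++ a ++ r) -> M (d ++ a ++ r') -> lam a C -> Sp r -> Sp r' ->
  chain inc n2 (c ++ a ++ r) (d ++ a ++ r') ->
  reduced (u ++ c ++ a) -> reduced (u ++ d ++ a) -> rtight (u ++ c) a -> rtight (u ++ d) a ->
  ltight u (c ++ a) -> ltight u (d ++ a) -> c = d.
Proof.
move=> an Mc Md lc ch1 Mca Mda la Sr Sr' ch2 rc rd rt1 rt2 lt1 lt2.
have [//|/eqP ncd] := eqVneq c d; exfalso.
have Ma : M a := M_mid Mca.
have Mca' : M (c ++ a) by rewrite catA in Mca; apply: M_catl Mca.
have Mda' : M (d ++ a) by rewrite catA in Mda; apply: M_catl Mda.
have rcc : reduced c := M_reduced (M_catl Mca').
have rdd : reduced d := M_reduced (M_catl Mda').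
have nM w1 : rtight w1 a -> reduced (w1 ++ a) -> ~ Mon Rel (wd (w1 ++ a)).
  move=> rt rw Mw; have := @rtight_inside w1 a [::] [::] an.
  by rewrite cats0 => /(_ rt); apply; split.
have rca : reduced ((u ++ c) ++ a) by rewrite -catA.
have rda : reduced ((u ++ d) ++ a) by rewrite -catA.
have := @sc_isolation (wd (u ++ c)) (wd (u ++ d)) (wd a) (wd c) (wd d).
have rr : reduced r by case: Sr.
have rr' : reduced r' by case: Sr'.
have ra := M_reduced Ma.
have Mar : M (a ++ r) := M_catr Mca.
have Mar' : M (a ++ r') := M_catr Mda.
have sz v w0 : reduced (v ++ w0) -> reduced w0 -> (size (letters (wd (v ++ w0))) - size (letters
  (wd w0)))%N = size v.
  by move=> r1 r2; rewrite !letters_wd // size_cat addnK.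
rewrite -!wd_cat -!catA !sz ?(M_reduced Mc) ?(M_reduced Md) //; apply.
- by move=> /(wd_inj (M_reduced Mc) (M_reduced Md)) /eqP; rewrite eqseq_cat // eqxx => /eqP.
- exact: incident_chainI ch1.
- by case: Ma.
- exact: lam_measure.
- by rewrite /no_cancel /= cats0 !letters_wd ?(M_reduced Mc).
- by rewrite /no_cancel /= cats0 !letters_wd ?(M_reduced Md).
- by rewrite catA; apply: nM.
- by rewrite catA; apply: nM.
- by rewrite catA; apply: max_occ_prefix.
- by rewrite catA; apply: max_occ_prefix.
- by rewrite !letters_wd ?(M_reduced Mc) // suffix_suffix.
- by apply: max_occ_suffix.
- by rewrite !letters_wd ?(M_reduced Md) // suffix_suffix.
- by apply: max_occ_suffix.
- exists (wd r), (wd r'); split.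
  + by split; [case: Sr|case: Sr'].
  + by rewrite -wd_cat /no_cancel /= cats0 !letters_wd //; case: Mar.
  + by rewrite -wd_cat /no_cancel /= cats0 !letters_wd //; case: Mar'.
  + rewrite -!wd_cat -!catA.
    have lca : lam (c ++ a ++ r) C by apply: lam_sub.
    exact: incident_chainI ch2.
- by rewrite !wd_cat !mulgK.
Qed.

Lemma C14 : (14 <= C)%N.
Proof. exact: measure_cut14 sc_tau. Qed.

(* Closed under [steps], so that being large does not depend on the shape of the
   neighbouring occurrences. *)
Definition thn s (x : seq L * seq L) : Prop :=
  tight s x.1 x.2 /\ exists n y, steps N N s n x y /\ lam y.1 (C + 12).

Lemma thn_steps s n x y : thn s x -> steps N N s n x y -> thn s y.
Proof.
move=> [tx [n' [z [h lz]]]] hy; split; first exact: steps_tight hy tx.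
by exists (n + n')%N, z; split=> //; apply: chain_trans h; apply: steps_sym.
Qed.

Lemma thn_lam s x : thn s x -> lam x.1 (C + 11).
Proof.
move=> [tx [n [y [h ly]]]]; have ty := steps_tight h tx.
have C1 := C14; apply: (steps_lam (x := y) (y := x) (m := C) _ ty _ (steps_sym h)); first by lia.
by rewrite -addnS.
Qed.

Definition link s t b b' : Prop :=
  exists q, [/\ Rel q, inp q b /\ inp q b', thn s (b, t) & thn s (b', t)].

Lemma link_sym s t b b' : link s t b b' -> link s t b' b.
Proof. by move=> [q [? [? ?] ? ?]]; exists q. Qed.

(** Reorders the history of the right neighbour: the replacements of the neighbour itself come first
    and become a chain of incident monomials in the original surroundings [T], the moves further
    right come last. An adjacent step is pulled back through those moves by [steps_transport]. *)
Lemma turn_chain s n x y u c a T : tight s x.1 x.2 -> adj C s x u c a T -> steps N N s n x y ->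
  exists c' a' T' Z n1 n2, [/\ adj C.-1 s y u c' a' T', chain inc n1 (c ++ a) Z,
    steps C C (s ++ u) n2 (Z, T) (c' ++ a', T'), tight (s ++ u) Z T /\ lam Z C &
    c' = c \/ exists a0 T0 n0, [/\ tight (s ++ u) (c' ++ a0) T0,
      steps C C (s ++ u) n0 (c' ++ a0, T0) (c' ++ a', T') & lam a0 N]].
Proof.
have C1 := C14; have eC : C = C.-1.+1 by lia.
move=> tx + h; elim: h tx => [x0|n' x0 y0 z0 h IH st] tx ax.
  exists c, a, T, (c ++ a), 0, 0; split; first by apply: adj_mono ax; lia.
  - exact: chain0.
  - exact: chain0.
  - by case: ax.
  - by left.
have ty0 := steps_tight h tx.
have [c' [a' [T' [Z [n1 [n2 [ay ch sZ [tZ lZ] H]]]]]]] := IH tx ax.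
case: st h IH ay ty0 => [y1 z1 f|u1 c1 c2 a1 a2 t p un t1 t2 t3 t4 rp i1 i2 l1 l2 l3 l4] h _ ay ty0.
  have [|a2 [T2 [ez tz st2]]] := fstep_adj (adj_mono _ ay) f; first by lia.
  have st3 : step C C (s ++ u) (c' ++ a', T') (c' ++ a2, T2) by apply: step_mono st2.
  have sZ2 := chainS sZ st3.
  exists c', a2, T2, Z, n1, n2.+1; split=> //.
    case: ay => un _ _ _; split=> //.
    move: sZ2 lZ; rewrite eC => sZ2 lZ.
    by apply: (steps_lam (x := (Z, T)) (y := (c' ++ a2, T2)) (m := C.-1) _ tZ lZ sZ2); lia.
  case: H => [->|[a0 [T0 [n0 [t0 h0 l0]]]]]; [by left|right].
  by exists a0, T0, n0.+1; split=> //; apply: chainS h0 st3.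
have ay1 : adj N s (u1 ++ c1, a1 ++ t) u1 c1 a1 t by split.
have [||eu ec ea et] := adj_uniq (tight_M ty0) (adj_mono _ ay) (adj_mono _ ay1); [by lia..|].
subst u1 c1 a1 t.
have [||||Z2 [hZ eZ rq]] := @steps_transport C.-1 (s ++ u) n2 (c' ++ a', T') (Z,
  T) p (c2 ++ a2) _ _ t3 rp i1 i2 t4.
- by lia.
- by rewrite -eC; apply: steps_sym.
- by apply: lam_le l2; lia.
- by apply: lam_le l1; lia.
rewrite -eC in hZ; have tZ2 := steps_tight hZ t4.
have lZ2 : lam Z2 C.
  apply: (steps_lam (x := (c2 ++ a2, T')) (y := (Z2, T)) (m := C.-1) _ t4 l2); first by lia.
  by rewrite -eC; exact: hZ.
exists c2, a2, T', Z2, n1.+1, n2; split.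
- by split=> //; apply: lam_le l2; lia.
- apply: chainS ch _; split; [by split; [exact: tight_M tZ|]|by split; [exact: tight_M tZ2|]|].
  exists (tr 1%g p ((wd (c' ++ a'))^-1 * wd Z)%g) => //.
  split; first by apply: (inp_tr _ i1); rewrite mul1g mulVKg.
  by apply: (inp_tr _ i2); rewrite mul1g eZ.
- exact: steps_sym.
- by split.
- by right; exists a2, T', 0; split=> //; apply: chain0.
Qed.

Lemma cov_prefix c d o e : cov c 1 -> lam o 2 -> c ++ d = o ++ e ->
  exists m, [/\ m <> [::], o = c ++ m & d = m ++ e].
Proof.
move=> cc lk e0; case: (cat_eqP e0) => [[m [ek ed]]|[m [mn ec _]]].
  exists m; split=> // m0; rewrite ek m0 cats0 in lk; exact: (@cov_lam c 1 2 cc isT lk).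
by case: (@cov_lam o 1 2 _ isT lk); apply: (@cov_catl _ m); rewrite -ec.
Qed.

Lemma ltight_prefix s b e : M (b ++ e) -> lam b 2 -> ltight s (b ++ e) -> ltight s b.
Proof. by move=> Mb lb lt s' y es My; apply: (lt s' y es); apply: M_left. Qed.

(** The links give a chain of incident monomials from [b] to [b'], and the steps give one for the
    right neighbour. If the overlaps [c] and [c'] differed, the two chains would form the
    configuration excluded by isolation, the neighbour providing the word [a] of the axiom. *)
Lemma linked_steps_uniq s t n1 n2 b b' : chain (link s t) n1 b b' -> thn s (b, t) ->
  steps N N s n2 (b, t) (b', t) -> b = b'.
Proof.
have C1 := C14; have eC : C = C.-1.+1 by lia.
move=> ch tb h; have tb' := thn_steps tb h.
have ch1 : chain inc n1 b b'.
  apply: chain_mono ch => u v [q [rq [iu iv] tu tv]].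
  split; [split; first exact: tight_M (proj1 tu)|split;
    first exact: tight_M (proj1 tv)|by exists q].
    by apply: lam_le (thn_lam tu); lia.
  by apply: lam_le (thn_lam tv); lia.
have [|f|] := steps_core (m := C) _ (proj1 tb) h; [by lia|exact: (fsteps_tightl f)|].
move=> [u [c [a [T [c' [a' [T' [ax ay]]]]]]]].
have [c1 [a1 [T1 [Z [k1 [k2 [ay1 chZ sZ [tZ lZ] H]]]]]]] := turn_chain (proj1 tb) ax h.
have [||_ ? ? ?] := adj_uniq (tight_M (proj1 tb')) (adj_mono _ ay) (adj_mono _ ay1); [by lia..|].
subst c1 a1 T1.
have cc := adj_cov (tight_M (proj1 tb)) ax.
have cc' := adj_cov (tight_M (proj1 tb')) ay.
have Mb := tight_M (proj1 tb); have Mb' := tight_M (proj1 tb').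
case: ax => un [eb et] ta la; case: (ay) => _ [eb' et'] ta' la'.
rewrite /= in Mb Mb'.
(* The right context [t] is the same at both ends of the path, so the neighbour ends at the same
   place. *)
have [eaa eTT] : a = a' /\ T = T'.
  have key x y m Tx Ty : tight (s ++ u) (x ++ y ++ m) Tx -> M (y ++ m) -> lam y 2 ->
      forall z, tight (s ++ u) (z ++ y) Ty -> Ty = m ++ Tx -> m = [::].
    move=> tx My ly z [_ Mz _ rt] eT; have [//|/eqP mn] := eqVneq m [::]; exfalso.
    by rewrite eT in rt; apply: (rtight_inside (r := [::]) mn rt); rewrite cats0 -catA;
      apply: M_glue.
  have e : a ++ T = a' ++ T' by rewrite -et.
  case: (cat_eqP e) => [[m [ea eT]]|[m [mn ea eT]]].
    have m0 : m = [::].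
      apply: (key c' a m T' T _ _ _ c ta eT); first by rewrite -ea.
        by rewrite -ea; apply: M_catr (tight_M ta').
      by apply: (lam_cutl (m := 1) cc); apply: lam_le la; lia.
    by rewrite m0 cats0 /= in ea eT.
  case: mn; apply: (key c a' m T T' _ _ _ c' ta' eT); first by rewrite -ea.
    by rewrite -ea; apply: M_catr (tight_M ta).
  by apply: (lam_cutl (m := 1) cc'); apply: lam_le la'; lia.
subst a' T'.
case: H => [ec|[a0 [T0 [n0 [ta0 h0 l0]]]]]; first by rewrite eb eb' ec.
suff : c = c' by move=> ec; rewrite eb eb' ec.
have red0 d : tight s (u ++ d) (a ++ T) -> reduced (u ++ d ++ a).
  by move=> /tight_red /reduced_catr; rewrite -!catA catA => r; move: r;
    rewrite catA => /reduced_catl; rewrite catA.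
have tb0 : tight s (u ++ c) (a ++ T) by rewrite -eb -et; exact: proj1 tb.
have tb0' : tight s (u ++ c') (a ++ T) by rewrite -eb' -et'; exact: proj1 tb'.
rewrite eb eb' in ch1.
have lb : lam (u ++ c) C by rewrite -eb; apply: lam_le (thn_lam tb) => /=; lia.
have ltu d : ltight (s ++ u) d -> ltight u d by move/(ltight_change (s' := [::]) un).
(* Isolation is applied with the common part [m] of [a] and [Z]; [e'] and [r] are the small pieces
   cut off at the right end. *)
have fin m e' r : m <> [::] -> a = m ++ e' -> lam m C -> cov e' 1 -> cov r 1 ->
  Z = c' ++ m ++ r -> c = c'.
  move=> mn ea lm ce cr eZ.
  have rt d : tight s (u ++ d) (a ++ T) -> rtight (u ++ d) m.
    move=> [_ _ _ rt0]; rewrite -(cats0 m); apply: (rtight_change (t := e' ++ T)) => //.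
    by rewrite catA -ea.
  have lt d : tight (s ++ u) (d ++ a) T -> ltight u (d ++ m).
    move=> [_ Md lt0 _]; apply: (@ltight_prefix _ _ e'); rewrite -?catA -?ea //; last exact: ltu.
    by apply: lam_catr; apply: lam_le lm; lia.
  have rd d : tight s (u ++ d) (a ++ T) -> reduced (u ++ d ++ m).
    by move=> /red0; rewrite ea !catA => /reduced_catl.
  apply: (isolation_words mn _ _ _ ch1 _ _ lm (cov1_Sp ce) (cov1_Sp cr));
    [..|exact: rt|exact: rt|exact: lt|exact: lt] => //.
  - by rewrite -eb.
  - by rewrite -eb'.
  - by rewrite -ea; exact: tight_M ta.
  - by rewrite -eZ; exact: tight_M tZ.
  - rewrite -ea -eZ; exact: chZ.
  - exact: rd.
  - exact: rd.
have an : a <> [::].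
  by apply: (@lam_nil _ 0); apply: (lam_cutl (m := 1) cc); apply: lam_le la; lia.
move: sZ h0; rewrite eC => sZ h0.
have core0 := steps_core (m := C.-1) (x := (c' ++ a0, T0)) _ ta0 h0.
have coreZ := steps_core (m := C.-1) (x := (Z, T)) _ tZ sZ.
case: core0 => [|/fsteps_tightl /= e0|[o [f [v [V [f' [v' [V' [ak ak']]]]]]]]]; first by lia.
- have ea : a0 = a by move/eqP: e0; rewrite eqseq_cat // eqxx => /eqP.
  subst a0.
  case: coreZ => [|/fsteps_tightl /= eZ|[o [f [v [V [f' [v' [V' [ak ak']]]]]]]]]; first by lia.
    by apply: (fin a [::] [::]); rewrite ?cats0 //; [exact: lam_le l0|exact: cov0|exact: cov0].
  have cf := adj_cov (x := (Z, T)) (tight_M tZ) ak; have cf' := adj_cov (x := (c' ++ a,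
    T)) (tight_M ta') ak'.
  case: (ak') (ak) => kn [e1 _] _ _ [_ [e2 _] _ _].
  have lk : lam o 2.
    by apply: (lam_cutr (m := 1) cf'); rewrite -e1; apply: lam_le la'; lia.
  have [m [mn ek em]] := cov_prefix cc' lk e1.
  apply: (fin m f' f) => //; last by rewrite e2 ek -catA.
  by apply: (lam_cutr (m := 1) cf'); rewrite -em addn1.
- have cf := adj_cov (x := (c' ++ a0, T0)) (tight_M ta0) ak;
  have cf' := adj_cov (x := (c' ++ a, T)) (tight_M ta') ak'.
  case: (ak') (ak) => kn [e1 _] _ _ [_ [e2 _] _ _].
  have lk : lam o 2.
    by apply: (lam_cutr (m := 1) cf'); rewrite -e1; apply: lam_le la'; lia.
  have [m [mn ek em]] := cov_prefix cc' lk e1.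
  have em0 : a0 = m ++ f.
    by move: e2; rewrite ek -catA => /eqP; rewrite eqseq_cat // eqxx => /eqP.
  have lm : lam m C by apply: (lam_cutr (m := 1) cf); rewrite -em0 addn1.
  case: coreZ => [|/fsteps_tightl /= eZ|[o' [g [w1 [W [g' [w' [W' [bk bk']]]]]]]]]; first by lia.
    apply: (fin a [::] [::]); rewrite ?cats0 //; [|exact: cov0|exact: cov0].
    by rewrite em; apply: lam_catl.
  have [||ek' eg _ _] := adj_uniq (x := (c' ++ a, T)) (tight_M ta') (adj_mono _ ak') (adj_mono _
    bk'); [by lia..|].
  subst o' g'; have cg := adj_cov (x := (Z, T)) (tight_M tZ) bk.
  case: bk => _ [e3 _] _ _.
  by apply: (fin m f' g) => //; rewrite e3 ek -catA.
Qed.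

End Isolation.

(** * Reducible occurrences *)

Section Classes.
Local Open Scope ring_scope.
Local Open Scope classical_set_scope.
Implicit Types (p q : kF) (s t a b c e : seq L) (g h : F).

Lemma span_tr (P Q : set kF) g h : (forall q, P q -> Q (tr g q h)) ->
  forall f, linear_span P f -> linear_span Q (tr g f h).
Proof.
move=> PQ; apply: span_min => [|q /PQ /span_gen //].
split=> [|c u v hu hv]; first by rewrite tr0; case: (span_subspace Q).
by rewrite trD trZ; apply: (span_subspace Q).2.
Qed.

Lemma span_supp (P : set kF) f u : linear_span P f -> u \in gsupp f ->
  exists2 q, P q & u \in gsupp q.
Proof.
pose U := [set f : kF | u \in gsupp f -> exists2 q, P q & u \in gsupp q].
move=> sf; apply: (span_min (U := U) _ _ sf) => [|q Pq uq]; last by exists q.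
split=> [|c f1 f2 h1 h2]; rewrite /U /= gsuppE ?mcoeff0 ?eqxx // mcoeffD mcoeffZ => n0.
have [z1|n1] := eqVneq f1@_u 0; last by apply: h1; rewrite gsuppE.
by apply: h2; rewrite gsuppE; rewrite z1 mulr0 add0r in n0.
Qed.

(* The monomials in [A] but not in [Y] are the leading terms of a reduced basis
   of the span of [P]. *)
Definition good (P : set kF) (A Y : set F) : Prop :=
  (forall u, A u -> ~ Y u -> exists f : kF, [/\ linear_span P f, f@_u = 1 &
     forall v, A v -> ~ Y v -> v <> u -> f@_v = 0]) /\
  (forall f : kF, linear_span P f -> (forall v, A v -> ~ Y v -> f@_v = 0) -> f = 0).

Lemma chain_finite (FF : set (set F)) (Q : F -> Prop) (r : seq F) : total_on FF subset ->
  (forall v, v \in r -> Q v -> exists2 Y, FF Y & Y v) ->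
  (forall v, v \in r -> ~ Q v) \/ exists2 Y, FF Y & forall v, v \in r -> Q v -> Y v.
Proof.
move=> tF; elim: r => [|v r IH] hr; first by left.
have [v1 v1r|none|[Y FY hY]] := IH; first by apply: hr; rewrite inE v1r orbT.
  have [/(hr v (mem_head _ _)) [Y FY Yv]|nQ] := EM (Q v).
    right; exists Y => // v1; rewrite inE => /orP [/eqP -> //|/none //].
  by left=> v1; rewrite inE => /orP [/eqP -> //|/none //].
right; have [/(hr v (mem_head _ _)) [Z FZ Zv]|nQ] := EM (Q v); last first.
  by exists Y => // v1; rewrite inE => /orP [/eqP -> //|/hY //].
case: (tF _ _ FY FZ) => sub; [exists Z|exists Y] => // v1; rewrite inE.
  by move=> /orP [/eqP -> //|v1r /(hY _ v1r) /sub].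
by move=> /orP [/eqP -> _|/hY //]; apply: sub.
Qed.

(** [Y] is maximal such that an element of the span is determined by its coefficients on [A] outside
    [Y]. Supports are finite, so this property passes to unions of chains and Zorn's lemma applies;
    maximality yields the basis element for each remaining [u]. *)
Lemma good_ex (P : set kF) (A : set F) :
  (forall f : kF, linear_span P f -> (forall v, A v -> f@_v = 0) -> f = 0) ->
  exists Y, good P A Y.
Proof.
move=> hP.
pose B (Y : set F) := forall f : kF, linear_span P f -> (forall v, A v -> ~ Y v -> f@_v = 0) ->
  f = 0.
have [|Y [BY maxY]] := @Zorn_bigcup F B; last first.
  exists Y; split=> // u Au nYu.
  have [|/existsNP [f /not_implyP [sf /not_implyP [fv fn]]]] := EM (B (Y `|` [set u])).
    move=> h; case: (maxY _ _ h); split; first exact: subsetUl.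
    by move=> /(_ u) hh; apply: nYu; apply: hh; right.
  have fu : f@_u != 0.
    apply/eqP => f0; apply: fn; apply: BY => // v Av nYv.
    by have [->//|nvu] := EM (v = u); apply: fv => // -[].
  exists ((f@_u)^-1 *: f); split; first exact: spanZ.
    by rewrite mcoeffZ mulVf.
  by move=> v Av nYv nvu; rewrite mcoeffZ (fv v Av) ?mulr0 // => -[].
move=> FF sF tF f sf fv.
have [v vf Av|none|[Y FY hY]] := @chain_finite FF A (enum_fset (gsupp f)) tF.
- apply: contrapT => nY; have : v \in gsupp f by [].
  by rewrite gsuppE fv ?eqxx // => -[Y FY Yv]; apply: nY; exists Y.
- apply: hP => // v Av; apply/eqP; rewrite -[_ == _]negbK -gsuppE; apply/negP => /none; exact.
- apply: (sF _ FY) => // v Av nYv; apply/eqP; rewrite -[_ == _]negbK -gsuppE.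
  by apply/negP => /hY /(_ Av).
Qed.

Implicit Types (x y : seq L * seq L).

Definition linked s x b : Prop := exists n, chain (link s x.2) n x.1 b.

Definition cls s x : set F := [set u | linked s x (letters u)].

Definition meets s x : set kF := [set q | Rel q /\ exists2 b, linked s x b & inp q b].

Lemma linked_thn s x b : thn s x -> linked s x b -> thn s (b, x.2).
Proof.
case: x => b0 t tx [n /= h]; case: h tx => [b1 tb1|n1 b1 b2 b3 _ [q [_ _ _ tz]] _];
  [exact: tb1|exact: tz].
Qed.

Lemma linked_sym s t b b' : linked s (b, t) b' -> linked s (b', t) b.
Proof. by move=> [n h]; exists n; apply: chain_sym h; apply: link_sym. Qed.

Lemma linked_trans s t b b' b'' : linked s (b, t) b' -> linked s (b', t) b'' -> linked s (b, t) b''.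
Proof. by move=> [n h] [n' h']; exists (n + n')%N; apply: chain_trans h'. Qed.

Lemma linked_link s x b b' : linked s x b -> link s x.2 b b' -> linked s x b'.
Proof. by move=> [n h] l; exists n.+1; apply: chainS h l. Qed.

Lemma thn_reduced s x : thn s x -> reduced x.1.
Proof. by move=> [/tight_M /M_reduced]. Qed.

Lemma linked_cls s x b : thn s x -> linked s x b -> cls s x (wd b).
Proof. by move=> tx l; rewrite /cls /= letters_wd //; exact: (thn_reduced (linked_thn tx l)). Qed.

Lemma thn_link s x q b c : thn s x -> linked s x b -> Rel q -> inp q b -> inp q c ->
  thn s (c, x.2) -> linked s x c.
Proof.
move=> tx lb rq ib ic tc; apply: (linked_link lb); exists q; split=> //.
exact: linked_thn lb.
Qed.

Lemma thn_theta s t q b c : thn s (b, t) -> Rel q -> inp q b -> inp q c -> reduced c ->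
  lam c (C + 12) -> thn s (c, t).
Proof.
move=> tb rq ib ic rc lc; split; last by exists 0, (c, t); split=> //; apply: chain0.
have lb := thn_lam tb; rewrite /= in lb *; case: tb => tb _.
have lb2 : lam b 2 by apply: lam_le lb; lia.
have lc2 : lam c 2 by apply: lam_le lc; lia.
exact: (tight_move tb lb2 rq ib ic rc lc2).
Qed.

Lemma lam_theta u : ((tau + 10)%:E <= measure' R Rel u)%E -> lam (letters u) (C + 12).
Proof.
move=> h r cr; apply/(measure_cutP sc_tau r).2.
by move/measure'_ge: h; apply; apply/is_concatenationE.
Qed.

(** Strong small cancellation provides a monomial of measure at least [tau + 10]. Such a monomial is
    large at this place and occurs in a relation that meets the class, hence it is linked to [x]. *)
Lemma meets_top s x f : thn s x -> linear_span (meets s x) f ->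
  (forall v, cls s x v -> f@_v = 0) -> f = 0.
Proof.
move=> tx sf fv; apply: contrapT => fn.
have sf' : linear_span Rel f by apply: (span_min (span_subspace _)) sf => q [/span_gen].
have [a af la] := sc_strong sf' fn.
have [q [rq [b lb ib]] aq] := span_supp sf af.
have iq : inp q (letters a) by rewrite /inp wdK.
have la' := lam_theta la.
have tha := thn_theta (linked_thn tx lb) rq ib iq (letters_reduced a) la'.
move: af; rewrite gsuppE fv ?eqxx //.
exact: thn_link lb rq ib iq tha.
Qed.

Lemma good_cls s x : thn s x -> exists Y, good (meets s x) (cls s x) Y.
Proof. by move=> tx; apply: good_ex => f; apply: meets_top. Qed.

(* Transport of a class of linked occurrences along steps, by right multiplication. *)
Definition tp s x y g : Prop := forall b, linked s x b ->
  [/\ exists n, steps N N s n (b, x.2) (letters (wd b * g)%g, y.2),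
      linked s y (letters (wd b * g)%g) & forall q, Rel q -> inp q b -> Rel (tr 1%g q g)].

Lemma tp_refl s x : thn s x -> tp s x x 1%g.
Proof.
move=> tx b lb; rewrite mulg1 letters_wd; last exact: thn_reduced (linked_thn tx lb).
by split=> //; [exists 0; apply: chain0|move=> q rq _; rewrite tr11].
Qed.

Lemma tp_trans s x y z g h : tp s x y g -> tp s y z h -> tp s x z (g * h)%g.
Proof.
move=> txy tyz b lb; have [[n st] ly rq1] := txy _ lb.
have [[n' st'] lz rq2] := tyz _ ly; rewrite wdK -mulgA in st' lz.
split=> //; first by exists (n + n')%N; apply: chain_trans st'.
move=> q rq ib; have := rq2 _ (rq1 _ rq ib); rewrite tr_tr mulg1; apply.
by apply: (inp_tr _ ib); rewrite mul1g wdK.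
Qed.

Lemma tp_link s b t b' : thn s (b, t) -> link s t b b' -> tp s (b, t) (b', t) 1%g.
Proof.
move=> tb l c lc; have [st lcb h] := tp_refl tb lc; split=> //.
rewrite /= in lcb; apply: linked_trans lcb; apply: linked_sym.
by exists 1; apply: chain1.
Qed.

(** One factor serves the whole class: by induction along the links, [step_transport] passes the
    step from each monomial to the next. *)
Lemma tp_step s x y : thn s x -> step N N s x y -> tp s x y ((wd x.1)^-1 * wd y.1)%g.
Proof.
have C1 := C14; move=> tx st b [n h].
set g := ((wd x.1)^-1 * wd y.1)%g.
have key b0 b1 q : thn s (b0, x.2) -> step N N s (b0, x.2) (b1, y.2) ->
    wd b1 = (wd b0 * g)%g -> Rel q -> inp q b0 -> forall c, inp q c -> thn s (c, x.2) ->
    exists c1, [/\ step N N s (c, x.2) (c1, y.2), wd c1 = (wd c * g)%g & Rel (tr 1%g q g)].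
  move=> t0 st0 e1 rq i0 c ic tc.
  have l0 : lam b0 4 by apply: lam_le (thn_lam t0); lia.
  have lc : lam c 4 by apply: lam_le (thn_lam tc); lia.
  have N3 : (3 <= N)%N by lia.
  have [c1 [st1 ec rq1]] := step_transport N3 (leqnn _) st0 rq i0 ic (proj1 tc) lc l0.
  by rewrite /= e1 mulKg in ec rq1; exists c1.
have [b1 [st1 eb1 lb1 tb]] : exists b1, [/\ step N N s (b, x.2) (b1, y.2), wd b1 = (wd b * g)%g,
    linked s y b1 & thn s (b, x.2)].
  move: {2 3}x.1 (erefl x.1) h => b0 e0 h; elim: h e0 => [c ec|n' c d e h IH [q [rq [iq iq'] t1
    t2]] ec].
    exists y.1; rewrite -ec -!surjective_pairing; split=> //; first by rewrite /g mulVKg.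
    by exists 0; apply: chain0.
  have [b1 [st1 eb1 lb1 tb]] := IH ec.
  have [c1 [st2 ec1 rq1]] := key _ _ _ t1 st1 eb1 rq iq _ iq' t2.
  exists c1; split=> //; apply: linked_link lb1 _; exists (tr 1%g q g); split=> //.
  - split; first by apply: (inp_tr _ iq); rewrite mul1g eb1.
    by apply: (inp_tr _ iq'); rewrite mul1g ec1.
  - by apply: (thn_steps t1); apply: chain1 st1.
  - by apply: (thn_steps t2); apply: chain1 st2.
have eb : letters (wd b * g)%g = b1.
  by rewrite -eb1 letters_wd //; case: (step_tight st1) => _ /tight_M /M_reduced.
rewrite eb; split=> //; first by exists 1; apply: chain1.
by move=> q rq ib; have [c1 []] := key _ _ _ tb st1 eb1 rq ib _ ib tb.
Qed.

Inductive cstep s : seq L * seq L -> seq L * seq L -> Prop :=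
| cstep_link b t b' : link s t b b' -> cstep s (b, t) (b', t)
| cstep_step x y : thn s x -> step N N s x y -> cstep s x y.

Lemma cstep_sym s x y : cstep s x y -> cstep s y x.
Proof.
case=> [b t b' /link_sym l|{}x {}y tx st]; first exact: cstep_link.
apply: cstep_step; last exact: step_sym.
by apply: (thn_steps tx); apply: chain1 st.
Qed.

Lemma cstep_thn s x y : cstep s x y -> thn s x /\ thn s y.
Proof.
case=> [b t b' [q [_ _ ? ?]] //|{}x {}y tx st]; split=> //.
by apply: (thn_steps tx); apply: chain1 st.
Qed.

Definition conn s x y : Prop := exists n, chain (cstep s) n x y.

Lemma conn_sym s x y : conn s x y -> conn s y x.
Proof. by move=> [n h]; exists n; apply: chain_sym h; apply: cstep_sym. Qed.

Lemma conn_trans s x y z : conn s x y -> conn s y z -> conn s x z.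
Proof. by move=> [n h] [n' h']; exists (n + n')%N; apply: chain_trans h'. Qed.

Lemma conn_thn s x y : conn s x y -> thn s x -> thn s y.
Proof. by move=> [n h]; case: h => // ? ? ? ? _ /cstep_thn []. Qed.

Lemma cstep_tp s x y : cstep s x y -> exists g, tp s x y g /\ tp s y x g^-1%g.
Proof.
move=> cs; have [tx ty] := cstep_thn cs.
case: cs tx ty => [b t b' l|{}x {}y _ st] tx ty.
  by exists 1%g; rewrite invg1; split; apply: tp_link => //; apply: link_sym.
exists ((wd x.1)^-1 * wd y.1)%g; split; first exact: tp_step.
by rewrite invgM invgK; apply: tp_step => //; apply: step_sym.
Qed.

Lemma conn_tp s x y : thn s x -> conn s x y -> exists g, tp s x y g /\ tp s y x g^-1%g.
Proof.
move=> + [n h]; elim: h => [z tz|n' z y1 z1 h IH cs tz].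
  by exists 1%g; rewrite invg1; split; apply: tp_refl.
have [g [t1 t2]] := IH tz; have [h' [t3 t4]] := cstep_tp cs.
by exists (g * h')%g; rewrite invgM; split; apply: tp_trans; eassumption.
Qed.

Lemma steps_conn s n x y : thn s x -> steps N N s n x y -> conn s x y.
Proof.
move=> tx h; exists n; elim: h tx => [z tz|n' z y1 z1 h IH st tz]; first exact: chain0.
by apply: chainS (IH tz) _; apply: cstep_step st; apply: thn_steps h.
Qed.

Lemma linked_conn s b t b' : linked s (b, t) b' -> conn s (b, t) (b', t).
Proof.
move=> [n /= h]; exists n; elim: h => [c|n' c d e h IH l]; first exact: chain0.
by apply: chainS IH _; apply: cstep_link.
Qed.

Definition rep s x : seq L * seq L := xget ([::], [::]) [set y | conn s x y].

Lemma rep_conn s x : conn s x (rep s x).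
Proof.
apply: (@xgetPex _ ([::], [::]) [set y | conn s x y]).
by exists x; exists 0; apply: chain0.
Qed.

Lemma rep_eq s x y : conn s x y -> rep s x = rep s y.
Proof.
move=> cxy; rewrite /rep; congr xget; apply/seteqP; split=> z /= h.
  exact: conn_trans (conn_sym cxy) h.
exact: conn_trans cxy h.
Qed.

(* The monomials that are not to be reduced are chosen in one representative of
   every class of [conn s] and transported to the others; [linked_steps_uniq]
   makes the result independent of the path. *)
Definition good0 s x : set F :=
  if pselect (exists Y, good (meets s x) (cls s x) Y) is left ex then projT1 (cid ex) else set0.

Lemma good0P s x : thn s x -> good (meets s x) (cls s x) (good0 s x).
Proof.
move=> /good_cls h; rewrite /good0; case: pselect => // ex; exact: (projT2 (cid ex)).
Qed.

Definition irr s x : Prop := exists (y : seq L) n,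
  [/\ good0 s (rep s x) (wd y), linked s (rep s x) y & steps N N s n x (y, (rep s x).2)].

Lemma irr_steps s n x y : thn s x -> steps N N s n x y -> irr s x -> irr s y.
Proof.
move=> tx h [z [n' [gz lz hz]]]; rewrite /irr -(rep_eq (steps_conn tx h)).
by exists z, (n + n')%N; split=> //; apply: chain_trans hz; apply: steps_sym.
Qed.

Definition irrs s x : set F := [set u | irr s (letters u, x.2)].

(** Transport to the representative is a right multiplication that carries span and class along;
    uniqueness of transport shows that it carries [irrs] onto the chosen set. *)
Lemma irr_good s x : thn s x -> good (meets s x) (cls s x) (irrs s x).
Proof.
move=> tx; have cr := rep_conn s x; set r := rep s x in cr.
have tr0 := conn_thn cr tx; have [hg1 hg2] := good0P tr0.
have [g [t1 t2]] := conn_tp tx cr.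
have iY u : cls s x u -> irrs s x u <-> good0 s r (u * g)%g.
  move=> lu; have er : rep s (letters u, x.2) = r.
    by apply/esym/rep_eq; have := linked_conn (t := x.2) (b := x.1); rewrite -surjective_pairing;
      apply.
  have [[n1 h1] l1 _] := t1 _ lu; rewrite wdK in h1 l1.
  rewrite /irrs /= /irr er; split=> [[y [n [gy ly hy]]]|gu]; last first.
    by exists (letters (u * g)%g), n1; rewrite wdK; split.
  have tug := linked_thn tr0 l1.
  have lyg : linked s (letters (u * g)%g, r.2) y.
    have l1' : linked s (r.1, r.2) (letters (u * g)%g) := l1.
    exact: linked_trans (linked_sym l1') ly.
  have [o hk] := lyg.
  have := linked_steps_uniq hk tug (chain_trans (steps_sym h1) hy) => ey.
  have ey' : letters (u * g)%g = y := ey; by rewrite -(wdK (u * g)%g) ey'.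
have mx q : meets s x q -> meets s r (tr 1%g q g).
  move=> [rq [b lb ib]]; have [_ lr hq] := t1 _ lb; split; first exact: hq.
  by exists (letters (wd b * g)%g) => //; apply: (inp_tr _ ib); rewrite mul1g wdK.
have mr q : meets s r q -> meets s x (tr 1%g q g^-1%g).
  move=> [rq [b lb ib]]; have [_ lr hq] := t2 _ lb; split; first exact: hq.
  by exists (letters (wd b * g^-1)%g) => //; apply: (inp_tr _ ib); rewrite mul1g wdK.
have c1 u : cls s x u -> cls s r (u * g)%g by move=> lu; have [_ ] := t1 _ lu; rewrite wdK.
have c2 u : cls s r u -> cls s x (u * g^-1)%g by move=> lu; have [_ ] := t2 _ lu; rewrite wdK.
split=> [u cu nYu|f sf fv].
  have [|f [sf fu fv]] := hg1 (u * g)%g (c1 _ cu); first by move/(iY _ cu).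
  exists (tr 1%g f g^-1%g); split; first exact: span_tr mr _ sf.
    by rewrite mcoeff_tr invg1 mul1g invgK.
  move=> v cv nYv nvu; rewrite mcoeff_tr invg1 mul1g invgK; apply: fv; first exact: c1.
    by move/(iY _ cv).
  by move/mulIg.
have sf' := span_tr mx sf.
apply: (@tr_eq0 _ _ 1%g g); apply: hg2 => // v cv nYv.
rewrite mcoeff_tr invg1 mul1g; apply: fv; first exact: c2.
by move/(iY _ (c2 _ cv)); rewrite mulgVK.
Qed.

End Classes.

(** * Leftmost reducible occurrences and their reducing elements *)

Section Reducers.
Local Open Scope ring_scope.
Local Open Scope classical_set_scope.
Implicit Types (p q : kF) (s t u v a b c e : seq L) (g h : F).
Implicit Types (x y : seq L * seq L) (U V : F).

Lemma cst_lamN a : (D <= cst a)%N -> lam a N.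
Proof. by rewrite /cst ltnS => /mn_lam. Qed.

(** Replacements between words of full weight [w l + D + w t] are steps for every large occurrence
    that starts further left. *)
Lemma slot_inv l a a1 t p s x : tight l a t -> tight l a1 t -> Rel p -> inp p a -> inp p a1 ->
  (w l + D + w t <= w (l ++ a ++ t))%N -> (w l + D + w t <= w (l ++ a1 ++ t))%N ->
  thn s x -> s ++ x.1 ++ x.2 = l ++ a ++ t -> (size s < size l)%N ->
  (exists d, [/\ d <> [::], l = s ++ x.1 ++ d, x.2 = d ++ a ++ t &
     step N N s x (x.1, d ++ a1 ++ t)]) \/
  (exists u c c1 a' a1', [/\ u <> [::], l = s ++ u, x = (u ++ c, a' ++ t),
     a = c ++ a' /\ a1 = c1 ++ a1' & step N N s x (u ++ c1, a1' ++ t)]).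
Proof.
move=> ta ta1 rp ia ia1 wa wa1 tx e lt.
have [v [el ev]] := cat_eq e (ltnW lt).
have vn : v <> [::] by move=> v0; move: lt; rewrite el v0 cats0 ltnn.
have Ma := tight_M ta; have Ma1 := tight_M ta1; have [t0 _] := tx; have Mx := tight_M t0.
have la : lam a N.
  by apply: cst_lamN; have := w_upper l t Ma; lia.
have la1 : lam a1 N.
  by apply: cst_lamN; have := w_upper l t Ma1; lia.
have adjc c : x.1 = v ++ c -> a ++ t = c ++ x.2 ->
  exists u c c1 a' a1', [/\ u <> [::], l = s ++ u, x = (u ++ c, a' ++ t),
     a = c ++ a' /\ a1 = c1 ++ a1' & step N N s x (u ++ c1, a1' ++ t)].
  move=> ex eat; subst l.
  have [a' [ea e2]] : exists a', a = c ++ a' /\ x.2 = a' ++ t.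
    case: (cat_eqP eat) => [[m [ec _]]|[m [mn ea et]]]; last by exists m.
    exfalso; case: ta => _ _ lta _; apply: (ltight_inside (r := [::]) vn lta).
    by apply: (@M_catl _ m); rewrite /= -catA -ec -ex.
  have ex' : x = (v ++ c, a' ++ t) by rewrite -ex -e2 -surjective_pairing.
  have cc : cov c 1 by case: ta => _ _ lta _; apply: (lstraddle lta Ma vn ea); rewrite -ex.
  have lv : lam v (C + 10).
    by apply: (lam_cutr (m := 1) cc); rewrite -ex -addnA; apply: thn_lam tx.
  have tx' : tight s (v ++ c) (a' ++ t) by rewrite -ex -e2.
  have lv2 : lam v 2 by apply: lam_le lv; lia.
  have [c1 [a1' [ea1 an1 tc1]]] := turn_slot vn lv2 tx' ta1.
  exists v, c, c1, a', a1'; split=> //.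
  have tv : tight s v [::].
    split; [by have := tight_red tx'; rewrite -catA catA cats0 =>
      /reduced_catl|by apply: (@M_catl _ c); rewrite -ex| |by []].
    by case: tx' => _ _ lts _; apply: ltight_prefix lts => //; rewrite -ex.
  have wv : (w s + D <= w (s ++ v))%N.
    have lv3 : lam v N.+2 by apply: lam_le lv; lia.
    by have := w_lower tv (or_introl lv3); rewrite cats0 w0 addn0.
  (* If the part [b] of the neighbour outside the overlap were small, cutting the word after
     [v ++ c0] would give a partition cheaper than the full weight. *)
  have key c0 b : M (v ++ c0) -> M b -> (w (s ++ v) + D + w t <= w ((s ++ v) ++ (c0 ++ b) ++ t))%N
    -> lam b N.
    move=> Mv Mb; have -> : (s ++ v) ++ (c0 ++ b) ++ t = s ++ (v ++ c0) ++ (b ++ t) by rewrite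
      -!catA.
    have := w_upper s (b ++ t) Mv; have := cst_le (v ++ c0); have := w_cat b t; have := w_Mcst Mb.
    by move=> *; apply: cst_lamN; lia.
  have la' : lam a' N.
    by apply: (key c); [rewrite -ex|apply: (@M_catr c); rewrite -ea|rewrite -ea].
  have la1' : lam a1' N.
    by apply: (key c1); [exact: tight_M tc1|apply: (@M_catr c1); rewrite -ea1|rewrite -ea1].
  rewrite ex'; apply: (step_adj (p := p)) => //; rewrite -?ea -?ea1 //.
case: (cat_eqP ev) => [[d [ed e2]]|[c [cn ex eat]]]; last by right; apply: (adjc c).
have [d0|/eqP dn] := eqVneq d [::].
  by right; apply: (adjc [::]); rewrite ?cats0 ?ed ?e2 ?d0 ?cats0.
left; exists d; split=> //; first by rewrite el ed.
have ex : x = (x.1, d ++ a ++ t) by rewrite -e2 -surjective_pairing.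
rewrite {1}ex; apply/step_far/(Fstep (p := p)) => //.
- by rewrite -e2.
- case: t0 => _ Mb lts rts; split=> //; first by have := tight_red ta1; rewrite el ed -!catA.
  by rewrite e2 in rts; exact: rtight_change rts.
- by rewrite -ed -el.
- by rewrite -ed -el.
Qed.

Definition redat (W : seq L) s : Prop :=
  exists x, [/\ thn s x, ~ irr s x & s ++ x.1 ++ x.2 = W].

Lemma redat_inv l a a1 t p s : tight l a t -> tight l a1 t -> Rel p -> inp p a -> inp p a1 ->
  (w l + D + w t <= w (l ++ a ++ t))%N -> (w l + D + w t <= w (l ++ a1 ++ t))%N ->
  (size s < size l)%N -> redat (l ++ a ++ t) s -> redat (l ++ a1 ++ t) s.
Proof.
move=> ta ta1 rp ia ia1 wa wa1 lt [x [tx nx ex]].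
have fin y : step N N s x y -> s ++ y.1 ++ y.2 = l ++ a1 ++ t -> redat (l ++ a1 ++ t) s.
  move=> st ey; have ty := thn_steps tx (chain1 st).
  by exists y; split=> // iy; apply: nx; apply: (irr_steps ty (chain1 (step_sym st)) iy).
case: (slot_inv ta ta1 rp ia ia1 wa wa1 tx ex lt) => [[d [dn el e2 st]]|].
  by apply: fin st _; rewrite /= el -!catA.
move=> [u [c [c1 [a' [a1' [un el e2 [ea ea1] st]]]]]].
by apply: fin st _; rewrite /= el ea1 -!catA.
Qed.

Lemma thn_w s x : thn s x -> w (s ++ x.1 ++ x.2) = (w s + D + w x.2)%N.
Proof.
by move=> tx; apply: w_eq; [case: tx|left; apply: lam_le (thn_lam tx); lia].
Qed.

Lemma linked_redat s x b s0 : thn s x -> linked s x b -> (size s0 < size s)%N ->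
  redat (s ++ b ++ x.2) s0 -> redat (s ++ x.1 ++ x.2) s0.
Proof.
move=> tx [n h] lt; elim: h => // n' c d e h IH [q [rq [iq iq'] t1 t2]] rd; apply: IH.
apply: (redat_inv (proj1 t2) (proj1 t1) rq iq' iq) => //.
  by rewrite (thn_w t2).
by rewrite (thn_w t1).
Qed.

(** The element of the reduced basis with leading monomial [x.1]; by [isred_uniq] there is only
    one. *)
Definition isred s x (f : kF) : Prop :=
  [/\ linear_span (meets s x) f, f@_(wd x.1) = 1 &
    forall v : F, cls s x v -> ~ irrs s x v -> v <> wd x.1 -> f@_v = 0].

Lemma isred_ex s x : thn s x -> ~ irr s x -> exists f, isred s x f.
Proof.
move=> tx nx; have [h _] := irr_good tx; apply: h.
  by apply: linked_cls => //; exists 0; apply: chain0.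
by rewrite /irrs /= letters_wd ?(thn_reduced tx) // -surjective_pairing.
Qed.

Lemma isred_uniq s x f f' : thn s x -> isred s x f -> isred s x f' -> f = f'.
Proof.
move=> tx [sf f1 fv] [sf' f1' fv']; apply/eqP; rewrite -subr_eq0; apply/eqP.
have [_ h] := irr_good tx; apply: h; first exact: spanB.
move=> v cv nv; rewrite mcoeffB; have [->|/eqP nvx] := eqVneq v (wd x.1).
  by rewrite f1 f1' subrr.
by rewrite fv ?fv' ?subrr.
Qed.

Lemma tp_meets s x y g q : tp s x y g -> meets s x q -> meets s y (tr 1%g q g).
Proof.
move=> t1 [rq [b lb ib]]; have [_ lr hq] := t1 _ lb; split; first exact: hq.
by exists (letters (wd b * g)%g) => //; apply: (inp_tr _ ib); rewrite mul1g wdK.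
Qed.

Lemma tp_cls s x y g (u : F) : tp s x y g -> cls s x u -> cls s y (u * g)%g.
Proof. by move=> t1 lu; have [_] := t1 _ lu; rewrite wdK. Qed.

Lemma tp_irrs s x y g (u : F) : thn s x -> tp s x y g -> cls s x u -> irrs s x u ->
  irrs s y (u * g)%g.
Proof.
move=> tx t1 lu iu; have [[n h] _ _] := t1 _ lu; rewrite wdK in h.
exact: irr_steps (linked_thn tx lu) h iu.
Qed.

Lemma isred_step s x y f : thn s x -> step N N s x y -> isred s x f ->
  isred s y (tr 1%g f ((wd x.1)^-1 * wd y.1)%g).
Proof.
move=> tx st [sf f1 fv]; have ty := thn_steps tx (chain1 st).
have t1 := tp_step tx st; have t2 := tp_step ty (step_sym st).
set g := (_ * _)%g; have eg : ((wd y.1)^-1 * wd x.1)%g = g^-1%g by rewrite /g invgM invgK.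
rewrite eg in t2; split.
- exact: span_tr (fun q => tp_meets t1) _ sf.
- by rewrite mcoeff_tr invg1 mul1g -eg mulVKg.
- move=> v cv nv nvy; rewrite mcoeff_tr invg1 mul1g; apply: fv.
  + exact: tp_cls t2 cv.
  + move=> iv; apply: nv; have := tp_irrs tx t1 (tp_cls t2 cv) iv.
    by rewrite mulgVK.
  + by move=> ev; apply: nvy; rewrite -(mulgVK g v) ev /g mulVKg.
Qed.

Definition leftmost (W : seq L) s x : Prop :=
  [/\ thn s x, ~ irr s x, s ++ x.1 ++ x.2 = W &
    forall s', (size s' < size s)%N -> ~ redat W s'].

Lemma leftmost_ex W s : redat W s -> exists s' x, leftmost W s' x /\ (size s' <= size s)%N.
Proof.
move: {2}(size s) (leqnn (size s)) => n; elim: n s => [|n IH] s le [x [tx nx ex]].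
  exists s, x; split=> //; split=> // s' lt; lia.
have [[s' [lt rs']]|no] := EM (exists s', (size s' < size s)%N /\ redat W s').
  have [|s2 [x2 [l2 le2]]] := IH s' _ rs'; first by lia.
  by exists s2, x2; split=> //; lia.
by exists s, x; split=> //; split=> // s' lt rs'; apply: no; exists s'.
Qed.

Lemma leftmost_uniq W s x s' x' : leftmost W s x -> leftmost W s' x' -> s = s' /\ x = x'.
Proof.
move=> [tx nx ex mx] [tx' nx' ex' mx'].
have es : size s = size s'.
  case: (ltngtP (size s) (size s')) => // lt; exfalso.
    by apply: (mx' _ lt); exists x.
  by apply: (mx _ lt); exists x'.
have e : s ++ (x.1 ++ x.2) = s' ++ (x'.1 ++ x'.2) by rewrite ex ex'.
have ss : s = s' by move/eqP: e; rewrite eqseq_cat // => /andP [/eqP].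
subst s'; split=> //; move/eqP: e; rewrite eqseq_cat // eqxx /= => /eqP e.
have [e1 e2] := tight_uniq (proj1 tx) (proj1 tx') e.
by rewrite (surjective_pairing x) (surjective_pairing x') e1 e2.
Qed.

End Reducers.

(** * The normal form *)

Section NormalForm.
Local Open Scope ring_scope.
Local Open Scope classical_set_scope.
Implicit Types (p q : kF) (s t a b c e : seq L) (g h u v : F).
Implicit Types (x y : seq L * seq L) (U V : F).

Definition reduces U s x f : Prop := leftmost (letters U) s x /\ isred s x f.

Lemma reduces_uniq U s x f s' x' f' : reduces U s x f -> reduces U s' x' f' ->
  [/\ s = s', x = x' & f = f'].
Proof.
move=> [l r] [l' r']; have [es ex] := leftmost_uniq l l'; subst s' x'; split=> //.
by case: l => tx _ _ _; apply: isred_uniq r r'.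
Qed.

Definition next s x (f : kF) : kF := tr (wd s) (gmon k (wd x.1) - f) (wd x.2).

Lemma reduces_wd U s x f : reduces U s x f -> U = (wd s * wd x.1 * wd x.2)%g.
Proof. by move=> [[_ _ e _] _]; rewrite -(wdK U) -e !wd_cat mulgA. Qed.

Lemma next_supp s x f V : isred s x f -> V \in gsupp (next s x f) ->
  exists u, [/\ V = (wd s * u * wd x.2)%g, u <> wd x.1, f@_u != 0 & cls s x u -> irrs s x u].
Proof.
move=> [sf f1 fv]; rewrite gsupp_tr; set u := (_ * _)%g => uf; exists u.
have eV : V = (wd s * u * wd x.2)%g by rewrite /u mulgA mulVKg mulgVK.
have nu : u <> wd x.1.
  by move=> eu; move: uf; rewrite eu gsuppE mcoeffB mcoeff_gmon eqxx f1 subrr eqxx.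
have fu : f@_u != 0.
  move: uf; rewrite gsuppE mcoeffB mcoeff_gmon; have [eu|_] := eqVneq (wd x.1) u; first by case: nu.
  by rewrite sub0r oppr_eq0.
split=> // cu; apply: contrapT => ni; move/eqP: fu; apply; exact: fv.
Qed.

(* The leftmost reducible occurrence moves to the right when a reduction preserves
   the weight. *)
Definition pos U : nat :=
  if pselect (exists sx : seq L * (seq L * seq L), leftmost (letters U) sx.1 sx.2) is left ex
  then (size (projT1 (cid ex)).2.2).+1 else 0.

Lemma pos_leftmost U s x : leftmost (letters U) s x -> pos U = (size x.2).+1.
Proof.
move=> h; rewrite /pos; case: pselect => [ex|[]]; last by exists (s, x).
by have [_ <-] := leftmost_uniq h (projT2 (cid ex)).
Qed.

Lemma pos_none U : (forall s, ~ redat (letters U) s) -> pos U = 0%N.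
Proof.
move=> h; rewrite /pos; case: pselect => // ex0; exfalso.
by case: ex0 => -[s x] /= [tx nx ex _]; apply: (h s); exists x.
Qed.

Definition ltF V U : Prop := (wF V < wF U)%N \/ (wF V = wF U /\ (pos V < pos U)%N).

Lemma ltF_wf : well_founded ltF.
Proof.
move=> U; move: {2}(wF U) (erefl (wF U)) => n; elim/ltn_ind: n U => n IHn U.
move: {2}(pos U) (erefl (pos U)) => m; elim/ltn_ind: m U => m IHm U em en.
constructor=> V [lt|[e lt]]; first by apply: IHn (erefl _); rewrite -en.
by apply: IHm (erefl _) _; [rewrite -em|rewrite e].
Qed.

Lemma wF_le g u h : (wF (g * u * h)%g <= wF g + wF u + wF h)%N.
Proof. by have := wF_mul (g * u)%g h; have := wF_mul g u; lia. Qed.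

Lemma M_D u : Mon Rel u -> (wF u <= cst (letters u))%N.
Proof. by move=> Mu; apply: w_Mcst; split; rewrite ?letters_reduced ?wdK. Qed.

Lemma meets_supp s x f u : linear_span (meets s x) f -> f@_u != 0 ->
  exists q b, [/\ Rel q, linked s x b, inp q b & inp q (letters u)].
Proof.
move=> sf; rewrite -gsuppE => /(span_supp sf) [q [rq [b lb ib]] uq].
by exists q, b; split=> //; rewrite /inp wdK.
Qed.

(* A new monomial of the same weight is again tight, and has no slot to reduce
   up to the position of the old one. *)
Lemma next_full s x f u : thn s x -> isred s x f -> f@_u != 0 -> u <> wd x.1 ->
  (cls s x u -> irrs s x u) -> lam (letters u) 2 ->
  tight s (letters u) x.2 /\ ~ (thn s (letters u, x.2) /\ ~ irr s (letters u, x.2)).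
Proof.
move=> tx [sf f1 fv] fu nu ci lu.
have [q [b [rq lb ib iu]]] := meets_supp sf fu.
have tb := linked_thn tx lb; have lb2 : lam b 2 by apply: lam_le (thn_lam tb); lia.
have tu := tight_move (proj1 tb) lb2 rq ib iu (letters_reduced u) lu.
split=> // -[thu niu]; apply/niu/ci; exact: thn_link tx lb rq ib iu thu.
Qed.

Lemma full_letters s a t g : tight s a t -> g = (wd s * wd a * wd t)%g ->
  letters g = s ++ a ++ t.
Proof. by move=> /tight_red r ->; rewrite -!wd_cat -catA letters_wd. Qed.

Lemma tight_right s a t s' b t' d : tight s a t -> tight s' b t' -> s' = s ++ d -> d <> [::] ->
  s ++ a ++ t = s' ++ b ++ t' -> (size t' < size t)%N.
Proof.
move=> [_ Ma _ _] [_ Mb lt _] es dn; rewrite es -catA => /eqP;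
  rewrite eqseq_cat // eqxx /= => /eqP e.
rewrite ltnNge; apply/negP => le.
have [e0 [et eb]] : exists e0, t' = e0 ++ t /\ a = d ++ b ++ e0.
  have e' : (d ++ b) ++ t' = a ++ t by rewrite -catA.
  have le' : (size (d ++ b) <= size a)%N.
    have := congr1 size e'; rewrite size_cat [size (a ++ t)]size_cat => sz.
    by rewrite -(leq_add2r (size t)) -sz leq_add2l.
  have [e0 [ed et]] := cat_eq e' le'.
  by exists e0; rewrite catA.
apply: (@ltight_inside b d s [::] dn); first by rewrite -es.
by apply: (@M_catl _ e0); rewrite /= -catA -eb.
Qed.

Lemma lin_redat s x u s0 : thn s x ->
  forall q b, Rel q -> linked s x b -> inp q b -> inp q (letters u) -> tight s (letters u) x.2 ->
  (w s + D + w x.2 <= w (s ++ letters u ++ x.2))%N -> (size s0 < size s)%N ->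
  redat (s ++ letters u ++ x.2) s0 -> redat (s ++ x.1 ++ x.2) s0.
Proof.
move=> tx q b rq lb ib iu tu wu lt rd; have tb := linked_thn tx lb.
apply: (linked_redat tx lb lt); apply: (redat_inv tu (proj1 tb) rq iu ib) => //.
by rewrite (thn_w tb).
Qed.

(** A new word of the same weight has a monomial in the old slot that is not reducible there, and
    [lin_redat] excludes reducible occurrences further left. *)
Lemma next_lt U s x f V : reduces U s x f -> V \in gsupp (next s x f) -> ltF V U.
Proof.
have C1 := C14; move=> [[tx nx eU mx] rf] /(next_supp rf) [u [eV nu fu ci]].
have [q [b [rq lb ib iu]]] : exists q b, [/\ Rel q, linked s x b, inp q b & inp q (letters u)].
  by case: (rf) => sf _ _; apply: meets_supp sf fu.
have Mu : Mon Rel u by exists q => //; move: iu; rewrite /inp wdK.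
have rs : reduced s by have := tight_red (proj1 tx) => /reduced_catl.
have rt : reduced x.2 by have := tight_red (proj1 tx) => /reduced_catr/reduced_catr.
have wU : wF U = (w s + D + w x.2)%N by rewrite /wF -eU thn_w.
have wV : (wF V <= w s + wF u + w x.2)%N by rewrite eV -(wF_wd rs) -(wF_wd rt); apply: wF_le.
have wu := M_D Mu; have cu := cst_le (letters u).
have [lt|ge] := ltnP (wF V) (wF U); [by left|right].
have wVU : wF V = wF U by lia.
have lu : lam (letters u) N by apply: cst_lamN; lia.
have [|tu nu'] := next_full tx rf fu nu ci; first by apply: lam_le lu; lia.
have eVl : letters V = s ++ letters u ++ x.2 by apply: full_letters tu _; rewrite wdK.
split=> //; rewrite (pos_leftmost (And4 tx nx eU mx)).
have [[s' rs']|/forallNP none] := EM (exists s', redat (letters V) s'); last by rewrite pos_none.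
have [s1 [x1 [l1 _]]] := leftmost_ex rs'.
rewrite (pos_leftmost l1) ltnS; case: l1 => tx1 nx1 e1 m1.
have [lt|ge1] := ltnP (size s1) (size s).
  exfalso; apply: (mx s1 lt); rewrite -eU.
  apply: (lin_redat tx rq lb ib iu tu) => //.
    by rewrite -eVl -/(wF V) wVU wU.
  by exists x1; rewrite e1 eVl.
have e2 : s ++ (letters u ++ x.2) = s1 ++ (x1.1 ++ x1.2) by rewrite e1.
have [d [ed _]] := cat_eq e2 ge1.
have [d0|/eqP dn] := eqVneq d [::]; last by apply: (tight_right tu (proj1 tx1) ed dn); rewrite e1.
exfalso; rewrite d0 cats0 in ed; subst s1.
move/eqP: e2; rewrite eqseq_cat // eqxx /= => /eqP e2.
have [eu et] := tight_uniq tu (proj1 tx1) e2.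
by apply: nu'; rewrite eu et -surjective_pairing.
Qed.

Definition redata U : option (seq L * (seq L * seq L) * kF) :=
  if pselect (exists d : seq L * (seq L * seq L) * kF, reduces U d.1.1 d.1.2 d.2) is left ex
  then Some (projT1 (cid ex)) else None.

Lemma redataP U s x f : reduces U s x f -> redata U = Some (s, x, f).
Proof.
move=> r; rewrite /redata; case: pselect => [ex|[]]; last by exists (s, x, f).
by have := projT2 (cid ex); case: (projT1 _) => -[s' x'] f' /= r';
  have [-> -> ->] := reduces_uniq r r'.
Qed.

Definition phi_rec U (rec : forall V, ltF V U -> kF) : kF :=
  if redata U is Some (s, x, f) then
    (* The default value 0 is never met, since [next_lt] makes every word of [next s x f] smaller
       than [U]. *)
    lext (fun V => if pselect (ltF V U) is left l then rec V l else 0) (next s x f)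
  else gmon k U.

Definition phi : F -> kF := Fix ltF_wf (fun=> kF) phi_rec.

Lemma phiE U : phi U = phi_rec (fun V (_ : ltF V U) => phi V).
Proof.
have ext V (r1 r2 : forall W, ltF W V -> kF) : (forall W l, r1 W l = r2 W l) ->
    phi_rec r1 = phi_rec r2.
  move=> e; congr phi_rec; apply: functional_extensionality_dep => W.
  by apply: functional_extensionality_dep => l; apply: e.
exact: (Fix_eq ltF_wf (fun=> kF) phi_rec ext U).
Qed.

Lemma phi_red U s x f : reduces U s x f -> phi U = lext phi (next s x f).
Proof.
move=> r; rewrite phiE /phi_rec (redataP r) /lext; apply: eq_big_seq => V /(next_lt r) lt.
case: pselect => [l|nl]; [reflexivity|by case: (nl lt)].
Qed.

Definition irreducible U : Prop := forall s, ~ redat (letters U) s.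

Lemma phi_irr U : irreducible U -> phi U = gmon k U.
Proof.
move=> h; rewrite phiE /phi_rec /redata; case: pselect => // ex0; exfalso.
by case: ex0 => -[[s x] f] /= [[tx nx ex _] _]; apply: (h s); exists x.
Qed.

Lemma reducesP U : irreducible U \/ exists s x f, reduces U s x f.
Proof.
have [[s rs]|/forallNP h] := EM (exists s, redat (letters U) s); [right|by left].
have [s' [x [l _]]] := leftmost_ex rs; have [tx nx _ _] := l.
by have [f rf] := isred_ex tx nx; exists s', x, f.
Qed.

(** * Overlaps of relations: the normal form kills all translates *)

Local Notation Phi := (lext phi).

(** Letters of [l] and [t] are absorbed into [p] as long as the product is a relation. When none can
    be absorbed any more, a monomial of measure at least [tau + 10] is maximal in its place. *)
Lemma norm l p t : reduced l -> reduced t -> Rel p -> p <> 0 ->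
  exists l' p' t' a, [/\ tr (wd l) p (wd t) = tr (wd l') p' (wd t'), Rel p',
    (w l' <= w l)%N, (w t' <= w t)%N & [/\ inp p' a, lam a (C + 12) & tight l' a t']].
Proof.
move: {2}(size l + size t).+1 (ltnSn (size l + size t)) => n.
elim: n l p t => // n IH l p t le rl rt rp pn.
have [a0 ia0 /lam_theta la] := sc_strong (span_gen rp) pn.
set a := letters a0 in la; have ia : inp p a by rewrite /inp wdK.
have ra : reduced a := letters_reduced a0.
have la2 : lam a 2 by apply: lam_le la; lia.
have an := lam_nil la2.
have [[z [l' [el rz]]]|noz] := EM (exists z l', l = rcons l' z /\ Rel (tr (wd [:: z]) p 1%g)).
  have e : tr (wd l) p (wd t) = tr (wd l') (tr (wd [:: z]) p 1%g) (wd t).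
    by rewrite tr_tr mul1g el wd_rcons.
  have le' : (size l' + size t < n)%N by move: le; rewrite el size_rcons; lia.
  have rl' : reduced l' by move: rl; rewrite el -cats1 => /reduced_catl.
  have pn' : tr (wd [:: z]) p 1%g <> 0 by move=> /tr_eq0.
  rewrite e; have [l2 [p2 [t2 [a2 [h1 h2 h3 h4 h5]]]]] := IH l' _ t le' rl' rt rz pn'.
  exists l2, p2, t2, a2; split=> //; apply: leq_trans h3 _.
  by rewrite el -cats1; apply: w_catl.
have [[z [t' [et rz]]]|noz'] := EM (exists z t', t = z :: t' /\ Rel (tr 1%g p (wd [:: z]))).
  have e : tr (wd l) p (wd t) = tr (wd l) (tr 1%g p (wd [:: z])) (wd t').
    by rewrite tr_tr mulg1 et -wd_cons.
  have le' : (size l + size t' < n)%N by move: le; rewrite et /=; lia.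
  have rt' : reduced t' by move: rt; rewrite et; apply: reduced_behead.
  have pn' : tr 1%g p (wd [:: z]) <> 0 by move=> /tr_eq0.
  rewrite e; have [l2 [p2 [t2 [a2 [h1 h2 h3 h4 h5]]]]] := IH l _ t' le' rl rt' rz pn'.
  exists l2, p2, t2, a2; split=> //; apply: leq_trans h4 _.
  by rewrite et -cat1s; apply: w_catr.
exists l, p, t, a; split=> //; split=> //; split.
- apply: reduced_cat3 an _ _.
    case/lastP: l rl noz {le} => [//|l' z] rl noz.
    rewrite cat_rcons; apply: reduced_glue => //.
    case: (a) ia ra => // b a' ia ra; rewrite /reduced /=; apply/andP; split=> //.
    apply/negP => /eqP eb; apply: noz; exists z, l'; split=> //.
    have := compat_l rp ia ra; rewrite eb -wdV // /winv /= linvK; exact.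
  case: t rt noz' {le} => [|z t'] rt noz'; first by rewrite cats0.
  case/lastP: (a) ia ra => [//|a' b] ia ra; apply: reduced_glue => //.
  rewrite -cats1 cat_rcons; apply: reduced_glue => //.
  rewrite /reduced /= andbT; apply/negP => /eqP eb; apply: noz'; exists z, t'; split=> //.
  have := compat_r rp ia ra; rewrite -wdV // /winv /= -eb; exact.
- exact: MI ia ra.
- move=> l' z el Mz; apply: noz; exists z, l'; split=> //.
  have := @tr_left p z a [::] rp; rewrite cats0; exact.
- move=> z t' et Mz; apply: noz'; exists z, t'; split=> //.
  exact: (@tr_right p z a [::] rp).
Qed.

Lemma phi_isred U s x f : reduces U s x f -> Phi (tr (wd s) f (wd x.2)) = 0.
Proof.
move=> r; have := phi_red r; rewrite /next trD trN lextB tr_gmon -(reduces_wd r) lext_gmon => e.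
by apply/eqP; rewrite -[X in _ == X](subrr (phi U)) {2}e opprB addrC subrK.
Qed.

Lemma lext_span (P : set kF) g h f : (forall q, P q -> Phi (tr g q h) = 0) ->
  linear_span P f -> Phi (tr g f h) = 0.
Proof.
move=> hP; apply: (span_min (U := [set f | Phi (tr g f h) = 0]) _ hP).
split=> [|c f1 f2 h1 h2] /=; first by rewrite tr0 lext0.
by rewrite trD trZ lextD lextZ h1 h2 scaler0 addr0.
Qed.

(** Needed where a replacement on the right lowers the weight and therefore may fail to be a step:
    the factor [c^-1 c1] still turns every relation that meets the class into a relation. *)
Lemma linked_mul s (u c c1 t b : seq L) q : thn s (u ++ c, t) -> lam u 2 -> M (u ++ c1) ->
  cov c 1 ->
  cov c1 1 -> linked s (u ++ c, t) b -> Rel q -> inp q b -> Rel (tr 1%g q ((wd c)^-1 * wd c1)%g).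
Proof.
move=> tx lu Mc1 cc cc1 [n h].
have Mc : M (u ++ c) := tight_M (proj1 tx).
set g := ((wd c)^-1 * wd c1)%g.
have key d : M d -> lam d 4 -> M (letters (wd d * g)%g) -> forall q, Rel q -> inp q d ->
  Rel (tr 1%g q g).
  move=> Md ld Mdg q0 rq0 iq0.
  have [d0 [e [e1 [ed ce rd ewd]]]] := mul_pieces Md (M_catr Mc) (M_catr Mc1) cc cc1.
  have ld0 : lam d0 2 by apply: (lam_cutr (m := 2) ce); rewrite -ed.
  have Md1 : M (d0 ++ e1) by rewrite -(letters_wd rd) ewd.
  have eg : g = ((wd e)^-1 * wd e1)%g.
    apply: (mulgI (wd d)); rewrite -ewd ed !wd_cat -!mulgA; congr (_ * _)%g.
    by rewrite mulVKg.
  have := @piece_lr q0 d0 [::] e [::] e1 ld0 rq0.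
  rewrite /= -eg -ed => /(_ (M_reduced Md) iq0 Md1) []; by [].
have : M (letters (wd b * g)%g) /\ thn s (b, t).
  have := erefl (u ++ c); rewrite /= in h; elim: {1}(u ++ c) b / h =>
    [d ed|n' d d1 d' e IH [q0 [rq [iq iq'] t1 t2]] ed].
    rewrite ed; split=> //; rewrite wd_cat /g -mulgA mulVKg -wd_cat letters_wd //.
    exact: M_reduced.
  have [Mg td] := IH ed; split=> //.
  have ld : lam d1 4 by apply: lam_le (thn_lam td) => /=; lia.
  have r1 := key d1 (tight_M (proj1 td)) ld Mg q0 rq iq.
  apply: (MI r1); last exact: letters_reduced.
  by apply: (inp_tr _ iq'); rewrite mul1g wdK.
move=> [Mg tb]; apply: (key b _ _ Mg); first exact: tight_M (proj1 tb).
by apply: lam_le (thn_lam tb) => /=; lia.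
Qed.

Lemma linked_meets s b t b' q : linked s (b, t) b' -> meets s (b, t) q -> meets s (b', t) q.
Proof.
move=> l [rq [c lc ic]]; split=> //; exists c => //.
exact: linked_trans (linked_sym l) lc.
Qed.

Lemma linked_clsE s b t b' u : linked s (b, t) b' -> cls s (b', t) u -> cls s (b, t) u.
Proof. by move=> l lu; apply: (linked_trans l); exact: lu. Qed.

(** With nothing reducible further left, the reducible monomials of [p] are reduced at this very
    place. So [p] is a combination of basis elements whose translates are killed by [phi_isred]. *)
Lemma phi_top l a t p : tight l a t -> Rel p -> inp p a -> lam a N.+2 ->
  (forall s, (size s < size l)%N -> ~ redat (l ++ a ++ t) s) -> Phi (tr (wd l) p (wd t)) = 0.
Proof.
move=> ta rp ia la nored.
have pn : p <> 0 by move=> p0; move: ia; rewrite /inp gsuppE p0 mcoeff0 eqxx.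
have [a0 ia0 /lam_theta la0] := sc_strong (span_gen rp) pn.
set a' := letters a0 in la0; have ia' : inp p a' by rewrite /inp wdK.
have la2 : lam a 2 by apply: lam_le la; lia.
have la2' : lam a' 2 by apply: lam_le la0; lia.
have ta' := tight_move ta la2 rp ia ia' (letters_reduced a0) la2'.
have tha : thn l (a', t) by split=> //; exists 0, (a', t); split=> //; apply: chain0.
have wa : (w l + D + w t <= w (l ++ a ++ t))%N by apply: w_lower => //; left.
have nored' s : (size s < size l)%N -> ~ redat (l ++ a' ++ t) s.
  move=> lt rd; apply: (nored s lt); apply: (redat_inv ta' ta rp ia' ia) => //.
  by rewrite (thn_w tha).
have pm : meets l (a', t) p by split=> //; exists a' => //; exists 0; apply: chain0.
have [hg1 hg2] := irr_good tha.
pose P u := cls l (a', t) u /\ ~ irrs l (a', t) u.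
pose fs u : kF := if pselect (exists f, isred l (letters u, t) f) is left ex then projT1 (cid ex)
  else 0.
have fsP u : P u -> isred l (letters u, t) (fs u).
  move=> [cu nu]; rewrite /fs; case: pselect => [ex|[]]; first exact: (projT2 (cid ex)).
  by apply: isred_ex nu; exact: linked_thn tha cu.
have fsm u : P u -> [/\ linear_span (meets l (a', t)) (fs u), (fs u)@_u = 1 &
    forall v, P v -> v <> u -> (fs u)@_v = 0].
  move=> Pu; have [sf f1 fv] := fsP _ Pu; rewrite wdK in f1 fv.
  have lu' := linked_sym (proj1 Pu).
  split=> // [|v [cv nv] nvu].
    apply: (span_min (span_subspace _)) sf => q /(linked_meets lu') mq; exact: span_gen.
  by apply: fv => //; apply: linked_clsE cv.
have redu u : P u -> reduces (wd (l ++ letters u ++ t)) l (letters u, t) (fs u).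
  move=> Pu; split; last exact: fsP.
  have tu := linked_thn tha (proj1 Pu).
  rewrite letters_wd; last exact: tight_red (proj1 tu).
  split=> //; first exact: (proj2 Pu).
  move=> s' lt rd; apply: (nored' _ lt); exact: (linked_redat tha (proj1 Pu) lt rd).
pose S := [seq u <- enum_fset (gsupp p) | `[< P u >]].
(* Both sides lie in the span and have the same coefficients at the leading monomials of the
   basis. *)
have pE : p = \sum_(u <- S) p@_u *: fs u.
  apply/eqP; rewrite -subr_eq0; apply/eqP; apply: hg2.
    apply: spanB; first exact: span_gen.
    apply: (subspace_sum (span_subspace _)) => u; rewrite mem_filter => /andP [/asboolP Pu _];
      apply: spanZ.
    by case: (fsm _ Pu).
  move=> v cv nv; have e u : u \in S -> (p@_u *: fs u)@_v = if u == v then p@_v else 0.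
    rewrite mem_filter => /andP [/asboolP Pu _]; rewrite mcoeffZ; have [_ f1 h] := fsm _ Pu.
    have [euv|/eqP nuv] := eqVneq u v; first by rewrite -euv f1 mulr1.
    by rewrite h ?mulr0 // => evu; apply: nuv.
  rewrite mcoeffB raddf_sum /= (eq_big_seq _ e) -big_mkcond /=.
  apply/eqP; rewrite subr_eq0; apply/eqP.
  have [vp|vp] := boolP (v \in gsupp p); last first.
    have -> : p@_v = 0 by move: vp; rewrite gsuppE negbK => /eqP.
    by apply/esym/big1_seq.
  have vS : v \in S by rewrite mem_filter; apply/andP; split=> //; apply/asboolP.
  have uS : uniq S by apply: filter_uniq; exact: fset_uniq.
  rewrite -big_filter (_ : [seq u <- S | u == v] = [:: v]) ?big_seq1 //.
  by rewrite filter_pred1_uniq.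
rewrite {1}pE tr_sum lext_sum; apply: big1_seq => u /andP [_];
  rewrite mem_filter => /andP [/asboolP Pu _].
by rewrite trZ lextZ (phi_isred (redu _ Pu)) scaler0.
Qed.

Definition phi_IH U : Prop := forall V, ltF V U -> forall l a t p, tight l a t -> Rel p ->
  inp p a -> lam a (C + 12) -> V = wd (l ++ a ++ t) -> Phi (tr (wd l) p (wd t)) = 0.

Lemma phi_low U : phi_IH U ->
  forall g h q, Rel q -> (wF g + D + wF h < wF U)%N -> Phi (tr g q h) = 0.
Proof.
move=> IH g h q rq lt.
have [->|/eqP qn] := eqVneq q 0; first by rewrite tr0 lext0.
have [l [p [t [a [e rp le1 le2 [ia la ta]]]]]] := norm (letters_reduced g) (letters_reduced h) rq
  qn.
rewrite !wdK in e; rewrite e; apply: (IH (wd (l ++ a ++ t)) _ l a t p ta rp ia la erefl).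
left; apply: leq_ltn_trans lt; rewrite wF_wd ?(tight_red ta) //.
have := w_upper l t (tight_M ta); have := cst_le a; rewrite /wF; lia.
Qed.

Lemma phi_low_span U : phi_IH U ->
  forall s x f g d h, linear_span (meets s x) f ->
  (forall q, meets s x q -> Rel (tr 1%g q d)) ->
  (wF g + D + wF h < wF U)%N -> Phi (tr g f (d * h)%g) = 0.
Proof.
move=> IH s x f g d h sf hd lt; apply: (lext_span _ sf) => q mq.
have -> : tr g q (d * h)%g = tr g (tr 1%g q d) h by rewrite tr_tr mulg1.
by apply: (phi_low IH) => //; apply: hd.
Qed.

Lemma next_in s x f u : f@_u != 0 -> u <> wd x.1 -> (wd s * u * wd x.2)%g \in gsupp (next s x f).
Proof.
move=> fu nu; rewrite gsupp_tr.
have -> : ((wd s)^-1 * (wd s * u * wd x.2) * (wd x.2)^-1)%g = u by rewrite -!mulgA mulKg mulgV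
  mulg1.
rewrite gsuppE mcoeffB mcoeff_gmon.
by have [e|_] := eqVneq (wd x.1) u; [case: nu|rewrite sub0r oppr_eq0].
Qed.

(** A word of [Mon] that starts before the second of two overlapping maximal occurrences and ends
    beyond the first would properly contain one of them or be covered by two small pieces. *)
Lemma no_span s (v e a t s2 b y : seq L) : tight s (v ++ e) (a ++ t) -> tight (s ++ v) (e ++ a) t ->
  M b -> lam b 3 -> s2 ++ b ++ y = s ++ (v ++ e) ++ a ++ t ->
  (size s2 < size (s ++ v))%N -> (size y < size (a ++ t))%N -> False.
Proof.
move=> tm te Mb lb E lt1 lt2.
have E' : (s ++ v ++ e) ++ (a ++ t) = (s2 ++ b) ++ y by rewrite -!catA E -!catA.
have le : (size (s ++ v ++ e) <= size (s2 ++ b))%N.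
  have := congr1 size E'; rewrite (size_cat (_ ++ _ ++ _)) (size_cat (s2 ++ b)) => sz.
  by rewrite -(leq_add2r (size y)) -sz leq_add2l ltnW.
have [m2 [e1 e2]] := cat_eq E' le.
have mn : m2 <> [::] by move=> m0; move: lt2; rewrite e2 m0 ltnn.
have [_ Mm _ rm] := tm; have [_ Ma la _] := te.
rewrite e2 in rm.
have nM r : ~ M ((v ++ e) ++ m2 ++ r) := rtight_inside mn rm.
rewrite -catA in e1; case: (cat_eqP e1) => [[m [_ eb]]|[v1 [_ es2 eb]]].
  by apply: (nM [::]); apply: (@M_catr m); rewrite cats0 -eb.
have eb' : v ++ (e ++ m2) = v1 ++ b by rewrite catA.
have le1 : (size v1 <= size v)%N by move: lt1; rewrite es2 !size_cat ltn_add2l => /ltnW.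
have [v2 [ev ebb]] := cat_eq (esym eb') le1.
have v2n : v2 <> [::] by move=> v20; move: lt1; rewrite es2 ev v20 cats0 ltnn.
subst s2 v b; case: (cat_eqP e2) => [[r [em _]]|[r [rn ea _]]].
  apply: (@ltight_inside (e ++ a) v2 (s ++ v1) [::] v2n); first by rewrite -catA.
  by apply: (@M_catl _ r); rewrite /= -!catA -em.
have c1 : cov (v2 ++ e) 1.
  apply: (@rstraddle (v1 ++ v2 ++ e) y m2 (v2 ++ e) v1) => //; rewrite -?catA //.
    by rewrite catA.
  by rewrite catA.
have c2 : cov (e ++ m2) 1.
  apply: (@lstraddle (s ++ v1) (e ++ a) v2 (e ++ m2) r) => //.
    by rewrite -catA.
  by rewrite -catA -ea.
apply: (@cov_lam (v2 ++ e ++ m2) 2 3 _ isT lb); rewrite catA -[2%N]/(1 + 1)%N.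
by apply: cov_cat => //; apply: cov_catr c2.
Qed.

Lemma wF_mul_inv u c r : M (letters u) -> M c -> M (letters (u * (wd c)^-1)%g) -> cov c 1 ->
  cov (letters u) r -> (wF (u * (wd c)^-1)%g <= r.+2)%N.
Proof.
move=> Mu Mc Mr cc cu; have rc := M_reduced Mc.
have [u0 [j [t0 [eu ec r0]]]] := reduced_cancel (letters_reduced u) (winv_reduced rc).
have rj : reduced j by have := letters_reduced u; rewrite eu => /reduced_catr.
have e : letters (u * (wd c)^-1)%g = u0 ++ t0.
  by rewrite -(letters_wd r0) -(wd_cancel u0 t0 rj) -eu -ec wd_cat wdK wdV.
have ct : cov t0 1.
  apply: (@cov_winv_suffix t0 c _ Mc [::] j) => //; first by apply: (@M_catr u0); rewrite -e.
  by rewrite /= -[LHS]winvK ec winv_cat winvK.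
rewrite e in Mr; rewrite /wF e; apply: leq_trans (w_Mcst Mr) _.
rewrite /cst ltnS; apply: cov_mn; rewrite -addn1; apply: cov_cat => //.
by apply: (@cov_catl _ j); rewrite -eu.
Qed.

Lemma isred_cls s x f u : isred s x f -> f@_u != 0 -> u <> wd x.1 -> cls s x u -> irrs s x u.
Proof.
by move=> [_ _ fv] /eqP fu nu cu; apply: contrapT => ni; apply: fu; apply: fv.
Qed.

Lemma reduces_step l a a1 t p s x y f : tight l a t -> tight l a1 t -> Rel p -> inp p a ->
  inp p a1 ->
  (w l + D + w t <= w (l ++ a ++ t))%N -> (w l + D + w t <= w (l ++ a1 ++ t))%N ->
  (size s < size l)%N -> reduces (wd (l ++ a ++ t)) s x f -> step N N s x y ->
  s ++ y.1 ++ y.2 = l ++ a1 ++ t ->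
  reduces (wd (l ++ a1 ++ t)) s y (tr 1%g f ((wd x.1)^-1 * wd y.1)%g).
Proof.
move=> ta ta1 rp ia ia1 wa wa1 lt [[tx nx ex mx] rf] st ey.
rewrite letters_wd ?(tight_red ta) // in ex mx.
have ty := thn_steps tx (chain1 st).
split; last exact: isred_step.
rewrite letters_wd ?(tight_red ta1) //; split=> //.
  by move=> iy; apply: nx; apply: (irr_steps ty (chain1 (step_sym st)) iy).
move=> s' lt' rd; apply: (mx s' lt').
by apply: (redat_inv ta1 ta rp ia1 ia) => //; apply: ltn_trans lt.
Qed.

Lemma w_cut s (u c y : seq L) : tight s (u ++ c) y -> lam u N.+2 -> (w s + D <= w (s ++ u))%N.
Proof.
move=> [rd Mu lt _] lu; have lu2 : lam u 2 by apply: lam_le lu; lia.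
have tv : tight s u [::].
  split; [|exact: M_catl Mu|exact: ltight_prefix lt|by []].
  by rewrite cats0; move: rd; rewrite -catA catA => /reduced_catl.
by have := w_lower tv (or_introl lu); rewrite cats0 w0 addn0.
Qed.

Section PhiStep.
Variables (l a t : seq L) (p : kF).
Hypotheses (IH : phi_IH (wd (l ++ a ++ t))) (ta : tight l a t) (rp : Rel p) (ia : inp p a)
  (la : lam a (C + 12)).

Let C1 := C14.

Lemma full_weight : wF (wd (l ++ a ++ t)) = (w l + D + w t)%N.
Proof.
rewrite wF_wd ?(tight_red ta) //; apply: w_eq => //; left; apply: lam_le la; lia.
Qed.

Lemma full_tight u : p@_u != 0 -> (D <= cst (letters u))%N -> tight l (letters u) t.
Proof.
rewrite -gsuppE => pu h; have lu := cst_lamN h.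
have la2 : lam a 2 by apply: lam_le la; lia.
have lu2 : lam (letters u) 2 by apply: lam_le lu; lia.
by apply: (tight_move ta la2 rp ia _ (letters_reduced u) lu2); rewrite /inp wdK.
Qed.

(** The two occurrences are disjoint, so the product of [f] and [p] is expanded in two ways. Along
    [p], either [f] still reduces at the leftmost place or the weight has dropped; along [f], the
    words other than that of [x.1] are smaller and induction applies. *)
Lemma phi_far s x f d : reduces (wd (l ++ a ++ t)) s x f -> d <> [::] -> l = s ++ x.1 ++ d ->
  x.2 = d ++ a ++ t -> Phi (tr (wd l) p (wd t)) = 0.
Proof.
move=> red dn el ex2; have [[tx nx ex mx] rf] := red; have [sf f1 fv] := rf.
have Mx := tight_M (proj1 tx).
have wU := full_weight.
have lx : lam x.1 N.+2 by apply: lam_le (thn_lam tx); lia.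
have tx0 z : reduced (s ++ x.1 ++ d ++ z) -> tight s x.1 (d ++ z).
  move=> rz; have [[_ _ lt rt] _] := tx; split=> //.
  by rewrite ex2 in rt; exact: rtight_change rt.
have wx z : reduced (s ++ x.1 ++ d ++ z) -> w (s ++ x.1 ++ d ++ z) = (w s + D + w (d ++ z))%N.
  by move=> /tx0 tz; apply: w_eq => //; left.
have rl : reduced l by have := tight_red ta => /reduced_catl.
have rt : reduced t by have := tight_red ta => /reduced_catr/reduced_catr.
have wl : w l = (w s + D + w d)%N.
  by rewrite el -[X in s ++ x.1 ++ X]cats0 wx ?cats0 // -el.
have szl : (size s < size l)%N.
  rewrite el -[X in (X < _)%N]addn0 size_cat ltn_add2l size_cat.
  by case: (d) dn => // ? ? _; rewrite /= addnS.
have ws : wF (wd s) = w s by rewrite wF_wd //; move: rl; rewrite el => /reduced_catl.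
have wd' : wF (wd d) = w d by rewrite wF_wd //; move: rl; rewrite el => /reduced_catr/reduced_catr.
have wt : wF (wd t) = w t by rewrite wF_wd.
have -> : wd l = (wd s * wd x.1 * wd d)%g by rewrite el !wd_cat mulgA.
apply: (lext_cross f1) => u.
- move=> pu; have Mu : Mon Rel u by exists p => //; rewrite gsuppE.
  have hlow : (w s + D + wF (wd d * u * wd t)%g < wF (wd (l ++ a ++ t)))%N ->
      Phi (tr (wd s) f (wd d * u * wd t)%g) = 0.
    move=> lt; rewrite -[(_ * _)%g]mul1g.
    by apply: (phi_low_span IH sf) => [q [rq _]|]; rewrite ?tr11 ?ws.
  have [lt|ge] := ltnP (cst (letters u)) D.
    apply: hlow; have := wF_le (wd d) u (wd t); have := M_D Mu; rewrite wU wl wd' wt; lia.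
  have tb := full_tight pu ge; have rb := tight_red tb.
  have eb : (wd d * u * wd t)%g = wd (d ++ letters u ++ t) by rewrite !wd_cat wdK mulgA.
  have rdb : reduced (d ++ letters u ++ t) by move: rb;
    rewrite el -!catA => /reduced_catr/reduced_catr.
  have wb : w (l ++ letters u ++ t) = (w s + D + w (d ++ letters u ++ t))%N.
    by rewrite el -!catA wx // -?catA //; move: rb; rewrite el -!catA.
  have [lt|ge2] := ltnP (w (l ++ letters u ++ t)) (w l + D + w t).
    by apply: hlow; rewrite eb wF_wd // wU -wb.
  have iu : inp p (letters u) by rewrite /inp wdK gsuppE.
  have wa : (w l + D + w t <= w (l ++ a ++ t))%N by rewrite -wU wF_wd ?(tight_red ta).
  rewrite letters_wd ?(tight_red ta) // in ex.
  case: (slot_inv ta tb rp ia iu wa ge2 tx ex szl) => [[d' [_ el' _ st]]|]; last first.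
    move=> [u0 [c [c1 [a' [a1' [_ el' exx _ _]]]]]]; exfalso; apply: dn.
    move: el'; rewrite el exx /= -!catA => /eqP; rewrite !eqseq_cat // !eqxx /= => /eqP.
    rewrite -[RHS]cats0 => /eqP; rewrite eqseq_cat // eqxx /= => /eqP.
    by case: (c) => //=; case: (d).
  have ed : d = d'.
    by move: el'; rewrite el => /eqP; rewrite !eqseq_cat // !eqxx /= => /eqP.
  rewrite -ed in st.
  have := reduces_step ta tb rp ia iu wa ge2 szl red st.
  rewrite mulVg tr11 eb => h; apply: (phi_isred (x := (x.1, d ++ letters u ++ t)) (h _)).
  by rewrite /= el -!catA.
- move=> fu nu; have [q [b [rq lb ib iu]]] := meets_supp (let: And3 sf _ _ := rf in sf) fu.
  have Mu : Mon Rel u by exists q => //; move: iu; rewrite /inp wdK.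
  have wu := M_D Mu; have cu := cst_le (letters u).
  have [lt|ge] := ltnP (wF u) D.
    apply: (phi_low IH) => //; have := wF_le (wd s) u (wd d).
    rewrite wU wl ws wd' wt => h.
    apply: (@leq_ltn_trans (w s + wF u + w d + D + w t)); last by lia.
    by rewrite !leq_add2r; exact: h.
  have lu : lam (letters u) N by apply: cst_lamN; lia.
  have lu2 : lam (letters u) 2 by apply: lam_le lu; lia.
  have [tu _] := next_full tx rf fu nu (isred_cls rf fu nu) lu2.
  have eV : (wd s * u * wd x.2)%g = wd ((s ++ letters u ++ d) ++ a ++ t).
    by rewrite ex2 -!catA (wd_cat s) (wd_cat (letters u)) wdK mulgA.
  have -> : (wd s * u * wd d)%g = wd (s ++ letters u ++ d) by rewrite !wd_cat wdK mulgA.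
  apply: (IH (next_lt red (next_in s fu nu)) _ rp ia la eV).
  have [_ Ma lta rta] := ta; split=> //.
    by have := tight_red tu; rewrite ex2 -!catA.
  by rewrite catA; apply: (ltight_change (s := s ++ x.1)) => //; rewrite -catA -el.
Qed.

(** The product of [f] and [p] is formed with [c^-1] in between, so that the overlap [c] of the two
    occurrences is counted once. *)
Lemma phi_adj s (u c a' : seq L) f : reduces (wd (l ++ a ++ t)) s (u ++ c, a' ++ t) f -> u <>
  [::] ->
  l = s ++ u -> a = c ++ a' -> Phi (tr (wd l) p (wd t)) = 0.
Proof.
move=> red un el ea; have [[tx nx ex mx] rf] := red; have [sf f1 fv] := rf.
have tx1 : tight s (u ++ c) (a' ++ t) := proj1 tx.
have Mx : M (u ++ c) := tight_M tx1; have Mc : M c := M_catr Mx.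
have wU := full_weight.
have ta0 := ta; have [_ Ma lta _] := ta0.
have lta' : ltight (s ++ u) a by rewrite -el.
have cc : cov c 1 by apply: (lstraddle lta' Ma un ea).
have lu : lam u (C + 10).
  by apply: (lam_cutr (m := 1) cc); rewrite -addnA; exact: (thn_lam tx).
have lu2 : lam u 2 by apply: lam_le lu; lia.
have lu3 : lam u N.+2 by apply: lam_le lu; lia.
have la' : lam a' (C + 11) by apply: (lam_cutl (m := 1) cc); rewrite -ea add1n -addnS.
have Ma' : M a' by apply: (@M_catr c); rewrite -ea.
have la2 : lam a' 2 by apply: lam_le la'; lia.
have an : a' <> [::] := lam_nil la2.
have wl : (w s + D <= w l)%N by rewrite el; apply: (w_cut tx1 lu3).
have rl : reduced l by have := tight_red ta => /reduced_catl.
have rt : reduced t by have := tight_red ta => /reduced_catr/reduced_catr.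
have szl : (size s < size l)%N.
  by rewrite el size_cat -[X in (X < _)%N]addn0 ltn_add2l; case: (u) un.
have ws : wF (wd s) = w s by rewrite wF_wd //; move: rl; rewrite el => /reduced_catl.
have wt : wF (wd t) = w t by rewrite wF_wd.
have mul c1 : M (u ++ c1) -> cov c1 1 -> forall q, meets s (u ++ c, a' ++ t) q ->
    Rel (tr 1%g q ((wd c)^-1 * wd c1)%g).
  by move=> Mc1 cc1 q [rq [b lb ib]]; apply: (linked_mul tx lu2 Mc1 cc cc1 lb rq ib).
have mul0 q : meets s (u ++ c, a' ++ t) q -> Rel (tr 1%g q (wd c)^-1%g).
  have Mu0 : M (u ++ [::]) by rewrite cats0; exact: M_catl Mx.
  by move=> mq; have := mul [::] Mu0 (cov0 1) q mq; rewrite wd0 mulg1.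
have -> : wd l = (wd s * wd (u ++ c) * (wd c)^-1)%g by rewrite el !wd_cat mulgA mulgK.
apply: (lext_cross f1) => v.
- move=> pv; have Mv : Mon Rel v by exists p => //; rewrite gsuppE.
  have [lt|ge] := ltnP (cst (letters v)) D.
    rewrite -mulgA; apply: (phi_low_span IH sf mul0).
    have h1 := wF_mul v (wd t); have h2 := M_D Mv.
    apply: (@leq_ltn_trans (w s + D + (wF v + w t))).
      by rewrite ws leq_add2l -wt; exact: h1.
    by rewrite wU; lia.
  have tb := full_tight pv ge; have rb := tight_red tb; have lv := cst_lamN ge.
  have iv : inp p (letters v) by rewrite /inp wdK gsuppE.
  have wa : (w l + D + w t <= w (l ++ a ++ t))%N by rewrite -wU wF_wd ?(tight_red ta).
  have [lt|ge2] := ltnP (w (l ++ letters v ++ t)) (w l + D + w t).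
    have tb' : tight (s ++ u) (letters v) t by rewrite -el.
    have [c1 [b1 [eb _ tc1]]] := turn_slot un lu2 tx1 tb'.
    have cc1 : cov c1 1.
      by case: tb' => _ Mb ltb _; exact: (lstraddle ltb Mb un eb (tight_M tc1)).
    have -> : ((wd c)^-1 * v * wd t)%g = ((wd c)^-1 * wd c1 * wd (b1 ++ t))%g.
      by rewrite -{1}(wdK v) eb !wd_cat !mulgA.
    apply: (phi_low_span IH sf (mul c1 (tight_M tc1) cc1)).
    have rbt : reduced (b1 ++ t) by have := tight_red tc1 => /reduced_catr/reduced_catr.
    rewrite ws (wF_wd rbt) wU -(_ : w (l ++ letters v ++ t) = w s + D + w (b1 ++ t))%N //.
    rewrite -(w_eq tc1); last by left; apply: lam_catl.
    by rewrite el eb -!catA.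
  rewrite letters_wd ?(tight_red ta) // in ex.
  case: (slot_inv ta tb rp ia iv wa ge2 tx ex szl) => [[d [dn el' _ _]]|].
    exfalso; apply: dn; move: el'; rewrite el /= => /eqP; rewrite eqseq_cat // eqxx /= => /eqP.
    rewrite -{1}[u]cats0 -catA => /eqP; rewrite eqseq_cat // eqxx /= => /eqP.
    by case: (c) => //=; case: (d).
  move=> [u1 [c' [c1 [a1 [b1 [_ el' [ec _] [_ eb] st]]]]]].
  have eu : u = u1 by move: el'; rewrite el => /eqP; rewrite eqseq_cat // eqxx => /eqP.
  subst u1.
  have ec' : s ++ (u ++ c1, b1 ++ t).1 ++ (u ++ c1, b1 ++ t).2 = l ++ letters v ++ t.
    by rewrite /= el eb -!catA.
  have := phi_isred (reduces_step ta tb rp ia iv wa ge2 szl red st ec').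
  rewrite tr_tr mulg1 => h; rewrite -[RHS]h; congr (Phi (tr _ f _)).
  by rewrite -{1}(wdK v) eb !wd_cat invgM !mulgA mulgVK.
- move=> fm nm; have [q [b [rq lb ib im]]] := meets_supp (let: And3 sf _ _ := rf in sf) fm.
  have Mm : M (letters v) := MI rq im (letters_reduced v).
  (* If [v] is short, [v c^-1] has weight at most 5, whereas [u] contributed at least [D] to the
     weight of [l]; the weight has dropped. *)
  have [c3|l4] := cov_or_lam (letters v) 3.
    apply: (phi_low IH) => //.
    have Mmc : M (letters (v * (wd c)^-1)%g).
      have mq : meets s (u ++ c, a' ++ t) q by split=> //; exists b.
      apply: (MI (mul0 q mq)); last exact: letters_reduced.
      by apply: (inp_tr _ im); rewrite mul1g !wdK.
    have h1 := wF_mul_inv Mm Mc Mmc cc c3.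
    have h2 := wF_mul (wd s) (v * (wd c)^-1)%g.
    rewrite mulgA in h2.
    apply: (@leq_ltn_trans (w s + 5 + D + w t)); last by rewrite wU; lia.
    rewrite wt !leq_add2r; apply: leq_trans h2 _; rewrite ws leq_add2l; exact: h1.
  have lm2 : lam (letters v) 2 by apply: lam_le l4; lia.
  have [tm _] := next_full tx rf fm nm (isred_cls rf fm nm) lm2.
  have lt : ltF (wd s * v * wd (a' ++ t))%g (wd (l ++ a ++ t)) := next_lt red (next_in s fm nm).
  have eVl : letters (wd s * v * wd (a' ++ t))%g = s ++ letters v ++ (a' ++ t).
    by apply: (full_letters tm); rewrite wdK.
  set V := (wd s * v * wd (a' ++ t))%g in eVl lt.
  have [v0 [e [em Me he]]] := longest_suffix (letters v) Ma'.
  rewrite /= in tm; have tm' : tight s (v0 ++ e) (a' ++ t) by rewrite -em.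
  have vn : v0 <> [::].
    move=> v00; rewrite v00 /= in em; case: tm => _ _ _ rtm.
    by apply: (rtight_inside (r := [::]) an rtm); rewrite cats0 em.
  have te : tight (s ++ v0) (e ++ a') t.
    split=> //.
    - by have := tight_red tm'; rewrite -!catA.
    - by apply: (proj1 (ltight_cat s (e ++ a') vn)) => v' y1 ev; exact: he ev.
    - move=> z t' et Mz; have [_ _ _ rta] := ta0; apply: (rta z t' et).
      rewrite ea; rewrite ea in Ma; have := @M_right z a' c Ma la2; apply.
      by apply: (@M_catr e); rewrite -rcons_cat.
  set p' := tr (wd e * (wd c)^-1)%g p 1%g.
  have ia1 : inp p (c ++ a' ++ [::]) by rewrite cats0 -ea.
  have rp' : Rel p'.
    have ra1 : reduced (c ++ a' ++ [::]) by rewrite cats0 -ea; exact: M_reduced Ma.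
    have Me1 : M (e ++ a' ++ [::]) by rewrite cats0.
    by have [] := @piece_lr p a' c [::] e [::] la2 rp ra1 ia1 Me1.
  have ie : inp p' (e ++ a').
    by apply: (inp_tr _ ia1); rewrite cats0 mulg1 !wd_cat -mulgA mulKg.
  have lea : lam (e ++ a') N.+2 by apply: lam_catr; apply: lam_le la'; lia.
  have -> : tr (wd s * v * (wd c)^-1)%g p (wd t) = tr (wd (s ++ v0)) p' (wd t).
    by rewrite tr_tr mul1g -(wdK v) em !wd_cat !mulgA.
  have wV : wF V = (w (s ++ v0) + D + w t)%N.
    by rewrite /wF eVl em -(w_eq te (or_introl lea)) -!catA.
  have rs0 : reduced (s ++ v0) by have := tight_red te => /reduced_catl.
  (* Either the weight drops, or the leftmost reducible occurrence ends further right than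
     [v0 ++ e]. By [no_span] it then cannot start before [s ++ v0], and [phi_top] applies. *)
  case: lt => [ltw|[_ ltp]].
    by apply: (phi_low IH) => //; rewrite wt wF_wd // -wV.
  apply: (phi_top te rp' ie lea) => s1 lt1 rd1.
  have eW : letters V = (s ++ v0) ++ (e ++ a') ++ t by rewrite eVl em -!catA.
  rewrite -eW in rd1; have [s2 [x2 [l2 le2]]] := leftmost_ex rd1.
  rewrite (pos_leftmost l2) (pos_leftmost (proj1 red)) ltnS in ltp.
  have [tx2 _ ex2 _] := l2.
  apply: (no_span (s2 := s2) tm' te (tight_M (proj1 tx2)) _ _ _ ltp).
  + by apply: lam_le (thn_lam tx2); lia.
  + by rewrite ex2 eW -!catA.
  + exact: leq_ltn_trans le2 lt1.
Qed.

End PhiStep.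

Lemma phi_tight V l a t p : tight l a t -> Rel p -> inp p a -> lam a (C + 12) ->
  V = wd (l ++ a ++ t) -> Phi (tr (wd l) p (wd t)) = 0.
Proof.
elim/(well_founded_ind ltF_wf): V l a t p => V IH l a t p ta rp ia la eV; rewrite eV in IH.
have [|/existsNP [s0 /not_implyP [lt0 /contrapT rd0]]] :=
    EM (forall s, (size s < size l)%N -> ~ redat (l ++ a ++ t) s).
  by apply: (phi_top ta rp ia); apply: lam_le la; lia.
have [s [x [lm le0]]] := leftmost_ex rd0; have [tx nx ex mx] := lm.
have lt : (size s < size l)%N := leq_ltn_trans le0 lt0.
have [f rf] := isred_ex tx nx.
have red : reduces (wd (l ++ a ++ t)) s x f by split; rewrite ?letters_wd ?(tight_red ta).
have wa : (w l + D + w t <= w (l ++ a ++ t))%N by rewrite -(full_weight ta la) wF_wd ?(tight_red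
  ta).
(* The trivial replacement of [a] by itself serves to locate [x] relative to [a]. *)
case: (slot_inv ta ta rp ia ia wa wa tx ex lt) => [[d [dn el ex2 _]]|].
  exact: (phi_far IH ta rp ia la red dn el ex2).
move=> [u [c [c1 [a' [a1 [un el exx [ea _] _]]]]]]; rewrite exx in red.
exact: (phi_adj IH ta rp ia la red un el ea).
Qed.

Lemma phi_rel g h p : Rel p -> Phi (tr g p h) = 0.
Proof.
move=> rp; have [->|/eqP pn] := eqVneq p 0; first by rewrite tr0 lext0.
have [l [p' [t [a [e rp' _ _ [ia la ta]]]]]] := norm (letters_reduced g) (letters_reduced h) rp pn.
rewrite !wdK in e; rewrite e; exact: phi_tight ta rp' ia la erefl.
Qed.

(* Left multiplication by [t] cannot cancel a long part of an element of [Mon]. *)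
Definition thin (t : F) : Prop :=
  forall a c b, winv (letters t) = a ++ c ++ b -> M c -> cov c 9.

(** If no neighbour has changed [x.1], its measure is at least [C + 12], and 9 less is [N + 2].
    Otherwise the part [u] outside the overlap has measure at least [C + 11], and 9 less is the
    [N + 1] of the second case of [bigat]. *)
Lemma thn_big s x d b0 : thn s x -> x.1 = d ++ b0 -> cov d 9 ->
  forall l e, tight l (e ++ b0) x.2 -> bigat l (e ++ b0) x.2.
Proof.
have C1 := C14; move=> tx ex cd l e tb; have [tx0 [n [y [h ly]]]] := tx.
have [|/fsteps_tightl exy|] := steps_core (m := C) _ tx0 h; first by lia.
  left; apply: lam_catr; apply: (lam_cutl cd); rewrite -ex exy.
  by apply: lam_le ly; lia.
move=> [u [c [a [T [c' [a' [T' [ax ay]]]]]]]]; right.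
have My := tight_M (steps_tight h tx0); have cc' := adj_cov My ay.
have lu : lam u (C + 11).
  by case: ay ly => _ -> _ _ ly; apply: (lam_cutr (m := 1) cc'); rewrite -addnA.
case: ax => un exx ta la.
have e0 : d ++ b0 = u ++ c by rewrite -ex exx.
case: (cat_eqP e0) => [[u1 [eu eb]]|[u1 [_ ed _]]]; last first.
  exfalso; have cu : cov u 9 by apply: (@cov_catl _ u1); rewrite -ed.
  by apply: (cov_lam cu _ lu); lia.
have lu1 : lam u1 N.+1 by apply: (lam_cutl cd); rewrite -eu; apply: lam_le lu; lia.
have u1n := lam_nil lu1.
exists (e ++ u1), c, a, T; rewrite eb exx catA; split=> //.
- have [_ Ma lta rta] := ta; split=> //.
    by have := tight_red tb; rewrite eb exx -!catA.
  rewrite catA; rewrite eu catA in lta; exact: ltight_change lta.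
- by apply: lam_le la; lia.
- exact: lam_catr.
Qed.

(** If the cancellation reaches [x.1], it removes only a short part [d]. The rest is still large, so
    the weight of the product splits around it, and left multiplication by [e d^-1] carries the
    relations of the class to the new place. *)
Lemma thin_next U s x f V (t : F) : reduces U s x f -> V \in gsupp (next s x f) -> thin t ->
  (wF (t * V)%g <= wF (t * U)%g)%N.
Proof.
move=> red /(next_supp (proj2 red)) [u [eV nu fu _]] th.
have [[tx nx ex mx] rf] := red; have eU := reduces_wd red.
have [q [b [rq lb ib iu]]] := meets_supp (let: And3 sf _ _ := rf in sf) fu.
have Mu : Mon Rel u by exists q => //; move: iu; rewrite /inp wdK.
have tx0 := proj1 tx; have Mx := tight_M tx0; have rx := tight_red tx0.
have lx : lam x.1 (C + 11) := thn_lam tx.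
have rt2 : reduced x.2 by have := rx => /reduced_catr/reduced_catr.
have wt2 : wF (wd x.2) = w x.2 by rewrite wF_wd.
have upper (l : seq L) g : reduced l -> Mon Rel g -> (wF (wd l * g * wd x.2)%g <= w l + D + w
  x.2)%N.
  move=> rl Mg; have h := wF_le (wd l) g (wd x.2); have := M_D Mg; have := cst_le (letters g).
  by rewrite wt2 wF_wd // in h; lia.
have [t0 [j [r0 [et eW r]]]] := reduced_cancel (letters_reduced t) rx.
have rj : reduced j by have := letters_reduced t; rewrite et => /reduced_catr.
have etU : (t * U)%g = wd (t0 ++ r0).
  by rewrite -(wd_cancel t0 r0 rj) -et -eW eU wd_cat wdK !wd_cat !mulgA.
rewrite etU wF_wd //.
have case2 d : winv j = s ++ d -> x.1 ++ x.2 = d ++ r0 -> (wF (t * V)%g <= w (t0 ++ r0))%N.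
  move=> ej e0.
  have ewt : winv (letters t) = s ++ d ++ winv t0 by rewrite et winv_cat ej catA.
  have [b0 [eb er]] : exists b0, x.1 = d ++ b0 /\ r0 = b0 ++ x.2.
    case: (cat_eqP e0) => [[m [ed _]]|[m [_ ex1 e2]]]; last by exists m.
    exfalso; have cx : cov x.1 9 by apply: (th s x.1 (m ++ winv t0)) => //; rewrite ewt ed -catA.
    by apply: (cov_lam cx _ lx); lia.
  have Md : M d by apply: (@M_catl _ b0); rewrite -eb.
  have cd : cov d 9 := th _ _ _ ewt Md.
  have lb0 : lam b0 (C + 2) by apply: (lam_cutl cd); rewrite -eb; apply: lam_le lx; lia.
  have lb02 : lam b0 2 by apply: lam_le lb0; lia.
  have Mb0 : M b0 by apply: (@M_catr d); rewrite -eb.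
  have [t1 [e [et0 Me he]]] := longest_suffix t0 Mb0.
  have te : tight t1 (e ++ b0) x.2.
    split=> //.
    - by move: r; rewrite et0 er -!catA.
    - by move=> l' z el; apply: (he z l' el).
    - move=> z z' ez Mz; case: tx0 => _ _ _ rtx; apply: (rtx z z' ez); rewrite eb.
      have Mdb : M (d ++ b0) by rewrite -eb.
      by have := @M_right z b0 d Mdb lb02; apply; apply: (@M_catr e); rewrite -rcons_cat.
  have wU : w (t0 ++ r0) = (w t1 + D + w x.2)%N.
    by rewrite et0 er -(w_eq te (thn_big tx eb cd te)) -!catA.
  have ej' : j = winv d ++ winv s by rewrite -[LHS]winvK ej winv_cat.
  have rd : reduced d := M_reduced Md.
  have rs : reduced s by move: rx => /reduced_catl.
  have et' : letters t = t1 ++ (e ++ winv d) ++ winv s by rewrite et et0 ej' -!catA.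
  have rch : reduced (e ++ winv d) by have := letters_reduced t; rewrite et' => /reduced_mid.
  set X0 := wd (e ++ winv d).
  have eX : X0 = (wd e * (wd d)^-1)%g by rewrite /X0 wd_cat wdV.
  (* The factor [e d^-1] cancels a part of [c] of measure at most 9, and what remains of [c] is no
     small piece. *)
  have key c q0 : M c -> lam c (C + 11) -> M (letters (X0 * wd c)%g) -> Rel q0 -> inp q0 c ->
      Rel (tr X0 q0 1%g).
    move=> Mc lc MXc rq0 ic.
    have [ch0 [i [c0 [ech ec r1]]]] := reduced_cancel rch (M_reduced Mc).
    have ri : reduced i by move: rch; rewrite ech => /reduced_catr.
    have ci : cov (winv i) 9.
      apply: (th s _ (winv ch0 ++ winv t1)); last by apply: (@M_catl _ c0); rewrite -ec.
      by rewrite et' 2!winv_cat winvK ech winv_cat -!catA.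
    have lc9 : lam (winv i ++ c0) (9 + 2) by rewrite -ec; apply: lam_le lc; exact: leq_addl.
    have lc0 : lam c0 2 := lam_cutl ci lc9.
    have eXc : letters (X0 * wd c)%g = ch0 ++ c0.
      by rewrite -(letters_wd r1) -(wd_cancel ch0 c0 ri) -ech -ec wd_cat.
    have Mc0 : M (ch0 ++ c0 ++ [::]) by rewrite cats0 -eXc.
    have rc0 : reduced (winv i ++ c0 ++ [::]) by rewrite cats0 -ec; exact: M_reduced Mc.
    have ic0 : inp q0 (winv i ++ c0 ++ [::]) by rewrite cats0 -ec.
    have [h _] := @piece_lr q0 c0 (winv i) [::] ch0 [::] lc0 rq0 rc0 ic0 Mc0.
    by rewrite /X0 ech wd_cat -[wd i]invgK -wdV.
  have [Mb2 lb2] : M (letters (X0 * wd b)%g) /\ thn s (b, x.2).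
    have [n h] := lb; have := erefl x.1; elim: {1}x.1 b / h {lb ib} =>
      [c ec|n0 c c1 c2 _ IH [q0 [rq0 [i1 i2] h1 h2]] ec].
      split; last by rewrite ec -surjective_pairing.
      have -> : (X0 * wd c)%g = wd (e ++ b0) by rewrite eX ec eb !wd_cat -mulgA mulKg.
      by rewrite letters_wd //; exact: M_reduced Me.
    have [Mc1 _] := IH ec; split=> //.
    have r1 := key c1 q0 (tight_M (proj1 h1)) (thn_lam h1) Mc1 rq0 i1.
    apply: (MI r1); last exact: letters_reduced.
    by apply: (inp_tr _ i2); rewrite mulg1 wdK.
  have rX := key b q (tight_M (proj1 lb2)) (thn_lam lb2) Mb2 rq ib.
  have MXu : Mon Rel (X0 * u)%g.
    by exists (tr X0 q 1%g) => //; move: iu; rewrite /inp wdK gsupp_tr invg1 mulg1 mulKg.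
  have -> : (t * V)%g = (wd t1 * (X0 * u) * wd x.2)%g.
    by rewrite eV -(wdK t) et' eX !wd_cat !wdV // !mulgA mulgVK.
  by rewrite wU; apply: upper => //; move: (tight_red te) => /reduced_catl.
case: (cat_eqP eW) => [[d [ej e0]]|[s1 [s1n es er]]]; first exact: case2 ej e0.
have rts : reduced (t0 ++ s1) by move: r; rewrite er catA => /reduced_catl.
have tt : tight (t0 ++ s1) x.1 x.2.
  have [_ _ ltx rtx] := tx0; split=> //; first by move: r; rewrite er -!catA.
  by rewrite es in ltx; exact: ltight_change ltx.
have -> : w (t0 ++ r0) = (w (t0 ++ s1) + D + w x.2)%N.
  by rewrite er -(w_eq tt) -?catA //; left; apply: lam_le lx; lia.
have -> : (t * V)%g = (wd (t0 ++ s1) * u * wd x.2)%g; last exact: upper.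
rewrite eV es -(wdK t) et !wd_cat wdV //.
by rewrite !mulgA mulgK.
Qed.

Lemma lext_supp (ph : F -> kF) f V : V \in gsupp (lext ph f) ->
  exists2 U, U \in gsupp f & V \in gsupp (ph U).
Proof.
move=> h; apply: contrapT => no; move: h; rewrite gsuppE /lext raddf_sum /= big1_seq ?eqxx // =>
  U /andP [_ Uf].
rewrite mcoeffZ; apply/eqP; rewrite mulf_eq0; apply/orP; right.
by rewrite -[_ == _]negbK -gsuppE; apply/negP => VU; apply: no; exists U.
Qed.

Lemma phi_weight U V (t : F) : thin t -> V \in gsupp (phi U) -> (wF (t * V)%g <= wF (t * U)%g)%N.
Proof.
move=> th; elim/(well_founded_ind ltF_wf): U V => U IH V.
have [/phi_irr ->|[s [x [f red]]]] := reducesP U.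
  by rewrite gsuppE mcoeff_gmon; have [->|_] := eqVneq U V; rewrite ?eqxx.
rewrite (phi_red red) => /lext_supp [U' U'n VU'].
exact: leq_trans (IH _ (next_lt red U'n) _ VU') (thin_next red U'n th).
Qed.

Lemma Phi_weight f V : V \in gsupp (Phi f) ->
  exists2 U, U \in gsupp f & forall t : F, thin t -> (wF (t * V)%g <= wF (t * U)%g)%N.
Proof.
by move=> /lext_supp [U Uf VU]; exists U => // t th; apply: phi_weight.
Qed.

(** * The normal form modulo the ideal *)

Lemma ideal_tr g h p : ideal_gen Rel p -> ideal_gen Rel (tr g p h).
Proof.
move=> Ip; have [_ _ IM IM'] := ideal_gen_ideal Rel.
by rewrite tr.unlock; apply: IM'; apply: IM.
Qed.

Lemma ideal_is_subspace : is_subspace (ideal_gen Rel : set kF).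
Proof.
have [I0 IB IM _] := ideal_gen_ideal Rel; split=> // c u v Iu Iv.
have -> : c *: u + v = (c%:A * u : kF) - (0 - v) by rewrite mulr_algl opprB subr0.
by apply: (IB); [exact: (IM)|apply: (IB)].
Qed.

Lemma ideal_sub f : linear_span Rel f -> ideal_gen Rel f.
Proof. by apply: (span_min ideal_is_subspace) => p rp I [_]; apply. Qed.

Lemma Phi_mod f : ideal_gen Rel (Phi f - f).
Proof.
have [I0 IZ] := ideal_is_subspace.
have ID (u v : kF) : ideal_gen Rel u -> ideal_gen Rel v -> ideal_gen Rel (u + v).
  by move=> Iu Iv; rewrite -[u]scale1r; apply: IZ.
have key U : ideal_gen Rel (phi U - gmon k U).
  elim/(well_founded_ind ltF_wf): U => U IH.
  have [/phi_irr ->|[s [x [h red]]]] := reducesP U; first by rewrite subrr.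
  have en : next s x h = gmon k U - tr (wd s) h (wd x.2).
    by rewrite /next trD trN tr_gmon -(reduces_wd red).
  have Ir : ideal_gen Rel (tr (wd s) h (wd x.2)).
    apply: ideal_tr; apply: ideal_sub; have [_ [sf _ _]] := red.
    by apply: (span_min (span_subspace _)) sf => q [/span_gen].
  rewrite (phi_red red) -[X in X - _](subrK (next s x h)) -addrA; apply: ID; last first.
    rewrite en addrAC subrr sub0r -scaleN1r -[_ *: _]addr0; exact: IZ.
  rewrite {2}(gmon_sum (next s x h)) /lext -sumrB.
  apply: (subspace_sum ideal_is_subspace) => V Vn.
  rewrite -scalerBr -[_ *: _]addr0; apply: IZ => //; exact: IH (next_lt red Vn).
rewrite {2}(gmon_sum f) /lext -sumrB; apply: (subspace_sum ideal_is_subspace) => V _.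
rewrite -scalerBr -[_ *: _]addr0; exact: IZ.
Qed.

(** Vanishing is required of all translates, which makes [J] an ideal; it contains [Rel] by
    [phi_rel]. *)
Lemma Phi_ideal f : ideal_gen Rel f -> Phi f = 0.
Proof.
pose J := [set f : kF | forall g h, Phi (tr g f h) = 0].
have J0 : J 0 by move=> g h; rewrite tr0 lext0.
have sJ : is_subspace J.
  by split=> [|c u v Ju Jv g h]; [exact: J0|rewrite trD trZ lextD lextZ Ju Jv scaler0 addr0].
have JZ (c : k) (u : kF) : J u -> J (c *: u) by move=> Ju g h; rewrite trZ lextZ Ju scaler0.
have Jtr (u : kF) g h : J u -> J (tr g u h) by move=> Ju g' h'; rewrite tr_tr Ju.
have idJ : is_ideal J.
  split; first exact: J0.
  - move=> u v Ju Jv; have -> : u - v = (-1) *: v + u by rewrite scaleN1r addrC.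
    exact: sJ.2.
  - move=> a u Ju; rewrite (gmon_sum a) mulr_suml; apply: (subspace_sum sJ) => g _.
    by rewrite -scalerAl; apply: JZ; rewrite trE1; apply: Jtr.
  - move=> a u Ju; rewrite (gmon_sum a) mulr_sumr; apply: (subspace_sum sJ) => g _.
    by rewrite -scalerAr; apply: JZ; rewrite trE2; apply: Jtr.
move=> If; have Jf : J f by apply: If; split; [exact: idJ|move=> p rp g h; exact: phi_rel].
by have := Jf 1%g 1%g; rewrite tr11.
Qed.

End NormalForm.

(** * Marker words *)

Section MarkerWords.
Implicit Types (x y : L) (s t a b c e r z : seq L).

Definition pre s n : Prop := forall c r, s = c ++ r -> M c -> cov c n.
Definition short_in s : Prop := forall a c b, s = a ++ c ++ b -> M c -> cov c 9.

Lemma pre_le s m n : (m <= n)%N -> pre s m -> pre s n.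
Proof. by move=> le h c r e Mc; apply: cov_pad le (h c r e Mc). Qed.

Lemma pre_cat s t m n : pre s m -> pre t n -> pre (s ++ t) (m + n).
Proof.
move=> hs ht c r e Mc; case: (cat_eqP e) => [[d [ec et]]|[d [_ es _]]].
  rewrite ec; apply: cov_cat; first by apply: (hs s [::]); rewrite ?cats0 //;
    apply: (@M_catl _ d); rewrite -ec.
  by apply: (ht d r et); apply: (@M_catr s); rewrite -ec.
by apply: cov_pad (leq_addr n m) (hs c d es Mc).
Qed.

Lemma pre_size s : pre s (size s).
Proof.
move=> c r e Mc; apply: cov_pad (M_cov Mc).
by rewrite e size_cat leq_addr.
Qed.

Lemma short_in_cat s t : short_in t -> (forall a b, s = a ++ b -> pre (b ++ t) 9) ->
  short_in (s ++ t).
Proof.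
move=> ht hs a c b e Mc; case: (cat_eqP e) => [[d [_ et]]|[d [_ es ec]]].
  exact: (ht d c b).
exact: (hs a d es c b).
Qed.

Section Alternation.
Variables (v : seq L) (g h : L).
Hypotheses (vn : v <> [::]) (rv : reduced v) (nMv : ~ M v).
Hypothesis (minv : forall a b, v = a ++ b -> a <> [::] -> b <> [::] -> M a /\ M b).
Hypothesis (hg : forall s l, v = rcons s l -> g.1 <> l.1) (hh : forall l s, v = l :: s -> h.1 <>
  l.1).
Local Notation W := (winv v).

(** Write [v = y1 c y2] with letters [y1] and [y2]. Both [y1 c] and [c y2] lie in [Mon] while [v]
    does not, so nothing can be glued along [c] and [c] is a small piece. A proper prefix or suffix
    is then covered by a letter and a small piece. *)
Lemma minv_cov a b : v = a ++ b -> (b <> [::] -> cov a 2) /\ (a <> [::] -> cov b 2).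
Proof.
case: v vn minv nMv => // y1 v1 _ mn nM.
case/lastP: v1 mn nM => [|c y2] mn nM e.
  case: a e => [|x a] e; first by split=> // _; apply: cov0.
  case: e => _ e2; case: a b e2 => [|? ?] [|? ?] // _; split=> // _; exact: cov0.
have e1 : y1 :: rcons c y2 = (y1 :: c) ++ [:: y2] by rewrite cats1.
have n1 : y1 :: c <> [::] by [].
have n2 : [:: y2] <> [::] by [].
have n3 : rcons c y2 <> [::] by case: (c).
have [M1 M2] := mn _ _ e1 n1 n2.
have n4 : [:: y1] <> [::] by [].
have [M0 M3] := mn [:: y1] (rcons c y2) erefl n4 n3.
have cc : cov c 1.
  have [//|l2] := cov_or_lam c 1; exfalso; apply: nM.
  by rewrite -cats1 -cat1s; apply: M_glue => //; rewrite cats1.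
have s1 : cov [:: y1] 1 by apply/cov_Sp/Sp_letter; apply: (@M_catl _ c).
have s2 : cov [:: y2] 1 by apply/cov_Sp/Sp_letter.
have c1 : cov (y1 :: c) 2 by rewrite -cat1s -[2]/(1 + 1)%N; apply: cov_cat.
have c2 : cov (rcons c y2) 2 by rewrite -cats1 -[2]/(1 + 1)%N; apply: cov_cat.
split.
  case/lastP: b e => [|b z] e // _; apply: (@cov_catl _ b); move: e.
  by rewrite -rcons_cat -rcons_cons => /rcons_inj [<- _].
by case: a e => [|x a] e // _; apply: (@cov_catr a); case: e => _ <-.
Qed.

(** A proper subword of [v^-1] in [Mon] is the inverse of a proper subword of [v] and has measure at
    most 2. The whole [v^-1] may lie in [Mon] and needs one letter more. *)
Lemma covW a c b : W = a ++ c ++ b -> M c -> cov c 3.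
Proof.
move=> e Mc; have ev : v = winv b ++ winv c ++ winv a by rewrite -[LHS]winvK e !winv_cat catA.
have [->|/eqP cn] := eqVneq c [::]; first exact: cov0.
have wcn : winv c <> [::] by move/winv_nil.
have fin : M (winv c) -> cov (winv c) 2 -> cov c 3.
  by move=> Mw cw; apply: (@cov_pad _ 2) => //; rewrite -[c]winvK; apply: cov_winv; rewrite ?winvK.
have [a0|/eqP an] := eqVneq (winv a) [::]; last first.
  have e1 : v = (winv b ++ winv c) ++ winv a by rewrite -catA.
  have [|Mbc _] := minv e1 _ an; first by case: (winv b).
  apply: fin; first exact: M_catr Mbc.
  by apply: (@cov_catr (winv b)); apply: (proj1 (minv_cov e1)).
have [b0|/eqP bn] := eqVneq (winv b) [::]; last first.
  have [|_ Mca] := minv ev bn; first by case: (winv c) wcn.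
  apply: fin; first exact: M_catl Mca.
  by apply: (@cov_catl _ (winv a)); apply: (proj2 (minv_cov ev)).
rewrite b0 a0 cats0 /= in ev; case ewc: (winv c) wcn => [|y1 z] // _; rewrite ewc in ev.
have ec : c = winv z ++ [:: linv y1] by rewrite -[LHS]winvK ewc /winv /= rev_cons cats1.
have n1 : [:: y1] <> [::] by [].
have cz := proj2 (@minv_cov [:: y1] z ev) n1.
rewrite ec -[3%N]/(2 + 1)%N; rewrite ec in Mc; apply: cov_cat.
  have [->|/eqP zn] := eqVneq z [::]; first exact: cov0.
  have [_ Mz] := @minv [:: y1] z ev n1 zn.
  by apply: cov_winv => //; exact: M_catl Mc.
by apply/cov_Sp/Sp_letter; exact: M_catr Mc.
Qed.

Lemma pre_v t : pre (v ++ t) 2.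
Proof.
move=> c r e Mc; case: (cat_eqP e) => [[d [ec _]]|[d [dn ev _]]].
  by exfalso; apply: nMv; apply: (@M_catl _ d); rewrite -ec.
exact: (proj1 (minv_cov ev)).
Qed.

Lemma pre_v' a b t : v = a ++ b -> a <> [::] -> pre b 2.
Proof. by move=> ev an c r e _; apply: (@cov_catl _ r); rewrite -e;
  apply: (proj2 (minv_cov ev)). Qed.

Lemma pre_W a b : W = a ++ b -> pre b 3.
Proof. by move=> eW c r e Mc; apply: (@covW a c r) => //; rewrite eW e. Qed.

Definition blk (o : bool) : seq L := if o then v else W.

Lemma blk_neq0 o : blk o <> [::].
Proof. by case: o => //= /winv_nil. Qed.

(* Words in which [v] and its inverse alternate, separated by single letters. *)
Inductive alt : bool -> seq L -> Prop :=
| alt_end o q : (size q <= 2)%N -> reduced (blk o ++ q) -> alt o (blk o ++ q)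
| alt_cons o x (z : seq L) : reduced (rcons (blk o) x) -> reduced (x :: blk (~~ o)) ->
  alt (~~ o) z ->
    alt o (blk o ++ x :: z).

Lemma alt_head o (z : seq L) : alt o z -> exists z', z = blk o ++ z'.
Proof. by case=> [o' q _ _|o' x z' _ _ _]; [exists q|exists (x :: z')]. Qed.

Lemma alt_reduced o (z : seq L) : alt o z -> reduced z.
Proof.
elim=> // o' x z' r1 r2 /alt_head [z2 ->] r3; apply: reduced_glue => //.
by rewrite -cat1s; apply: reduced_cat3 => //; apply: blk_neq0.
Qed.

Lemma alt_pre o (z : seq L) : alt o z -> pre z (if o then 2 else 6).
Proof.
case=> [[] q sq _|[] x z' _ _ /alt_head [z2 ->]] /=.
- exact: pre_v.
- apply: (@pre_le _ (3 + 2)) => //; apply: pre_cat; first exact: (@pre_W [::]).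
  by apply: pre_le sq (@pre_size q).
- exact: pre_v.
- apply: (@pre_cat _ _ 3 3); first exact: (@pre_W [::]).
  rewrite -cat1s; apply: (@pre_cat _ _ 1 2); [exact: (@pre_size [:: x])|exact: pre_v].
Qed.

(** No element of [Mon] contains [v], so one inside such a word extends at most from a suffix of [v]
    through a letter, [v^-1] and another letter into a prefix of [v]: 2 + 1 + 3 + 1 + 2 = 9. *)
Lemma alt_short_in o (z : seq L) : alt o z -> short_in z.
Proof.
have key (o' : bool) a b r : blk o' = a ++ b -> pre r 7 -> (o' = false -> pre r 6) ->
  pre (b ++ r) 9.
  case: o' => /= e r7 r6.
    have [a0|/eqP an] := eqVneq a [::]; last by apply: (@pre_cat _ _ 2 7) => //; exact: pre_v' e an.
    by apply: (@pre_le _ 2) => //; move: e; rewrite a0 /= => <-; exact: pre_v.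
  by apply: (@pre_cat _ _ 3 6); [exact: pre_W e|exact: r6].
elim=> [o' q sq _|o' x z' r1 r2 az IH].
  apply: short_in_cat => [|a b e].
    by move=> a c b e Mc; apply: cov_pad (M_cov Mc); move: sq; rewrite e !size_cat; lia.
  by apply: key e _ _ => [|_]; apply: pre_le (@pre_size q); lia.
have hz := alt_pre az; apply: short_in_cat => [|a b e].
  rewrite -cat1s; apply: short_in_cat => // a b e; apply: (@pre_le _ (1 + 6)) => //; apply: pre_cat.
    apply: pre_le (@pre_size b); have := congr1 size e; rewrite size_cat /=; lia.
  by apply: pre_le hz; case: (~~ o').
apply: key e _ _ => [|o'f].
  rewrite -cat1s; apply: (@pre_cat _ _ 1 6); first exact: (@pre_size [:: x]).
  by apply: pre_le hz; case: (~~ o').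
rewrite o'f in hz; rewrite -cat1s; apply: (@pre_le _ (1 + 2)) => //.
by apply: (@pre_cat _ _ 1 2) => //; exact: (@pre_size [:: x]).
Qed.

(** A word built from [v] without its inverse would have an inverse without [v], which could lie in
    [Mon]. Alternation makes [Tm n] and its inverse [Sm n] words of the same kind. *)
Definition Tm n : seq L := iter n (fun z => v ++ g :: W ++ h :: z) v.
Definition Sm n : seq L := iter n (fun z => W ++ linv h :: v ++ linv g :: z) W.

Lemma SmS n : Sm n.+1 = Sm n ++ linv h :: v ++ linv g :: W.
Proof.
elim: n => // n IH; transitivity (W ++ linv h :: v ++ linv g :: Sm n.+1) => //.
by rewrite {1}IH /= -!catA /= -!catA.
Qed.

Lemma winv_Tm n : winv (Tm n) = Sm n.
Proof.
elim: n => [//|n IH]; rewrite SmS -IH [Tm n.+1]/= -(cat1s g) -(cat1s h) !winv_cat winvK.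
by rewrite -!catA.
Qed.

Lemma TmD n j : exists r, Tm (n + j) = Tm n ++ r.
Proof.
elim: n => [|n [r e]]; last by exists r; rewrite addSn /= e -!catA /= -!catA.
by case: j => [|j] /=; [exists [::]; rewrite cats0|exists (g :: W ++ h :: Tm j)].
Qed.

Lemma reduced_neq x y : x.1 <> y.1 -> reduced [:: x; y].
Proof. by move=> n; rewrite /reduced /= andbT; apply/eqP => e; apply: n; rewrite e. Qed.

Lemma red_g x : x.1 = g.1 -> reduced (rcons v x) /\ reduced (x :: W).
Proof.
move=> ex; case/lastP: v vn rv hg => // v' l _ rv' hg'.
have n := hg' _ _ erefl; split.
  by rewrite -cats1 cat_rcons; apply: reduced_glue => //; apply: reduced_neq; rewrite ex => e;
    apply: n.
have -> : winv (rcons v' l) = linv l :: winv v' by rewrite -cats1 winv_cat.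
have := winv_reduced rv'; rewrite -cats1 winv_cat => r.
by apply: (@reduced_glue _ [:: x]) => //; apply: reduced_neq; rewrite ex.
Qed.

Lemma red_h x : x.1 = h.1 -> reduced (x :: v) /\ reduced (rcons W x).
Proof.
move=> ex; case: v vn rv hh => // l v' _ rv' hh'.
have n := hh' _ _ erefl; split.
  by apply: (@reduced_glue _ [:: x]) => //; apply: reduced_neq; rewrite ex.
have -> : winv (l :: v') = rcons (winv v') (linv l) by rewrite -cats1 -cat1s winv_cat.
have := winv_reduced rv'; rewrite -cat1s winv_cat => r.
by rewrite -cats1 cat_rcons; apply: reduced_glue => //; rewrite -?cats1 //; apply: reduced_neq;
  rewrite ex => e; apply: n.
Qed.

Lemma alt_Sm n q : (size q <= 2)%N -> reduced (W ++ q) -> alt false (Sm n ++ q).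
Proof.
move=> sq rq; elim: n => [|n IH]; first exact: (@alt_end false).
rewrite /= -!catA /= -!catA /=; apply: (@alt_cons false).
- by case: (@red_h (linv h)).
- by case: (@red_h (linv h)).
by apply: (@alt_cons true) => //=; case: (@red_g (linv g)).
Qed.

Lemma alt_Tm n x z : x.1 = g.1 -> alt false z -> alt true (Tm n ++ x :: z).
Proof.
move=> ex az; elim: n => [|n IH]; first by apply: (@alt_cons true) => //=; case: (red_g ex).
rewrite /= -!catA /= -!catA /=; apply: (@alt_cons true).
- by case: (@red_g g).
- by case: (@red_g g).
by apply: (@alt_cons false) => //=; case: (@red_h h).
Qed.

Lemma alt_Tm0 n : alt true (Tm n).
Proof.
elim: n => [|n IH]; first by rewrite -[Tm 0]cats0; apply: (@alt_end true) => //; rewrite cats0.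
apply: (@alt_cons true).
- by case: (@red_g g).
- by case: (@red_g g).
by apply: (@alt_cons false) => //=; case: (@red_h h).
Qed.

(** No interval in [Mon] contains [v], so a partition spends something before the interval that
    reaches [z]. This makes the weights of the words [Tm n] unbounded. *)
Lemma w_v a z : (w z < w (a ++ v ++ z))%N.
Proof.
rewrite catA; have := pt_w ((a ++ v) ++ z); case/pt_split.
  move=> [n1 [n2 [h1 h2 ->]]]; have := w_min h1; have := w_min h2.
  have : (0 < w (a ++ v))%N by apply: w_gt0; case: (a) => //=; exact: vn.
  lia.
move=> [s0 [m1 [m2 [t0 [n1 [n2 [[e1 e2 m1n m2n] [Mm h1 h2 ->]]]]]]]].
have s0n : s0 <> [::].
  move=> s00; subst s0; rewrite /= in e1; apply: nMv.
  by apply: (@M_catl _ m2); apply: (@M_catr a); rewrite catA e1.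
have := w_gt0 s0n; have := w_min h1; have := w_min h2; rewrite e2.
have := w_cat m2 t0; have := w_Mcst (M_catr Mm).
have := mn_mid m1 m2 [::]; rewrite cats0 /cst; lia.
Qed.

Lemma w_Tm n : (n <= w (Tm n))%N.
Proof.
elim: n => // n IH; have := @w_v [::] (g :: W ++ h :: Tm n); rewrite /=.
by have := @w_catr (g :: W ++ [:: h]) (Tm n); rewrite -cat1s -!catA /=; lia.
Qed.

(* A word [U] that does not begin with [Z] is mapped by [Y g Z^-1] to a word of larger
   weight that begins with [Y]; the margins [D] make the heaviest words of the normal
   form of the product begin with [y] too. *)
Definition marker y (A Z Y : seq L) : Prop :=
  [/\ reduced (Y ++ g :: winv Z), (exists A', A = y :: A') /\ (exists Z', Z = y :: Z'),
    (exists Y', Y = A ++ Y') &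
    [/\ (D < w A)%N, (w A + D <= w Z)%N, (w Z + D < w Y)%N,
        thin (wd (Y ++ g :: winv Z)) & thin (wd A)^-1%g]].

Lemma marker_ex y : y <> linv h -> exists A Z Y, marker y A Z Y.
Proof.
move=> ny; pose T n := y :: h :: Tm n.
have wT n : (n <= w (T n))%N.
  by apply: leq_trans (w_Tm n) _; exact: (@w_catr [:: y; h]).
(* By [w_Tm] the gaps between the three weights can be prescribed. The sum defining [m2] begins with
   [D.+1] so that [TmD] shows [A] to be a prefix of [Y]. *)
pose m1 := (w (T D.+1) + D)%N; pose m2 := (D.+1 + (w (T m1) + D).+1)%N.
have rW : reduced (W ++ [:: linv h; linv y]).
  case: (@red_h (linv h)) => // _ r; apply: reduced_glue => //.
  by rewrite /reduced /= andbT linvK; apply/eqP => e; apply: ny; rewrite -e linvK.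
have ryh z : reduced (h :: z) -> reduced (y :: h :: z).
  move=> r; apply: (@reduced_glue _ [:: y]) => //.
  by rewrite /reduced /= andbT; apply/eqP => e; apply: ny; rewrite e linvK.
have rT z : alt true z -> reduced (y :: h :: z).
  move=> az; apply: ryh; have r := alt_reduced az; have [z2 ez] := alt_head az; rewrite ez in r *.
  by rewrite -cat1s; apply: reduced_cat3 => //; case: (@red_h h).
have iT z : alt true z -> short_in (y :: h :: z).
  move=> az; apply: (@short_in_cat [:: y; h]); first exact: alt_short_in az.
  move=> a b e; apply: (@pre_le _ (2 + 2)) => //; apply: pre_cat; last exact: alt_pre az.
  by apply: pre_le (@pre_size b); have := congr1 size e; rewrite size_cat /=; lia.
have aS n n' x : x.1 = g.1 -> alt true (Tm n ++ x :: Sm n' ++ [:: linv h; linv y]).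
  by move=> ex; apply: alt_Tm => //; apply: alt_Sm.
have eS n : winv (T n) = Sm n ++ [:: linv h; linv y].
  by rewrite /T -(cat1s y) -(cat1s h) !winv_cat winv_Tm -catA.
have rTn n : reduced (T n) by apply: rT; exact: alt_Tm0.
have rs : reduced (T m2 ++ g :: winv (T m1)) by rewrite eS; apply: (@rT (Tm m2 ++ _)); exact: aS.
exists (T D.+1), (T m1), (T m2); split=> //.
- by split; eexists.
- by have [r e] := TmD D.+1 (w (T m1) + D).+1; exists r; rewrite /T e.
split.
- exact: wT.
- exact: wT.
- by apply: leq_trans (wT m2); rewrite /m2; lia.
- rewrite /thin letters_wd //; have -> : winv (T m2 ++ g :: winv (T m1)) = T m1 ++ linv g :: winv
  (T m2).
    by rewrite -(cat1s g) !winv_cat winvK -catA.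
  by rewrite eS; apply: (@iT (Tm m1 ++ _)); exact: aS.
- rewrite /thin -wdV // letters_wd ?winv_reduced // winvK.
  by apply: iT; exact: alt_Tm0.
Qed.

End Alternation.

Lemma not_prefix z t : ~~ prefix z t ->
  exists a x b t', [/\ z = a ++ x :: b, t = a ++ t' & forall r, t' <> x :: r].
Proof.
elim: z t => [|x z IH] t; first by rewrite prefix0s.
case: t => [|y t] h; first by exists [::], x, z, [::].
have [exy|/eqP nxy] := eqVneq x y; last by exists [::], x, z, (y :: t); split=> // r [e _];
  apply: nxy.
move: h; rewrite prefix_cons exy eqxx /= => /IH [a [x' [b [t' [-> -> h]]]]].
by exists (y :: a), x', b, t'.
Qed.

Lemma reduced_head a x t : reduced (rcons a x) -> reduced t -> (forall r, t <> linv x :: r) ->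
  reduced (rcons a x ++ t).
Proof.
case: t => [|y t] ra rt h; first by rewrite cats0.
apply: reduced_glue => //; rewrite -cats1 cat_rcons; apply: reduced_glue => //.
by rewrite /reduced /= andbT; apply/eqP => e; apply: (h t); rewrite e.
Qed.

(** Less than all of [Z] cancels, so [Y g] stays intact, and [Y] outweighs by more than [D] what was
    lost with the prefix of [Z]. *)
Lemma marker_away g y A Z Y (U : F) : marker g y A Z Y -> ~~ prefix Z (letters U) ->
  (wF U < wF (wd (Y ++ g :: winv Z) * U)%g)%N /\
  exists r, letters (wd (Y ++ g :: winv Z) * U)%g = Y ++ r.
Proof.
move=> [rd _ _ [_ _ wY _ _]] /not_prefix [a [x [b [t' [eZ eU h]]]]].
have rU := letters_reduced U; rewrite eU in rU.
have ra : reduced a := reduced_catl rU.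
have e1 : Y ++ g :: winv Z = rcons (Y ++ g :: winv b) (linv x) ++ winv a.
  by rewrite eZ winv_cat -(cat1s x) winv_cat -cats1 -!catA.
have r1 : reduced (rcons (Y ++ g :: winv b) (linv x)) by move: rd; rewrite e1 => /reduced_catl.
have r2 : reduced (rcons (Y ++ g :: winv b) (linv x) ++ t').
  by apply: reduced_head => //; [exact: reduced_catr rU|move=> r; rewrite linvK; apply: h].
have e2 : letters (wd (Y ++ g :: winv Z) * U)%g = Y ++ (rcons (g :: winv b) (linv x) ++ t').
  rewrite -[RHS]letters_wd; last by rewrite catA -rcons_cat.
  congr letters; rewrite e1 -{1}(wdK U) eU (wd_cat _ (winv a)) (wd_cat a) wdV //.
  by rewrite mulgA mulgVK -wd_cat rcons_cat -catA.
split; last by eexists; exact: e2.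
rewrite /wF e2 eU.
have := w_super Y (rcons (g :: winv b) (linv x) ++ t').
have := w_catr (rcons (g :: winv b) (linv x)) t'; have := w_cat a t'.
have := w_catl a (x :: b); rewrite -eZ; lia.
Qed.

(** If [U] begins with [Z], the cancellation may reach [Y]. Were it to reach into [A], the gap [D]
    between the weights of [A] and [Z] would contradict the assumed increase. *)
Lemma marker_begin g y A Z Y (U : F) : marker g y A Z Y ->
  (wF U < wF (wd (Y ++ g :: winv Z) * U)%g)%N ->
  exists r, letters (wd (Y ++ g :: winv Z) * U)%g = A ++ r.
Proof.
move=> mk lt; have [rd _ [Y' eY] [_ wZ _ _ _]] := mk.
have [pr|np] := boolP (prefix Z (letters U)); last first.
  by have [_ [r ->]] := marker_away mk np; exists (Y' ++ r); rewrite eY catA.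
have [t eU] : exists t : seq L, letters U = Z ++ t by case/prefixP: pr => t e; exists t.
have rU := letters_reduced U; rewrite eU in rU.
have rZ : reduced Z := reduced_catl rU.
have rYg : reduced (Y ++ [:: g]) by move: rd; rewrite -cat1s catA => /reduced_catl.
have [a [c [b [eYg et r1]]]] := reduced_cancel rYg (reduced_catr rU).
have rc : reduced c by move: rYg; rewrite eYg => /reduced_catr.
have e2 : letters (wd (Y ++ g :: winv Z) * U)%g = a ++ b.
  rewrite -[RHS]letters_wd //; congr letters; rewrite -(wd_cancel a b rc) -eYg -et.
  by rewrite -{1}(wdK U) eU -(cat1s g) !wd_cat wdV // -!mulgA mulKg.
rewrite e2; rewrite eY -catA in eYg; case: (cat_eqP (esym eYg)) => [[m [eA _]]|[m [_ ea _]]];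
  last first.
  by exists (m ++ b); rewrite ea catA.
exfalso; move: lt; rewrite /wF e2 eU et; apply/negP; rewrite -leqNgt.
have := w_super Z (winv c ++ b); have := w_catr (winv c) b; have := w_cat a b.
have := w_catl a m; rewrite -eA; lia.
Qed.

(** If [V] did not begin with [y], nothing would cancel in [A^-1 V], which would be at least as
    heavy as [V]. But dividing the product by [A] lowers its weight, since [w A] exceeds [D]. *)
Lemma marker_head g y A Z Y (U V : F) : marker g y A Z Y ->
  (wF U < wF (wd (Y ++ g :: winv Z) * U)%g)%N -> wF V = wF (wd (Y ++ g :: winv Z) * U)%g ->
  (wF ((wd A)^-1 * V)%g <= wF ((wd A)^-1 * (wd (Y ++ g :: winv Z) * U))%g)%N ->
  exists r, letters V = y :: r.
Proof.
move=> mk lt eV le; have [r eU] := marker_begin mk lt; have [rd [[A' eA] _] [Y' eY] [wA _ _ _ _]]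
  := mk.
apply: contrapT => nh; move: le; apply/negP; rewrite -ltnNge.
have rAr : reduced (A ++ r) by rewrite -eU; exact: letters_reduced.
have rA : reduced A := reduced_catl rAr.
have -> : ((wd A)^-1 * (wd (Y ++ g :: winv Z) * U))%g = wd r.
  by rewrite -[X in (_ * X)%g]wdK eU wd_cat mulKg.
have -> : ((wd A)^-1 * V)%g = wd (winv A ++ letters V) by rewrite wd_cat wdV // wdK.
have rAV : reduced (winv A ++ letters V).
  have := winv_reduced rA; rewrite eA -cat1s winv_cat [winv [:: y]]/= cats1 => r1.
  apply: reduced_head r1 (letters_reduced V) _ => r'; rewrite linvK => e; apply: nh; by exists r'.
rewrite !wF_wd //; last exact: reduced_catr rAr.
have := w_catr (winv A) (letters V); have := w_super A r; move: eV; rewrite /wF eU; lia.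
Qed.

Lemma minimal_word : (exists u : F, u <> 1%g /\ ~ Mon Rel u) ->
  exists v : seq L, [/\ v <> [::], reduced v, ~ M v &
    forall a b, v = a ++ b -> a <> [::] -> b <> [::] -> M a /\ M b].
Proof.
move=> [u [un nu]].
have : exists v : seq L, [/\ v <> [::], reduced v & ~ M v].
  exists (letters u); split; [|exact: letters_reduced|by move=> [_]; rewrite wdK].
  by move=> e; apply: un; rewrite -(wdK u) e wd0.
move=> [v]; move: {2}(size v).+1 (ltnSn (size v)) => n; elim: n v => // n IH v lt [vn rv nM].
have [[v' [lt' bad]]|no] := EM (exists v' : seq L, (size v' < size v)%N /\ [/\ v' <> [::],
  reduced v' & ~ M v']).
  by apply: (IH v' _ bad); lia.
exists v; split=> // a b e an bn; rewrite e in rv; split; apply: contrapT => nMa; apply: no.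
  exists a; split; last by split=> //; exact: reduced_catl rv.
  by rewrite e size_cat -[X in (X < _)%N]addn0 ltn_add2l; case: (b) bn.
exists b; split; last by split=> //; exact: reduced_catr rv.
by rewrite e size_cat -[X in (X < _)%N]add0n ltn_add2r; case: (a) an.
Qed.

Lemma other_generator : ~ cyclic_group F -> forall x0 : X, exists x1 : X, x1 <> x0.
Proof.
move=> nc x0; apply: contrapT => no; apply: nc.
have all_x (x : X) : x = x0 by apply: contrapT => nx; apply: no; exists x.
pose a : F := wd [:: (x0, false)].
have wx (x : L) : wd [:: x] = a \/ wd [:: x] = a^-1%g.
  case: x => x [] ; rewrite (all_x x); [right|by left].
  by rewrite /a -wdV.
exists a => u; rewrite -(wdK u); elim: (letters u) => [|x s [n IH]].
  by exists 0%N; left; rewrite wd0 expg0.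
rewrite wd_cons; case: (wx x) => ->; case: IH => ->.
- by exists n.+1; left; rewrite expgS.
- case: n => [|n]; first by exists 1%N; left; rewrite expg0 invg1 mulg1 expg1.
  by exists n; right; rewrite expgSr invgM mulgA mulgV mul1g.
- case: n => [|n]; first by exists 1%N; right; rewrite expg0 mulg1 expg1.
  by exists n; left; rewrite expgS mulKg.
- by exists n.+1; right; rewrite expgSr invgM.
Qed.

End MarkerWords.

(** * Linear independence of the products *)

Local Notation Phi := (lext phi).
Local Notation Q := (quotient_space Rel).
Local Notation pi := (@quot_proj k kF Rel).

Section Amenability.
Local Open Scope ring_scope.
Local Open Scope classical_set_scope.
Implicit Types (p q f : kF) (U V : F).

Lemma piD f f' : pi (f + f') = pi f + pi f'.
Proof. exact: quot_projD. Qed.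

Lemma piZ (c : k) f : pi (c *: f) = c *: pi f.
Proof. by rewrite -quot_projZ. Qed.

Lemma pi0 : pi 0 = 0.
Proof. by apply: (addrI (pi 0)); rewrite -piD !addr0. Qed.

Lemma pi_sum (I : Type) (r : seq I) (E : I -> kF) : pi (\sum_(i <- r) E i) = \sum_(i <- r) pi (E i).
Proof. exact: (big_morph _ piD pi0). Qed.

Lemma pi_eq0 f : pi f = 0 <-> ideal_gen Rel f.
Proof.
rewrite -pi0; split=> [/quot_projP|h]; first by rewrite subr0 => /asboolP.
by apply/quot_projP; rewrite subr0; apply/asboolP.
Qed.

Lemma pi_Phi f : pi (Phi f) = pi f.
Proof. by apply/quot_projP/asboolP; exact: Phi_mod. Qed.

Lemma Phi_pi f f' : pi f = pi f' -> Phi f = Phi f'.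
Proof.
move=> /quot_projP /asboolP /Phi_ideal; rewrite lextB => /eqP.
by rewrite subr_eq0 => /eqP.
Qed.

Lemma Phi_idem f : Phi (Phi f) = Phi f.
Proof. by apply: Phi_pi; apply: pi_Phi. Qed.

Lemma argmax (T : eqType) (s : seq T) (m : T -> nat) : s <> [::] ->
  exists2 i, i \in s & forall j, j \in s -> (m j <= m i)%N.
Proof.
elim: s => // i s IH _; have [->|/eqP sn] := eqVneq s [::].
  by exists i; rewrite ?mem_head // => j; rewrite mem_seq1 => /eqP ->.
have [i0 i0s h] := IH sn; have [le|lt] := leqP (m i0) (m i).
  exists i; rewrite ?mem_head // => j; rewrite inE => /orP [/eqP -> //|/h h'].
  exact: leq_trans h' le.
by exists i0; rewrite ?inE ?i0s ?orbT // => j; rewrite inE => /orP [/eqP -> |/h //]; apply: ltnW.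
Qed.

Lemma uniq_map_inj (T T' : eqType) (f : T -> T') (s : seq T) : uniq (map f s) ->
  {in s &, injective f}.
Proof.
elim: s => // i s IH /= /andP [ns us] j l; rewrite !inE.
move=> /orP [/eqP ->|js] /orP [/eqP -> //|ls] e.
- by move: ns; rewrite e map_f.
- by move: ns; rewrite -e map_f.
- exact: IH.
Qed.

(* Families in echelon form: the word [t.2] has maximal weight in [t.1] and
   occurs in no other element. *)
Definition pivots (N0 : set kF) (P : seq (kF * F)) : Prop :=
  [/\ uniq (map snd P), forall t, t \in P -> N0 t.1,
    forall t t', t \in P -> t' \in P -> t.1@_(t'.2) = (t.2 == t'.2)%:R &
    forall t V, t \in P -> V \in gsupp t.1 -> (wF V <= wF t.2)%N].

Definition pexp (P : seq (kF * F)) f : kF := \sum_(t <- P) f@_(t.2) *: t.1.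

Lemma mcoeff_pexp N0 P f t : pivots N0 P -> t \in P -> (pexp P f)@_(t.2) = f@_(t.2).
Proof.
move=> [uP _ dP _] tP; rewrite /pexp raddf_sum /= (bigD1_seq t tP (map_uniq uP)) /=.
rewrite -[RHS]addr0; congr (_ + _); first by rewrite mcoeffZ (dP t t tP tP) eqxx mulr1.
apply: big1_seq => t' /andP [nt t'P].
rewrite mcoeffZ dP //; case: eqVneq => [e|_]; last exact: mulr0.
by case/eqP: nt; apply: (uniq_map_inj uP).
Qed.

(** Subtract from [f] its expansion, take a heaviest word of the rest as new pivot and clear it from
    the old elements. An old element changes only if it contains the new pivot, so the words added
    to it are no heavier than its own pivot. *)
Lemma pivot_ext (N0 : set kF) P f : is_subspace N0 -> pivots N0 P -> N0 f -> f <> pexp P f ->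
  exists P', pivots N0 P' /\ size P' = (size P).+1.
Proof.
move=> sN pP Nf nf; have [uP NP dP wP] := pP.
set f' := f - pexp P f.
have Nf' : N0 f'.
  rewrite /f' -scaleN1r addrC; apply: sN.2 => //; rewrite /pexp.
  by apply: (subspace_sum sN) => t tP; apply: subspaceZ => //; apply: NP.
have f'0 t : t \in P -> f'@_(t.2) = 0.
  by move=> tP; rewrite mcoeffB (mcoeff_pexp f pP tP) subrr.
have [U Uf' maxU] : exists2 U, U \in enum_fset (gsupp f') & forall V,
  V \in enum_fset (gsupp f') -> (wF V <= wF U)%N.
  apply: argmax => e; apply: nf; apply/eqP; rewrite -subr_eq0; apply/eqP/malgP => V.
  rewrite mcoeff0; apply/eqP; rewrite -[_ == _]negbK -gsuppE; apply/negP => h.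
  have : V \in enum_fset (gsupp f') by []. by rewrite e.
have fU : f'@_U != 0 by rewrite -gsuppE.
have nU t : t \in P -> t.2 != U.
  by move=> tP; apply/eqP => e; move: fU; rewrite -e f'0 ?eqxx.
pose f2 : kF := (f'@_U)^-1 *: f'.
have f2U : f2@_U = 1 by rewrite mcoeffZ mulVf.
have f20 t : t \in P -> f2@_(t.2) = 0 by move=> tP; rewrite mcoeffZ f'0 ?mulr0.
have Nf2 : N0 f2 by apply: subspaceZ.
have f2w V : V \in gsupp f2 -> (wF V <= wF U)%N.
  rewrite gsuppE mcoeffZ mulf_eq0 negb_or -gsuppE => /andP [_ h]; exact: maxU.
pose h (t : kF * F) : kF * F := (t.1 - t.1@_U *: f2, t.2).
exists ((f2, U) :: map h P); split; last by rewrite /= size_map.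
have hU t : t \in P -> (h t).1@_U = 0 by move=> tP; rewrite mcoeffB mcoeffZ f2U mulr1 subrr.
split.
- rewrite /= -map_comp; apply/andP; split; last exact: uP.
  by apply/mapP => -[t tP e]; move: (nU t tP); rewrite e eqxx.
- move=> t; rewrite inE => /orP [/eqP -> //|/mapP [t0 t0P ->]] /=.
  rewrite addrC -scaleN1r scalerA; apply: sN.2 => //; exact: NP.
- move=> t t'; rewrite !inE => /orP [/eqP ->|/mapP [t0 t0P ->]] /orP [/eqP ->|/mapP [t1 t1P ->]] /=.
  + by rewrite f2U eqxx.
  + by rewrite f20 // eq_sym (negPf (nU _ t1P)).
  + by rewrite -/((h t0).1) hU // (negPf (nU _ t0P)).
  + by rewrite mcoeffB mcoeffZ f20 // mulr0 subr0 dP.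
- move=> t V; rewrite inE => /orP [/eqP -> /f2w //|/mapP [t0 t0P ->]] /=.
  rewrite gsuppE mcoeffB mcoeffZ => n0.
  have [z0|n1] := eqVneq t0.1@_V 0; last by apply: wP => //; rewrite gsuppE.
  rewrite z0 sub0r oppr_eq0 mulf_eq0 negb_or in n0; case/andP: n0 => nU0 nV.
  apply: (@leq_trans (wF U)); first by apply: f2w; rewrite gsuppE.
  by apply: wP => //; rewrite gsuppE.
Qed.

Lemma pexp_lc P f : exists c, pexp P f = lc c (map fst P).
Proof.
elim: P => [|t P [c e]]; first by exists (fun=> 0); rewrite /pexp big_nil.
exists (fun i => if i is i'.+1 then c i' else f@_(t.2)).
by rewrite /= -e /pexp big_cons.
Qed.

Lemma pivots_ex (N0 : set kF) (n : nat) (b : 'I_n -> kF) : is_subspace N0 ->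
  (forall i, N0 (b i)) ->
  (forall c : 'I_n -> k, \sum_(i <- enum 'I_n) c i *: b i = 0 -> forall i, i \in enum 'I_n ->
    c i = 0) ->
  exists P, pivots N0 P /\ size P = n.
Proof.
move=> sN Nb ib; suff h m : (m <= n)%N -> exists P, pivots N0 P /\ size P = m by apply: h.
elim: m => [|m IH] lt; first by exists [::].
have [P [pP sz]] := IH (ltnW lt).
have [|/existsNP [f /not_implyP [Nf nf]]] := EM (forall f, N0 f -> f = pexp P f); last first.
  by have [P' [pP' sz']] := pivot_ext sN pP Nf nf; exists P'; rewrite sz' sz.
move=> all; exfalso.
have H : (size (enum 'I_n) <= size (map fst P))%N.
  apply: (@steinitz _ _ _ (enum 'I_n) b _ (enum_uniq _) ib) => i _.
  by rewrite (all _ (Nb i)); apply: pexp_lc.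
by move: H; rewrite size_map size_enum_ord sz leqNgt lt.
Qed.

Definition starts x p : Prop := forall V, V \in gsupp p ->
  (forall V', V' \in gsupp p -> (wF V' <= wF V)%N) -> exists r, letters V = x :: r.

(** The heaviest words of all summands taken together begin with different letters in different
    summands, hence cannot cancel. *)
Lemma starts_sum (xs : seq L) (pf : L -> kF) : uniq xs -> (forall x, x \in xs -> starts x (pf x)) ->
  \sum_(x <- xs) pf x = 0 -> forall x, x \in xs -> pf x = 0.
Proof.
move=> uxs st s0.
pose S := [seq (x, V) | x <- xs, V <- enum_fset (gsupp (pf x))].
have inS x V : ((x, V) \in S) = (x \in xs) && (V \in gsupp (pf x)).
  apply/allpairsPdep/andP => [[x' [V' [x'x V'V [-> ->]]]] //|[xx VV]].
  by exists x, V.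
have [Se|/eqP Sn] := eqVneq S [::].
  move=> x xx; apply/malgP => V; rewrite mcoeff0; apply/eqP; rewrite -[_ == _]negbK -gsuppE.
  apply/negP => VV; have : (x, V) \in S by rewrite inS xx.
  by rewrite Se.
exfalso; have [[x V] xVS mx] := @argmax _ S (fun t => wF t.2) Sn.
move: (xVS); rewrite inS => /andP [xx VV].
have big x' V' : x' \in xs -> V' \in gsupp (pf x') -> (wF V' <= wF V)%N.
  by move=> x'x V'V; apply: (mx (x', V')); rewrite inS x'x.
have [r eV] := st x xx V VV (fun V' h => big x V' xx h).
have : (\sum_(x <- xs) pf x)@_V = 0 by rewrite s0 mcoeff0.
rewrite raddf_sum /= (bigD1_seq x xx uxs) /= big1_seq ?addr0 => [|x' /andP [nx x'x]].
  by move=> e; move: VV; rewrite gsuppE e eqxx.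
apply/eqP; rewrite -[_ == _]negbK -gsuppE; apply/negP => VV'.
have [r' eV'] := st x' x'x V VV' (fun V' h => big x' V' x'x h).
by move: nx; move: eV'; rewrite eV => -[-> _]; rewrite eqxx.
Qed.

Lemma gsupp_lmul g f U : (U \in gsupp (gmon k g * f)) = ((g^-1 * U)%g \in gsupp f).
Proof. by rewrite trE1 gsupp_tr invg1 mulg1. Qed.

(** * Multiplying an echelon family by one marker *)

Section Pivots.
Variables (gl y : L) (A Z Y : seq L) (N0 : set kF) (P : seq (kF * F)) (c : kF * F -> k).
Hypotheses (mk : marker gl y A Z Y) (pP : pivots N0 P)
  (PhiP : forall t, t \in P -> Phi t.1 = t.1).
Local Notation s := (wd (Y ++ gl :: winv Z)).
Local Notation ok := (fun t : kF * F => ~~ prefix Z (letters t.2)).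

Definition pcomb : kF := \sum_(t <- P | ok t) c t *: t.1.

Lemma mcoeff_pcomb t : t \in P -> ok t -> pcomb@_(t.2) = c t.
Proof.
have [uP _ dP _] := pP; move=> tP okt.
rewrite /pcomb -big_filter raddf_sum /= (bigD1_seq t) /=; first last.
- exact: filter_uniq (map_uniq uP).
- by rewrite mem_filter tP andbT.
rewrite -[RHS]addr0; congr (_ + _); first by rewrite mcoeffZ (dP t t tP tP) eqxx mulr1.
apply: big1_seq => t' /andP [nt]; rewrite mem_filter => /andP [_ t'P].
rewrite mcoeffZ dP //; case: eqVneq => [e|_]; last exact: mulr0.
by case/eqP: nt; apply: (uniq_map_inj uP).
Qed.

Lemma Phi_pcomb : Phi pcomb = pcomb.
Proof.
rewrite /pcomb -big_filter lext_sum; apply: eq_big_seq => t; rewrite mem_filter => /andP [_ tP].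
by rewrite lextZ PhiP.
Qed.

Lemma pcomb_supp U : U \in gsupp pcomb -> exists t, [/\ t \in P, ok t,
  c t != 0 & (wF U <= wF t.2)%N].
Proof.
have [_ _ _ wP] := pP; move=> Us; apply: contrapT => no; move: Us; rewrite gsuppE => /eqP; apply.
rewrite /pcomb -big_filter raddf_sum /=; apply: big1_seq => t /andP [_];
  rewrite mem_filter => /andP [okt tP].
rewrite mcoeffZ; have [->|ct] := eqVneq (c t) 0; first exact: mul0r.
have [->|n0] := eqVneq t.1@_U 0; first exact: mulr0.
by exfalso; apply: no; exists t; split=> //; apply: wP => //; rewrite gsuppE.
Qed.

(** Left multiplication by [s] is invertible modulo the ideal, and [pcomb] is its own normal
    form. *)
Lemma Phi_back : Phi (gmon k s^-1%g * Phi (gmon k s * pcomb)) = pcomb.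
Proof.
rewrite -[RHS]Phi_pcomb; apply: Phi_pi; apply/quot_projP/asboolP.
rewrite gmon_subK.
by have [_ _ h _] := ideal_gen_ideal Rel; apply: h; apply: Phi_mod.
Qed.

Lemma pcomb_zero t : Phi (gmon k s * pcomb) = 0 -> t \in P -> ok t -> c t = 0.
Proof.
move=> e tP okt; rewrite -(mcoeff_pcomb tP okt).
have e1 : Phi (gmon k s^-1%g * 0) = pcomb by rewrite -{1}e; exact: Phi_back.
have e2 : gmon k s^-1%g * 0 = 0 by exact: mulr0.
rewrite e2 lext0 in e1.
by rewrite -e1 mcoeff0.
Qed.

(** By [Phi_back] weights compare in both directions, so a heaviest word [V] has the weight of some
    [s U0] with [U0] in [pcomb]. A heaviest pivot with non-zero coefficient shows that this weight
    exceeds that of [U0]. The thinness of [A^-1] gives the comparison of [A^-1 V] required by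
    [marker_head]. *)
Lemma pcomb_starts : starts y (Phi (gmon k s * pcomb)).
Proof.
have [_ _ _ [_ _ _ ths thA]] := mk.
have th1 : thin 1%g by move=> a d b; case: a => //; case: d => // _ _; exact: cov0.
move=> V Vs maxV.
have back U : U \in gsupp pcomb -> (wF (s * U)%g <= wF V)%N.
  rewrite -{1}Phi_back => /Phi_weight [V']; rewrite gsupp_lmul invgK => V's /(_ s ths) h.
  by apply: leq_trans h (maxV _ V's).
have [U] := Phi_weight Vs; rewrite gsupp_lmul => Us h.
set U0 := (s^-1 * U)%g in Us; have eU : U = (s * U0)%g by rewrite mulVKg.
rewrite eU in h; have h1 := h _ th1; rewrite !mul1g in h1.
have eV : wF V = wF (s * U0)%g by apply/eqP; rewrite eqn_leq h1 back.
have [t0 [t0P ok0 c0 _]] := pcomb_supp Us.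
pose S := [seq t <- P | ok t && (c t != 0)].
have Sn : S <> [::].
  move=> S0; have : t0 \in S by rewrite mem_filter ok0 c0.
  by rewrite S0.
have [t tS mx] := argmax (fun t => wF t.2) Sn.
move: tS; rewrite mem_filter => /andP [/andP [okt ct] tP].
have tU : t.2 \in gsupp pcomb by rewrite gsuppE mcoeff_pcomb.
have lt1 := (marker_away mk okt).1.
have leU : (wF U0 <= wF t.2)%N.
  have [t1 [t1P ok1 c1 le1]] := pcomb_supp Us; apply: leq_trans le1 _.
  by apply: mx; rewrite mem_filter ok1 c1.
apply: (marker_head mk _ eV); last by have := h _ thA.
by rewrite -eV; apply: leq_ltn_trans leU _; apply: leq_trans lt1 (back _ tU).
Qed.

End Pivots.

Lemma allowed_count (ys : seq L) (Zf : L -> seq L) U : uniq ys ->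
  (forall y, y \in ys -> exists z, Zf y = y :: z) ->
  (count (fun y => prefix (Zf y) (letters U)) ys <= 1)%N.
Proof.
move=> uy hZ; case eU: (letters U) => [|x r].
  rewrite (eq_in_count (a2 := pred0)) ?count_pred0 // => y /hZ [z ->] //.
apply: (@leq_trans (count_mem x ys)); last by rewrite count_uniq_mem // leq_b1.
have -> : count (fun y => prefix (Zf y) (x :: r)) ys =
    count (fun y => (y \in ys) && prefix (Zf y) (x :: r)) ys.
  by apply: eq_in_count => y yy; rewrite yy.
apply: sub_count => y /andP [/hZ [z ->]]; rewrite prefix_cons => /andP [/eqP <- _].
by rewrite /= eqxx.
Qed.

Lemma free_product_count (ys : seq L) (Zf : L -> seq L) (P : seq (kF * F)) : size ys = 3%N ->
  uniq ys ->
  (forall y, y \in ys -> exists z, Zf y = y :: z) ->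
  (2 * size P <= size [seq (y, t) | y <- ys, t <- [seq t <- P | ~~ prefix (Zf y) (letters t.2)]])%N.
Proof.
move=> sz uy hZ; rewrite size_allpairs_dep.
elim: P => [|t P IH]; first by rewrite muln0.
apply: (@leq_trans (2 + sumn [seq size [seq t <- P | ~~ prefix (Zf y) (letters t.2)] | y <- ys])).
  by rewrite mulnS leq_add2l.
have -> : sumn [seq size [seq t0 <- t :: P | ~~ prefix (Zf y) (letters t0.2)] | y <- ys] =
  (count (fun y => ~~ prefix (Zf y) (letters t.2)) ys +
   sumn [seq size [seq t <- P | ~~ prefix (Zf y) (letters t.2)] | y <- ys])%N.
  elim: (ys) => //= y r ->; case: (prefix _ _) => /=; lia.
have H (i j : nat) : (i <= 1)%N -> (i + j = 3)%N -> (2 <= j)%N by lia.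
rewrite leq_add2r; apply: (H _ _ (allowed_count t.2 uy hZ)).
by rewrite -sz; exact: count_predC.
Qed.

Lemma has_dim_sub (V : lmodType k) (W : set V) n (e : 'I_n -> V) :
  (forall u, W u -> exists! c : {ffun 'I_n -> k}, [set 0] (u - \sum_(i < n) c i *: e i)) ->
  (forall i, W (e i)) -> is_subspace W ->
  forall c : 'I_n -> k, \sum_(i < n) c i *: e i = 0 -> forall i, c i = 0.
Proof.
move=> h We [W0 _] c s0 i; have [d [_ ud]] := h 0 W0.
have e1 : d = [ffun=> 0].
  apply: ud; rewrite /= big1 ?subr0 // => j _; by rewrite ffunE scale0r.
have e2 : d = [ffun j => c j].
  apply: ud; rewrite /= (eq_bigr (fun j => c j *: e j)) ?s0 ?subr0 // => j _.
  by rewrite ffunE.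
by have /ffunP /(_ i) := etrans (esym e2) e1; rewrite !ffunE.
Qed.

Lemma markers_ex : ~ cyclic_group F -> (exists u : F, u <> 1%g /\ ~ Mon Rel u) ->
  exists (gl : L) (ys : seq L) (Af Zf Yf : L -> seq L), [/\ size ys = 3%N, uniq ys &
  forall y, y \in ys -> marker gl y (Af y) (Zf y) (Yf y)].
Proof.
move=> hF hproper.
have [v [vn rv nM mv]] := minimal_word hproper.
have [l0 [v0 ev]] : exists l v0, v = l :: v0 by case: (v) vn => // l v0 _; exists l, v0.
have [v1 [l1 ev1]] : exists v1 l, v = rcons v1 l.
  by case/lastP: (v) vn => // v1 l1 _; exists v1, l1.
have [xh nh] := other_generator hF l0.1; have [xg ng] := other_generator hF l1.1.
pose h : L := (xh, false); pose g : L := (xg, false).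
have hg s l : v = rcons s l -> g.1 <> l.1.
  by rewrite ev1 => /rcons_inj [_ <-].
have hh l s : v = l :: s -> h.1 <> l.1 by rewrite ev => -[<- _].
(* [marker_ex] excludes only the letter [linv h]. The generator of [h] differs from that of [l0], so
   these three letters are distinct and allowed. *)
pose ys := [:: l0; linv l0; h].
have ny y : y \in ys -> y <> linv h.
  rewrite !inE => /or3P [] /eqP -> e; [apply: nh|apply: nh|].
  - by rewrite e.
  - by have := congr1 fst e.
  - by move/eqP: (linv_neq h); apply.
have mk y : y \in ys -> exists t : seq L * seq L * seq L, marker g y t.1.1 t.1.2 t.2.
  move=> /ny; move/(marker_ex vn rv nM mv hg hh) => [A [Z [Y m]]].
  by exists (A, Z, Y).
pose T y := if pselect (exists t : seq L * seq L * seq L, marker g y t.1.1 t.1.2 t.2) is left ex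
  then projT1 (cid ex) else ([::], [::], [::]).
exists g, ys, (fun y => (T y).1.1), (fun y => (T y).1.2), (fun y => (T y).2); split=> //.
  rewrite /= !inE !negb_or andbT; apply/andP; split; [apply/andP; split|].
  - by rewrite eq_sym linv_neq.
  - by apply/eqP => e; apply: nh; rewrite e.
  - by apply/eqP => e; apply: nh; rewrite -[LHS]/(h.1) -e.
move=> y /mk ex; rewrite /T; case: pselect => // ex'; exact: (projT2 (cid ex')).
Qed.

Lemma pi_lmul_sum (I : Type) (r : seq I) (c : I -> k) (E : I -> kF) (a : kF) :
  pi (a * \sum_(i <- r) c i *: E i) = \sum_(i <- r) c i *: pi (a * E i).
Proof. exact: (linear_lmul_sum piD piZ). Qed.

(** * The dimension count *)

Section Nonamenable.
Variables (gl : L) (ys : seq L) (Af Zf Yf : L -> seq L).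
Hypotheses (sz : size ys = 3%N) (uy : uniq ys)
  (mk : forall y, y \in ys -> marker gl y (Af y) (Zf y) (Yf y)).
Local Notation sw := (fun y => wd (Yf y ++ gl :: winv (Zf y))).
Local Notation sQ := (fun y => pi (gmon k (sw y))).
Local Notation kmul := (@kalg_mul k (quotient_algebra Rel)).

Lemma product_free (N0 : set kF) (P : seq (kF * F)) : pivots N0 P ->
  (forall t, t \in P -> Phi t.1 = t.1) ->
  let S := [seq (y, t) | y <- ys, t <- [seq t <- P | ~~ prefix (Zf y) (letters t.2)]] in
  forall c : L * (kF * F) -> k,
  \sum_(t <- S) c t *: pi (gmon k (sw t.1) * t.2.1) = 0 -> forall t, t \in S -> c t = 0.
Proof.
move=> pP PhiP S c s0.
pose cy y (t : kF * F) := c (y, t).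
have e0 : pi (\sum_(y <- ys) gmon k (sw y) * pcomb (Zf y) P (cy y)) = 0.
  rewrite -[RHS]s0 big_allpairs_dep pi_sum; apply: eq_bigr => y _ /=.
  rewrite /pcomb -[in LHS]big_filter; exact: (pi_lmul_sum _ (cy y) fst).
have e1 : \sum_(y <- ys) Phi (gmon k (sw y) * pcomb (Zf y) P (cy y)) = 0.
  by rewrite -lext_sum; apply: Phi_ideal; apply/pi_eq0.
have z := starts_sum uy _ e1.
move=> t /allpairsPdep [y [t' [yy]]]; rewrite mem_filter => /andP [okt t'P ->].
apply: (pcomb_zero (c := cy y) pP PhiP _ t'P okt); apply: z => // y' y'y.
exact: pcomb_starts (mk y'y) pP PhiP.
Qed.

Section Dimension.
Variables (H : set Q) (n : nat) (e : 'I_n -> Q).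
Hypotheses (sH : is_subspace H) (He : forall i, H (e i))
  (hb : forall u, H u -> exists! c : {ffun 'I_n -> k}, [set 0] (u - \sum_(i < n) c i *: e i)).

Lemma span_e u : H u -> exists c : 'I_n -> k, u = \sum_(i <- enum 'I_n) c i *: e i.
Proof.
move=> /hb [c [/= h _]]; exists c; rewrite big_enum; apply/eqP; rewrite -subr_eq0.
by apply/eqP; exact: h.
Qed.

(** Normal forms are a linear section of the quotient map, so a basis of [H] lifts to independent
    elements, from which the echelon family is obtained. *)
Lemma pivots_of_dim : exists P, [/\ pivots [set f | H (pi f) /\ Phi f = f] P & size P = n].
Proof.
set N0 := [set f | _].
have sN : is_subspace N0.
  split=> [|a f1 f2 [h1 p1] [h2 p2]]; first by rewrite /N0 /= pi0 lext0; split=> //; case: sH.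
  by rewrite /N0 /= piD piZ lextD lextZ p1 p2; split=> //; apply: sH.2.
pose b i : kF := Phi (quot_repr (e i)).
have pib i : pi (b i) = e i by rewrite pi_Phi quot_projK.
have [||P [pP sP]] := @pivots_ex N0 n b sN.
- by move=> i; rewrite /N0 /= pib Phi_idem.
- move=> c s0 i _; apply: (has_dim_sub hb He sH); have := congr1 pi s0.
  rewrite pi0 pi_sum big_enum => s1; rewrite -[RHS]s1; apply: eq_bigr => j _.
  by rewrite piZ pib.
by exists P.
Qed.

Definition prods y : seq Q := [seq kmul (sQ y) (e i) | i <- enum 'I_n].

Definition addset y : set Q := [set x + kmul (sQ y) z | x in H & z in H].

Lemma kmul_sum y (c : 'I_n -> k) : kmul (sQ y) (\sum_(i <- enum 'I_n) c i *: e i) =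
  \sum_(i <- enum 'I_n) c i *: kmul (sQ y) (e i).
Proof. exact: kalg_mul_sumr. Qed.

Lemma addsetE y u : addset y u <-> in_span H (prods y) u.
Proof.
split=> [[x Hx [z Hz <-]]|[c hc]].
  have [c ->] := span_e Hz; rewrite kmul_sum.
  have [c' ec] := lspan_map (enum 'I_n) (fun i => kmul (sQ y) (e i)) c.
  by exists c'; rewrite -/(prods y) in ec; rewrite ec addrK.
exists (u - lc c (prods y)); first exact: hc.
have [|c' ec] := @map_lspan k Q _ (enum 'I_n) (fun i => kmul (sQ y) (e i)) (lc c (prods y))
  (enum_uniq _).
  by exists c.
exists (\sum_(i <- enum 'I_n) c' i *: e i).
  by apply: (subspace_sum sH) => i _; apply: subspaceZ.
by rewrite kmul_sum -ec subrK.
Qed.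

Lemma large_product : exists y (r : seq Q), [/\ y \in ys, has_dim_quotient (addset y) H (size r) &
  (n <= 3 * size r)%N].
Proof.
have [rb hrb] : {rb : L -> seq Q | forall y, ind H (rb y) /\
    forall u, in_span H (prods y) u <-> in_span H (rb y) u}.
  exists (fun y => projT1 (cid (basis_ex (prods y) sH))) => y.
  exact: (projT2 (cid (basis_ex (prods y) sH))).
have [P [pP sP]] := pivots_of_dim.
have PhiP t : t \in P -> Phi t.1 = t.1 by case: pP => _ h _ _ /h [].
have HP t : t \in P -> H (pi t.1) by case: pP => _ h _ _ /h [].
have hZ y : y \in ys -> exists z, Zf y = y :: z by move=> /mk [_ [_ [z ->]] _ _]; exists z.
have cnt := free_product_count P sz uy hZ.
have free := product_free pP PhiP.
set S := [seq (y, t) | y <- ys, t <- _] in cnt; rewrite -/S /= in free.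
have uS : uniq S.
  apply: allpairs_uniq_dep => //; last by move=> [y t] [y' t'] _ _ /= [-> ->].
  by move=> y yy; apply: filter_uniq; case: pP => /map_uniq.
(* A basis of [H] followed by lifts of bases of the quotients of [addset y] by [H]. This list spans
   all the independent products, hence is at least as long as [S]. *)
pose G := [seq e i | i <- enum 'I_n] ++ flatten [seq rb y | y <- ys].
have le : (size S <= size G)%N.
  apply: (steinitz uS free) => t /allpairsPdep [y [t' [yy]]].
  rewrite mem_filter => /andP [_ t'P ->] /=.
  have : addset y (pi (gmon k (sw y) * t'.1)).
    exists 0; first by case: sH.
    exists (pi t'.1); first exact: HP.
    by rewrite add0r; apply: quot_projM.
  move=> /addsetE /(proj2 (hrb y) _) [c hc].
  have [c1 e1] := span_e hc.
  have l1 : lspan [seq e i | i <- enum 'I_n] (pi (gmon k (sw y) * t'.1) - lc c (rb y)).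
    by rewrite e1; apply: lspan_map.
  have l2 : lspan (flatten [seq rb y | y <- ys]) (lc c (rb y)).
    by apply: lspan_flatten yy _; exists c.
  by have := lspan_cat l1 l2; rewrite subrK.
have ysn : ys <> [::] by move=> y0; move: sz; rewrite y0.
have [y yy my] := sumn_max (fun y => size (rb y)) ysn.
exists y, (rb y); split=> //.
  apply: (ind_has_dim sH (proj1 (hrb y))) => u; rewrite -(proj2 (hrb y)); exact: addsetE.
rewrite sz in my; apply: leq_trans my; rewrite -(leq_add2l n) addnn -mul2n.
rewrite -{1}sP; apply: leq_trans cnt _; apply: leq_trans le _.
by rewrite /G size_cat size_map size_enum_ord size_flatten /shape -map_comp.
Qed.

End Dimension.

Lemma nonamenable_quotient : nonamenable R (quotient_algebra Rel).
Proof.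
exists 3^-1; split; first by rewrite invr_gt0 ltr0n.
exists (lspan (map sQ ys)); split; first exact: lspan_findim.
move=> H [sH [n [e [He hb]]]] Hn.
have n0 : (0 < n)%N.
  rewrite lt0n; apply/eqP => n0; apply: Hn; apply/seteqP; split=> u; last first.
    by move=> ->; case: sH.
  by subst n => /hb [c [/= h _]]; move: h; rewrite big_ord0 subr0.
have [y [r [yy hd le]]] := large_product sH He hb.
exists (sQ y); split; first by apply: lspan_mem; apply: map_f.
exists (size r), n; split=> //; first by exists e.
by rewrite ler_pdivlMr ?ltr0n // mulrC ler_pdivrMr ?ltr0n // -natrM ler_nat mulnC.
Qed.

End Nonamenable.

End Amenability.

End SmallCancellation.

Local Open Scope ring_scope.
Local Open Scope classical_set_scope.

Theorem theorem4 (R : realType) (k : fieldType) (X : choiceType)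
  (hF : ~ cyclic_group (free_group X))
  (Rel : set (group_algebra k (free_group X)))
  (hcompat : compatibility_axiom Rel)
  (tau : R) (htau : 16 <= tau)
  (hsc : strong_small_cancellation_axiom Rel (tau + 10))
  (hisol : isolation_axiom Rel tau)
  (hproper : exists w : free_group X, w <> 1%g /\ ~ Mon Rel w)
  (hsym : forall u : free_group X, Mon Rel u -> Mon Rel (u^-1)%g ->
    measure' R Rel u = measure' R Rel (u^-1)%g) :
  nonamenable R (quotient_algebra Rel).
Proof.
have [gl [ys [Af [Zf [Yf [sz uy mk]]]]]] := markers_ex hcompat htau hsym hF hproper.
exact: (nonamenable_quotient hcompat htau hsc hisol.2 hsym sz uy mk).
Qed.
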